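(* The rectilinear crossing number of the complete graph $K_{30}$ is $\overline{\mathrm{cr}}(K_{30})=9726$.
   Context: A geometric drawing of a graph is a drawing in the plane in which the vertices are points in general position and the edges are straight line segments. The rectilinear crossing number $\overline{\mathrm{cr}}(G)$ of a graph $G$ is the minimum number of edge crossings over all geometric drawings of $G$. *)

(* Defs.v *)
From HB Require Import structures.
From mathcomp Require Import all_boot all_order all_algebra.
From mathcomp Require Import boolp reals.
Set Implicit Arguments. Unset Strict Implicit. Unset Printing Implicit Defensive.
Import Order.TTheory GRing.Theory Num.Theory.
Local Open Scope ring_scope.

Definition point (R : realType) := (R * R)%type.

Definition orient (R : realType) (a b c : point R) : R :=
  (b.1 - a.1) * (c.2 - a.2) - (b.2 - a.2) * (c.1 - a.1).

Definition general_position (R : realType) (n : nat) (p : 'I_n -> point R) : Prop :=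
  injective p /\
  (forall i j k : 'I_n, i != j -> j != k -> i != k -> orient (p i) (p j) (p k) != 0).

Definition segments_meet (R : realType) (a b c d : point R) : Prop :=
  exists t s : R, [/\ 0 <= t <= 1, 0 <= s <= 1,
    a.1 + t * (b.1 - a.1) = c.1 + s * (d.1 - c.1) &
    a.2 + t * (b.2 - a.2) = c.2 + s * (d.2 - c.2)].

(* Number of crossings of the geometric drawing of K_n with vertices p:
   unordered pairs of edges {i,j}, {k,l} with four distinct endpoints whose
   segments meet.  Each such pair is counted once via the normalisation
   i < j, k < l, i < k. *)
Definition crossings (R : realType) (n : nat) (p : 'I_n -> point R) : nat :=
  #|[set q : 'I_n * 'I_n * 'I_n * 'I_n |
      let: (i, j, k, l) := q in
      [&& (i < j)%N, (k < l)%N, (i < k)%N, i != l, j != k, j != l &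
          `[< segments_meet (p i) (p j) (p k) (p l) >]]]|.

Definition rectilinear_crossing_number_Kn (R : realType) (n c : nat) : Prop :=
  (exists p : 'I_n -> point R, general_position p /\ crossings p = c) /\
  (forall p : 'I_n -> point R, general_position p -> (c <= crossings p)%N).

(* Main.v *)
(* Order the wires (points) by their projections on a rotating direction: in half a
   turn every pair is swapped once, at a moment when it is adjacent, and the number
   of wires before it, the gate of the swap, is the number of points on one side of
   the line through the pair.  A linear relation between the orientations of four
   points expresses the number of crossings by the gates, and it remains to bound
   from below the number E k of swaps with gate < k in a full turn.

   Removing three suitable hull points from a set of c points loses at least
   6 k - 3 + max(0, 3 k - c) of these swaps and lowers k by 2; iterating gives E k
   for k <= 13.  Between two swaps at the middle gate 14 there is one at gate 13 or
   15, which bounds E 14 by 363 and the crossing number by 9723.  An excess anywhere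
   below 14 already gives 9726, so let all bounds be attained; then it suffices that
   a half turn contains at most 69 swaps at gate 14 (halving lines).

   Tightness at k = 2 and k = 10 splits the points into classes A, B, C of ten, in
   the orders ABC, BAC, BCA at three times of a half turn.  The four central
   positions undergo 144 internal swaps and 48 events, that is, exchanges with the
   outside on the left (L) or on the right (R); counting shows that a wire leaves the
   centre only after crossing its three companions.  Hence in every class the wires
   that meet no other class in the centre pass through it in a block LLLLRRRR of
   consecutive events, and the eight events between the blocks of two consecutive
   phases form, up to reflection, a word p with three L, no two of them adjacent.
   A finite automaton shows that RRRR p RRRR forces two side swaps (gates 13, 15)
   with no middle swap in between to occur twice, or once if p starts and ends with
   L.  Two consecutive phases cannot end and start with L respectively, so the three
   phases contain at least five such repetitions, and 144 - 2 h >= 5 for the number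
   h of halving lines. *)

From Stdlib Require Import ZArith.
Require Import Defs.
From mathcomp Require Import all_boot all_order all_algebra.
From mathcomp Require Import boolp reals zify ssrZ ring lra.
Set Implicit Arguments. Unset Strict Implicit. Unset Printing Implicit Defensive.

(** * Allowable sequences *)

(** By [crossings_formula], having at least 9726 crossings means that the product of the two side
    counts, summed over the 435 lines, is at most 72489. By [gate_weight] this is the inequality [27
    * E 1 + 25 * E 2 + ... + 3 * E 13 + E 14 >= 12771], with weight [29 - 2 * k] at [k]. Peeling and
    the alternation at the middle gate together give 12768. The missing three units explain the case
    split: every weight below 14 is at least 3, but the weight at 14 is 1, so there the bound itself
    must rise by three.

    Time is a natural number and not a point of a circle. The record of central crossings starts
    empty at time 0 and forgets this start only when every wire has left the centre; hence the
    recurring assumption [M <= t].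

    The classes play symmetric roles: [dec_shift] advances by half a turn and one phase and renames
    ABC to CAB. Statements are therefore proved for [A] between [c1] and [c3] only, and applied to
    shifted decompositions. *)

Lemma sum_nat_period (f : nat -> nat) P a :
  (forall t, f (t + P) = f t) ->
  \sum_(a <= t < a + P) f t = \sum_(0 <= t < P) f t.
Proof.
move=> fP; elim: a => [|a IH] //.
have [->|P0] := posnP P; first by rewrite addn0 !big_geq.
rewrite -IH addSn big_nat_recr /=; last by lia.
by rewrite fP addnC -big_ltn //; lia.
Qed.

(* bef t is the order of the wires at time t; at that time lw t and rw t, adjacent
   in this order, are swapped.  A half turn consists of M swaps, reverses the order,
   and swaps every pair once. *)
Record aseq (n M : nat) := ASeq {
  bef : nat -> rel 'I_n;
  lw : nat -> 'I_n;
  rw : nat -> 'I_n;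
  bef_asym : forall t i j, bef t i j -> ~~ bef t j i;
  bef_total : forall t i j, i != j -> bef t i j || bef t j i;
  bef_trans : forall t, transitive (bef t);
  bef_lr : forall t, bef t (lw t) (rw t);
  bef_step : forall t i j, bef t.+1 i j =
    (i == rw t) && (j == lw t) || bef t i j && ~~ ((i == lw t) && (j == rw t));
  bef_period : forall t i j, bef (t + M) i j = bef t j i;
  lw_period : forall t, lw (t + M) = rw t;
  rw_period : forall t, rw (t + M) = lw t;
  swap_once : forall s t, s < t -> [set lw s; rw s] = [set lw t; rw t] ->
    s + M <= t }.

Section Basics.
Variables (n M : nat) (q : aseq n M).
Implicit Types (S : {set 'I_n}) (t s r : nat) (i j m : 'I_n).

(** Positions and gates are relative to a subset [S]: a swap with [act S t] false leaves the order
    of [S] unchanged, so peeling needs no new sequence. *)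
Definition pos S t i := #|[set m in S | bef q t m i]|.
Definition act S t := (lw q t \in S) && (rw q t \in S).
Definition gate S t := pos S t (lw q t).

Lemma bef_irr t i : bef q t i i = false.
Proof. by apply/negP => h; move: (bef_asym h); rewrite h. Qed.

Lemma befN t i j : i != j -> bef q t j i = ~~ bef q t i j.
Proof.
move=> ij; case h: (bef q t i j); first exact/negbTE/bef_asym.
by move: (bef_total q t ij); rewrite h.
Qed.

Lemma bef_neq t i j : bef q t i j -> i != j.
Proof. by apply: contraTneq => ->; rewrite bef_irr. Qed.

Lemma lr_neq t : lw q t != rw q t.
Proof. exact: bef_neq (bef_lr q t). Qed.

Lemma bef_step_swap t : bef q t.+1 (rw q t) (lw q t).
Proof. by rewrite bef_step !eqxx. Qed.

Lemma bef_step_stay t i j : [set i; j] != [set lw q t; rw q t] ->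
  bef q t.+1 i j = bef q t i j.
Proof.
move=> h; rewrite bef_step.
case: (altP (i =P rw q t)) => [ei|ni] /=.
  case: (altP (j =P lw q t)) => [ej|nj] /=; first by rewrite ei ej setUC eqxx in h.
  by rewrite ei eq_sym (negbTE (lr_neq t)) andbT.
case: (altP (i =P lw q t)) => [ei|ni2] /=; last by rewrite andbT.
case: (altP (j =P rw q t)) => [ej|nj] /=; last by rewrite andbT.
by rewrite ei ej eqxx in h.
Qed.

Lemma bef_step_other t i j : i != lw q t -> i != rw q t ->
  bef q t.+1 i j = bef q t i j.
Proof.
move=> h1 h2; apply: bef_step_stay; apply/eqP => /setP /(_ i).
by rewrite !inE eqxx (negbTE h1) (negbTE h2).
Qed.

Lemma bef_step_other2 t i j : j != lw q t -> j != rw q t ->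
  bef q t.+1 i j = bef q t i j.
Proof.
move=> h1 h2; apply: bef_step_stay; apply/eqP => /setP /(_ j).
by rewrite !inE eqxx (negbTE h1) (negbTE h2) orbT.
Qed.

Lemma bef_lr_other t m : m != lw q t -> m != rw q t ->
  bef q t m (rw q t) = bef q t m (lw q t).
Proof.
move=> h1 h2; apply/idP/idP => h; last exact: bef_trans h (bef_lr q t).
rewrite befN 1?eq_sym //; apply/negP => h'.
have a1 : bef q t.+1 (lw q t) m by rewrite bef_step_other2.
have a2 : bef q t.+1 m (rw q t) by rewrite bef_step_other.
by move: (bef_asym (bef_trans a1 a2)); rewrite bef_step_swap.
Qed.

Lemma pos_lt_mono S t i j : i \in S -> bef q t i j -> pos S t i < pos S t j.
Proof.
move=> iS ij; apply: proper_card; apply/properP; split.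
  by apply/subsetP => m; rewrite !inE => /andP[-> /=] h; apply: bef_trans h ij.
by exists i; rewrite !inE iS //= bef_irr.
Qed.

Lemma bef_pos S t i j : i \in S -> j \in S ->
  bef q t i j = (pos S t i < pos S t j).
Proof.
move=> iS jS; apply/idP/idP; first exact: pos_lt_mono.
case: (altP (i =P j)) => [->|ij]; first by rewrite ltnn.
apply: contraTT; rewrite -befN // => ji; rewrite -leqNgt ltnW //.
exact: pos_lt_mono.
Qed.

Lemma pos_inj S t i j : i \in S -> j \in S -> pos S t i = pos S t j -> i = j.
Proof.
move=> iS jS e; apply/eqP; apply: contraT => ij.
by move: (bef_total q t ij); rewrite !(bef_pos t _ _ (S := S)) // e ltnn.
Qed.

Lemma pos_lt S t i : i \in S -> pos S t i < #|S|.
Proof.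
move=> iS; apply: proper_card; apply/properP; split.
  by apply/subsetP => m; rewrite !inE => /andP[].
by exists i; rewrite // !inE bef_irr andbF.
Qed.

Lemma pos_period S t i : i \in S -> pos S (t + M) i + pos S t i = #|S|.-1.
Proof.
move=> iS; rewrite (cardsD1 i S) iS /= /pos -cardsUI.
have -> : [set m in S | bef q (t + M) m i] :&: [set m in S | bef q t m i] = set0.
  apply/setP => m; rewrite !inE bef_period; case: (m \in S) => //=.
  by apply/negP => /andP[/bef_asym /negbTE ->].
rewrite cards0 addn0.
apply: eq_card => m; rewrite !inE bef_period -andb_orr.
case: (altP (m =P i)) => [->|mi] /=; first by rewrite !bef_irr andbF.
by rewrite orbC (bef_total q t mi) andbT.
Qed.

Lemma pos_lr S t : lw q t \in S -> pos S t (rw q t) = (gate S t).+1.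
Proof.
move=> lS; rewrite /gate /pos (cardsD1 (lw q t)) !inE lS bef_lr /= add1n.
congr _.+1; apply: eq_card => m; rewrite !inE.
case: (altP (m =P lw q t)) => [->|ml] /=; first by rewrite bef_irr andbF.
case: (altP (m =P rw q t)) => [->|mr]; last by rewrite bef_lr_other.
by rewrite bef_irr (negbTE (bef_asym (bef_lr q t))).
Qed.

Lemma pos_step_other S t i : i != lw q t -> i != rw q t ->
  pos S t.+1 i = pos S t i.
Proof.
move=> h1 h2; rewrite /pos; apply: eq_card => m.
by rewrite !inE bef_step_other2.
Qed.

Lemma pos_step_r S t : pos S t.+1 (rw q t) = gate S t.
Proof.
rewrite /gate /pos; apply: eq_card => m; rewrite !inE.
case: (altP (m =P lw q t)) => [->|ml].
  by rewrite bef_irr (negbTE (bef_asym (bef_step_swap t))).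
case: (altP (m =P rw q t)) => [->|mr].
  by rewrite bef_irr (negbTE (bef_asym (bef_lr q t))).
by rewrite bef_step_other // bef_lr_other.
Qed.

Lemma pos_step_l S t : pos S t.+1 (lw q t) = gate S t + (rw q t \in S).
Proof.
rewrite /gate /pos (cardsD1 (rw q t)) !inE bef_step_swap andbT addnC.
congr (_ + _); apply: eq_card => m; rewrite !inE.
case: (altP (m =P rw q t)) => [->|mr] /=.
  by rewrite (negbTE (bef_asym (bef_lr q t))) andbF.
case: (altP (m =P lw q t)) => [->|ml]; first by rewrite !bef_irr.
by rewrite bef_step_other.
Qed.

Lemma pos_step_nact S t i : ~~ act S t -> i \in S -> pos S t.+1 i = pos S t i.
Proof.
rewrite /act; case: (altP (i =P lw q t)) => [->|il].
  by move=> h iS; rewrite iS /= in h; rewrite pos_step_l (negbTE h) addn0.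
case: (altP (i =P rw q t)) => [->|ir]; last by move=> _ _; exact: pos_step_other.
move=> h iS; rewrite iS andbT in h; rewrite pos_step_r /gate /pos.
apply: eq_card => m; rewrite !inE.
case: (altP (m =P lw q t)) => [->|ml]; first by rewrite (negbTE h).
case: (altP (m =P rw q t)) => [->|mr].
  by rewrite bef_irr (negbTE (bef_asym (bef_lr q t))).
by rewrite bef_lr_other.
Qed.

Lemma act_period S t : act S (t + M) = act S t.
Proof. by rewrite /act lw_period rw_period andbC. Qed.

Lemma gate_period S t : act S t -> gate S (t + M) + gate S t = #|S| - 2.
Proof.
move=> /andP[hl hr]; have := pos_period t hr; rewrite pos_lr // /gate lw_period.
by lia.
Qed.

Lemma gate_lt S t : act S t -> (gate S t).+1 < #|S|.
Proof. move=> /andP[hl hr]; rewrite -(pos_lr hl); exact: pos_lt. Qed.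

Lemma bef_period2 t i j : bef q (t + M.*2) i j = bef q t i j.
Proof. by rewrite -addnn addnA !bef_period. Qed.
Lemma lw_period2 t : lw q (t + M.*2) = lw q t.
Proof. by rewrite -addnn addnA lw_period rw_period. Qed.
Lemma rw_period2 t : rw q (t + M.*2) = rw q t.
Proof. by rewrite -addnn addnA rw_period lw_period. Qed.
Lemma pos_period2 S t i : pos S (t + M.*2) i = pos S t i.
Proof.
by rewrite /pos; apply: eq_card => m; rewrite !inE bef_period2.
Qed.
Lemma act_period2 S t : act S (t + M.*2) = act S t.
Proof. by rewrite /act lw_period2 rw_period2. Qed.
Lemma gate_period2 S t : gate S (t + M.*2) = gate S t.
Proof. by rewrite /gate lw_period2 pos_period2. Qed.

Lemma bef_change s t i j : s <= t -> bef q s i j -> bef q t j i ->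
  exists2 r, s <= r < t & lw q r = i /\ rw q r = j.
Proof.
move=> st ij; elim: t st => [|t IH] st ji.
  by move: st ij ji; rewrite leqn0 => /eqP -> /bef_asym /negbTE ->.
move: (st); rewrite leq_eqVlt => /orP[/eqP e|]; first by move: (bef_asym ij); rewrite e ji.
rewrite ltnS => st'.
case h : (bef q t j i).
  by have [r hr1 hr2] := IH st' h; exists r => //; lia.
move: ji; rewrite bef_step h orbF => /andP[/eqP -> /eqP ->].
by exists t => //; rewrite st' ltnSn.
Qed.

Lemma swap_distinct s t : s < t < s + M ->
  ~ ((lw q s = rw q t /\ rw q s = lw q t) \/ (lw q s = lw q t /\ rw q s = rw q t)).
Proof.
move=> /andP[st tM] h; have : s + M <= t by apply: (@swap_once _ _ q _ _ st); case: h => [[-> ->]|[-> ->]] //; exact: setUC.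
by lia.
Qed.

(** A pair is swapped only once in half a turn, so once reversed it stays reversed up to [s + M]. *)
Lemma bef_mono s t r i j : s <= t -> t <= r -> r <= s + M ->
  bef q s i j -> bef q t j i -> bef q r j i.
Proof.
move=> st tr rs ij ji; case: (altP (i =P j)) => [e|nij]; first by rewrite e bef_irr in ij.
apply: contraT; rewrite -befN 1?eq_sym // => ij2.
have [a ha [ea eb]] := bef_change st ij ji.
have [b hb [fa fb]] := bef_change tr ji ij2.
by case: (@swap_distinct a b); [lia|left; rewrite ea eb fa fb].
Qed.

End Basics.

(** * Peeling off three hull points *)

Lemma sum_bool_le1 (f : nat -> bool) a b :
  (forall s t, a <= s < b -> a <= t < b -> f s -> f t -> s = t) ->
  \sum_(a <= t < b) f t <= 1.
Proof.
elim: b => [|b IH] h; first by rewrite big_geq.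
have [ba|ab] := ltnP b a; first by rewrite big_geq.
rewrite big_nat_recr //=.
have IH' : \sum_(a <= t < b) f t <= 1 by apply: IH => s t hs ht; apply: h; lia.
case fb: (f b); last by rewrite addn0.
rewrite big1_seq ?add0n // => t /andP[_]; rewrite mem_index_iota => ht.
by case ft: (f t) => //; have := h t b _ _ ft fb; lia.
Qed.

Lemma sum_nat_leq (f g : nat -> nat) a b :
  (forall t, a <= t < b -> f t <= g t) ->
  \sum_(a <= t < b) f t <= \sum_(a <= t < b) g t.
Proof. by move=> h; rewrite [X in X <= _]big_nat [X in _ <= X]big_nat; apply: leq_sum. Qed.

Lemma sum_nat_sub (f : nat -> nat) a b c d : a <= b -> b <= c -> c <= d ->
  \sum_(b <= t < c) f t <= \sum_(a <= t < d) f t.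
Proof.
move=> ab bc cd; rewrite (big_cat_nat (n := b) (p := d)) //=; last lia.
by rewrite (big_cat_nat (n := c) (p := d)) //=; lia.
Qed.

Lemma sum_nat_double (f : nat -> nat) P :
  \sum_(0 <= t < P.*2) f t = \sum_(0 <= t < P) (f t + f (t + P)).
Proof.
rewrite -addnn (big_cat_nat (n := P)) //=; last by lia.
by rewrite -{2}[P]add0n big_addn addnK -big_split.
Qed.

Lemma hull_arith k a b c d e f : k.*2 <= b -> k.*2 <= c -> k.*2 <= d -> e <= 3 ->
  a + (b + c + d) = f + e -> 6 * k + a <= f + 3.
Proof. lia. Qed.

Lemma gates_arith g g' s k : g' + g = s - 2 -> g.+1 < s -> k.*2 < s ->
  (g < k) + (g' < k) <= 1.
Proof. by case: ltnP; case: ltnP; lia. Qed.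

Section Peel.
Variables (n M : nat) (q : aseq n M).
Implicit Types (S : {set 'I_n}) (t s r k : nat) (i j m w : 'I_n).

Notation pos := (pos q).
Notation act := (act q).
Notation gate := (gate q).
Notation lw := (lw q).
Notation rw := (rw q).
Notation bef := (bef q).

Definition edges_lt S k := \sum_(0 <= t < M.*2) (act S t && (gate S t < k)).

(** The truncated position [minn k (pos S t w)] grows only when [w] is the left wire of a swap at a
    gate below [k], and then by one. *)
Lemma right_moves S k w a b : w \in S -> a <= b ->
  minn k (pos S b w) <=
    minn k (pos S a w) + \sum_(a <= t < b) (act S t && (gate S t < k) && (lw t == w)).
Proof.
move=> wS; elim: b => [|b IH]; first by rewrite leqn0 => /eqP ->; exact: leq_addr.
rewrite leq_eqVlt => /orP[/eqP <-|]; first exact: leq_addr.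
rewrite ltnS => ab; rewrite big_nat_recr //=; have {}IH := IH ab.
have [ha|ha] := boolP (act S b); last first.
  by rewrite (pos_step_nact ha wS) /= addn0.
case: (altP (lw b =P w)) => [e|ne]; rewrite /= ?andbF ?andbT ?addn0.
  move: (ha) => /andP[lS rS]; move: IH; rewrite -e pos_step_l rS /gate.
  by case: ltnP; lia.
have [e|ne'] := altP (w =P rw b); last by rewrite pos_step_other // 1?eq_sym.
move: (ha) => /andP[lS rS]; move: IH; rewrite e pos_step_r (pos_lr lS); lia.
Qed.

Lemma left_moves S k w a b : w \in S -> a <= b ->
  minn k (pos S a w) <=
    minn k (pos S b w) + \sum_(a <= t < b) (act S t && (gate S t < k) && (rw t == w)).
Proof.
move=> wS; elim: b => [|b IH]; first by rewrite leqn0 => /eqP ->; exact: leq_addr.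
rewrite leq_eqVlt => /orP[/eqP <-|]; first exact: leq_addr.
rewrite ltnS => ab; rewrite big_nat_recr //=; have {}IH := IH ab.
have [ha|ha] := boolP (act S b); last first.
  by rewrite (pos_step_nact ha wS) /= addn0.
case: (altP (rw b =P w)) => [e|ne]; rewrite /= ?andbF ?andbT ?addn0.
  move: (ha) => /andP[lS rS]; move: IH; rewrite -e pos_step_r (pos_lr lS).
  by case: ltnP; lia.
have [e|ne'] := altP (w =P lw b); last by rewrite pos_step_other // eq_sym.
move: (ha) => /andP[lS rS]; move: IH; rewrite e pos_step_l rS /gate; lia.
Qed.

(** In a full turn [w] travels from the first position to the last and back, through each gate below
    [k] at least once in either direction. *)
Lemma own_swaps S k w t0 : w \in S -> pos S t0 w = 0 -> k < #|S| ->
  k.*2 <= \sum_(0 <= t < M.*2) (act S t && (gate S t < k) && (lw t == w))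
        + \sum_(0 <= t < M.*2) (act S t && (gate S t < k) && (rw t == w)).
Proof.
move=> wS p0 kS.
have p1 : pos S (t0 + M) w = #|S|.-1 by have := pos_period q t0 wS; lia.
have p2 : pos S (t0 + M.*2) w = 0 by rewrite pos_period2.
have h1 := @right_moves S k w t0 (t0 + M) wS (leq_addr _ _).
have h2 := @left_moves S k w (t0 + M) (t0 + M.*2) wS ltac:(lia).
rewrite -(@sum_nat_period _ M.*2 t0); last first.
  by move=> t; rewrite act_period2 gate_period2 lw_period2.
rewrite -[X in _ + X](@sum_nat_period _ M.*2 t0); last first.
  by move=> t; rewrite act_period2 gate_period2 rw_period2.
have s1 := @sum_nat_sub (fun t => act S t && (gate S t < k) && (lw t == w)) t0 t0
  (t0 + M) (t0 + M.*2) (leqnn _) (leq_addr _ _) ltac:(lia).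
have s2 := @sum_nat_sub (fun t => act S t && (gate S t < k) && (rw t == w)) t0
  (t0 + M) (t0 + M.*2) (t0 + M.*2) (leq_addr _ _) ltac:(lia) (leqnn _).
by lia.
Qed.

Definition pswap t i j := ((lw t == i) && (rw t == j)) || ((lw t == j) && (rw t == i)).

Lemma pswap_period t i j : pswap (t + M) i j = pswap t i j.
Proof. by rewrite /pswap lw_period rw_period orbC andbC [X in _ || X]andbC. Qed.

Lemma pswap_once a b i j : b <= a + M -> \sum_(a <= t < b) pswap t i j <= 1.
Proof.
move=> ba; apply: sum_bool_le1 => s t hs ht.
wlog st : s t hs ht / s <= t.
  by move=> W fs ft; case: (leqP s t) => h; [exact: W|apply/esym; apply: W => //; lia].
move=> fs ft; apply/eqP; apply: contraT => ne; exfalso.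
apply: (@swap_distinct _ _ q s t); first lia.
move: fs ft => /orP[]/andP[/eqP -> /eqP ->] /orP[]/andP[/eqP -> /eqP ->]; auto.
Qed.

Section Triple.
Variables (S : {set 'I_n}) (x y z : 'I_n).
Hypotheses (xS : x \in S) (yS : y \in S) (zS : z \in S).
Hypotheses (xy : x != y) (yz : y != z) (xz : x != z).
Hypotheses (hx : exists t, pos S t x = 0) (hy : exists t, pos S t y = 0)
  (hz : exists t, pos S t z = 0).

Let H := [set x; y; z].
Let S0 := S :\: H.

Lemma card_triple : #|S0| + 3 = #|S|.
Proof.
have HS : H \subset S by rewrite /H !subUset !sub1set xS yS zS.
rewrite /S0 cardsD (setIidPr HS).
have cH : #|H| = 3.
  by rewrite /H -setUA !cardsU1 cards1 !inE negb_or xy xz yz.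
by have := subset_leq_card HS; rewrite cH; move: #|S|; lia.
Qed.

Lemma inH w : (w \in H : nat) = (w == x) + (w == y) + (w == z).
Proof.
rewrite /H !inE; case: (altP (w =P x)) => [->|_] /=; first by rewrite (negbTE xy) (negbTE xz).
by case: (altP (w =P y)) => [->|_] /=; first by rewrite (negbTE yz).
Qed.

(** Each of the three pairs is swapped twice in a full turn, at gates adding up to [#|S| - 2]; only
    one of the two can be below [k]. *)
Lemma inner_swaps k : k.*2 < #|S| ->
  \sum_(0 <= t < M.*2) (act S t && (gate S t < k) && ((lw t \in H) && (rw t \in H))) <= 3.
Proof.
move=> kS; rewrite sum_nat_double.
apply: (@leq_trans (\sum_(0 <= t < M) (pswap t x y + pswap t x z + pswap t y z))).
  apply: leq_sum => t _; rewrite act_period lw_period rw_period.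
  have [ha|] := boolP (act S t) => //=.
  have g1 := gate_period ha; have g2 := gate_lt ha.
  rewrite [(rw t \in H) && _]andbC.
  have [/andP[lH rH]|] := boolP ((lw t \in H) && (rw t \in H)); last by rewrite !andbF.
  have : [|| pswap t x y, pswap t x z | pswap t y z].
    have := lr_neq q t; move: lH rH; rewrite /H !inE /pswap.
    move: (lw t) (rw t) => l r.
    by case/orP => [/orP[]|] /eqP -> /orP[/orP[]|] /eqP ->; rewrite ?eqxx ?orbT.
  rewrite !andbT => h; apply: (@leq_trans 1); last by move: h; do 3!case: (pswap _ _ _).
  exact: gates_arith g1 g2 kS.
rewrite !big_split /=.
have := @pswap_once 0 M x y (leqnn _); have := @pswap_once 0 M x z (leqnn _).
have := @pswap_once 0 M y z (leqnn _); lia.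
Qed.

(** Adding the [2 * k] own swaps of each of the three points counts twice the swaps between two of
    them, and there are at most three of those. *)
Lemma hull_swaps k : k.*2 < #|S| ->
  6 * k + \sum_(0 <= t < M.*2) (act S0 t && (gate S t < k)) <= edges_lt S k + 3.
Proof.
move=> kS; have kS' : k < #|S| by lia.
have i3 := inner_swaps kS.
case: hx => tx /(own_swaps xS)/(_ kS') ox.
case: hy => ty /(own_swaps yS)/(_ kS') oy.
case: hz => tz /(own_swaps zS)/(_ kS') oz.
apply: hull_arith ox oy oz i3 _; rewrite /edges_lt.
rewrite -!big_split /=; apply: eq_bigr => t _.
have eA : act S0 t = act S t && ~~ (lw t \in H) && ~~ (rw t \in H).
  by rewrite /act /S0 !inE; do 2!case: (_ \in S); rewrite ?andbF ?andbT.
rewrite eA; have := inH (lw t); have := inH (rw t).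
case: (act S t) => //=; case: (gate S t < k); rewrite ?andbF ?andbT //=.
by do 2!(case: (_ \in H)); rewrite /=; do 6!case: (_ == _) => //=.
Qed.

End Triple.
End Peel.

(** Here [c] removed points precede the swap; the [b] mark those behind the median, the [a] those
    before the swap. For [c <= 2] the bound is immediate, and [c = 3] would put a point behind the
    median before a swap at gate at most [h]. *)
Lemma one_back_arith g c h k (b1 b2 b3 a1 a2 a3 : bool) :
  c = a1 + a2 + a3 -> k.+2 <= h -> g < k -> 1 <= b1 + b2 + b3 ->
  (b1 -> a1 -> h < g + c) -> (b2 -> a2 -> h < g + c) -> (b3 -> a3 -> h < g + c) ->
  g + c < k.+2.
Proof.
by move=> ->; case: b1; case: b2; case: b3; case: a1; case: a2; case: a3 => //=;
  rewrite ?addn0 ?addn1 ?addn2 ?addn3 => h1 h2 h3 h4 h5 h6; try (have := h4 isT isT);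
  try (have := h5 isT isT); try (have := h6 isT isT); lia.
Qed.

(** With two of the three points behind the median, [c = 2] puts at least one of them before the
    swap and [c = 3] at least two; both contradict the gate [k + c]. *)
Lemma two_back_arith g c h k (b1 b2 b3 a1 a2 a3 : bool) :
  c = a1 + a2 + a3 -> k.+2 <= h -> g = k -> 2 <= b1 + b2 + b3 ->
  (b1 -> a1 -> h < g + c) -> (b2 -> a2 -> h < g + c) -> (b3 -> a3 -> h < g + c) ->
  (b1 -> b2 -> a1 -> a2 -> h.+1 < g + c) -> (b1 -> b3 -> a1 -> a3 -> h.+1 < g + c) ->
  (b2 -> b3 -> a2 -> a3 -> h.+1 < g + c) ->
  g + c < k.+2.
Proof.
by move=> ->; case: b1; case: b2; case: b3; case: a1; case: a2; case: a3 => //=;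
  rewrite ?addn0 ?addn1 ?addn2 ?addn3 => h1 h2 h3 h4 h5 h6 h7 h8 h9;
  try (have := h4 isT isT);
  try (have := h5 isT isT); try (have := h6 isT isT); try (have := h7 isT isT isT isT);
  try (have := h8 isT isT isT isT); try (have := h9 isT isT isT isT); lia.
Qed.

Lemma cards_disjoint3 (T : finType) (A B C D : {set T}) :
  A \subset D -> B \subset D -> C \subset D ->
  [disjoint A & B] -> [disjoint A & C] -> [disjoint B & C] ->
  #|A| + #|B| + #|C| <= #|D|.
Proof.
move=> sA sB sC dAB dAC dBC; have e1 := cardsUI A B.
have e2 := cardsUI (A :|: B) C.
rewrite (disjoint_setI0 dAB) cards0 in e1.
rewrite setIUl (disjoint_setI0 dAC) (disjoint_setI0 dBC) setU0 cards0 in e2.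
by rewrite -e1 addn0 -e2 addn0; apply: subset_leq_card; rewrite !subUset sA sB.
Qed.

Section Front.
Variables (n M : nat) (q : aseq n M).
Implicit Types (S : {set 'I_n}) (t s r k : nat) (i j m w : 'I_n).

Notation pos := (pos q).
Notation act := (act q).
Notation gate := (gate q).
Notation lw := (lw q).
Notation rw := (rw q).
Notation bef := (bef q).

Lemma pos_surj S t p : p < #|S| -> exists2 i, i \in S & pos S t i = p.
Proof.
case E: #|S| => [|c] // pc.
pose g i : 'I_c.+1 := inord (pos S t i).
have gv i : i \in S -> g i = pos S t i :> nat.
  by move=> iS; rewrite /g inordK // -E; exact: pos_lt.
have gi : {in S &, injective g}.
  by move=> i j iS jS /(congr1 val); rewrite /= !gv //; exact: pos_inj.
have : Ordinal pc \in g @: S.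
  suff -> : g @: S = setT by [].
  by apply/eqP; rewrite eqEcard subsetT cardsT card_ord (card_in_imset gi) E leqnn.
by case/imsetP => i iS /(congr1 val) /= ->; exists i; rewrite // gv.
Qed.

Definition front S k t := [set m in S | pos S t m < k].

Lemma card_front S k t : k <= #|S| -> #|front S k t| = k.
Proof.
elim: k => [|k IH] kS.
  by apply/eqP; rewrite cards_eq0; apply/eqP/setP => m; rewrite !inE ltn0 andbF.
have [i iS pi] := @pos_surj S t k kS.
rewrite (cardsD1 i) !inE iS pi ltnSn /= add1n -[in RHS]IH ?(ltnW kS) //.
congr _.+1; apply: eq_card => m; rewrite !inE.
case: (altP (m =P i)) => [->|mi] /=; first by rewrite pi ltnn andbF.
case mS: (m \in S) => //=; rewrite ltnS leq_eqVlt; case: eqP => // e.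
by case/eqP: mi; apply: (@pos_inj _ _ q S t m i) => //; rewrite pi e.
Qed.

Lemma front_disjoint S k t : k.*2 <= #|S| -> [disjoint front S k t & front S k (t + M)].
Proof.
move=> kS; rewrite disjoints_subset; apply/subsetP => m; rewrite !inE => /andP[mS pm].
rewrite mS /= -leqNgt; have := pos_period q t mS.
by move: (pos S t m) (pos S (t + M) m) #|S| pm kS; lia.
Qed.

Lemma front_period S k t : front S k (t + M.*2) = front S k t.
Proof. by apply/setP => m; rewrite !inE pos_period2. Qed.

Lemma front_step S k t : ~~ (act S t && (gate S t == k)) ->
  front S k.+1 t.+1 = front S k.+1 t.
Proof.
move=> h; apply/setP => m; rewrite !inE; case mS: (m \in S) => //=.
have [ha|ha] := boolP (act S t); last by rewrite (pos_step_nact ha mS).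
rewrite ha /= in h; move: (ha) => /andP[lS rS].
have [->|ml] := altP (m =P lw t).
  by rewrite pos_step_l rS -/(gate S t) addn1; move: h; move: (gate S t) => g h; lia.
have [->|mr] := altP (m =P rw t); last by rewrite pos_step_other.
by rewrite pos_step_r (pos_lr lS); move: h; move: (gate S t) => g h; lia.
Qed.

(** A swap at gate [k] is the only way out of the first [k + 1] positions, and it expels one
    wire. *)
Lemma front_moves S k a b : a <= b ->
  #|front S k.+1 a :\: front S k.+1 b| <= \sum_(a <= t < b) (act S t && (gate S t == k)).
Proof.
elim: b => [|b IH]; first by rewrite leqn0 => /eqP ->; rewrite setDv cards0.
rewrite leq_eqVlt => /orP[/eqP <-|]; first by rewrite setDv cards0.
rewrite ltnS => ab; rewrite big_nat_recr //=.
have [ha|ha] := boolP (act S b && (gate S b == k)); last first.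
  by rewrite front_step // addn0; exact: IH.
apply: leq_trans (leq_add (IH ab) (leqnn _)); rewrite addn1.
have sub : front S k.+1 a :\: front S k.+1 b.+1 \subset
    lw b |: (front S k.+1 a :\: front S k.+1 b).
  apply/subsetP => m; rewrite !inE => /andP[]; case mS: (m \in S) => //= h1 ->.
  rewrite andbT; have [->//|ml /=] := altP (m =P lw b); apply: contra h1.
  have [-> _|mr] := altP (m =P rw b); last by rewrite pos_step_other.
  by rewrite pos_step_r; move/andP: ha => [_ /eqP ->].
apply: leq_trans (subset_leq_card sub) _; rewrite cardsU1.
by move: (_ \notin _) => [] /=; rewrite ?add0n ?add1n.
Qed.

Definition back S t w := #|S|./2 <= pos S t w.

Lemma back_period S t w : back S (t + M.*2) w = back S t w.
Proof. by rewrite /back pos_period2. Qed.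

(* Each of the hull points x, y, z is "back" (behind the median) during a half
   turn, and these half turns start at T0, T2 and T1 + M respectively. *)
Record tripod S x y z T0 T1 T2 : Prop := Tripod {
  tri_S : [/\ x \in S, y \in S & z \in S];
  tri_neq : [/\ x != y, y != z & x != z];
  tri_hull : [/\ exists t, pos S t x = 0, exists t, pos S t y = 0 & exists t, pos S t z = 0];
  tri_le : [/\ T0 <= T1, T1 <= T2 & T2 <= T0 + M];
  tri_x : forall t, T0 <= t < T0 + M -> back S t x;
  tri_y : forall t, T2 <= t < T2 + M -> back S t y;
  tri_z : forall t, T1 + M <= t < T1 + M.*2 -> back S t z }.

Lemma tripod_rot S x y z T0 T1 T2 :
  tripod S x y z T0 T1 T2 -> tripod S y z x T2 (T0 + M) (T1 + M).
Proof.
case=> -[xS yS zS] [xy yz xz] [hx hy hz] [l1 l2 l3] bx b_y bz; split => //.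
- by split; rewrite // eq_sym.
- by split; lia.
- by move=> t ht; apply: bz; lia.
- move=> t ht; rewrite (_ : t = t - M.*2 + M.*2) ?back_period; last by lia.
  by apply: bx; lia.
Qed.

Section Tri.
Variables (S : {set 'I_n}) (x y z : 'I_n) (T0 T1 T2 : nat).
Hypothesis tri : tripod S x y z T0 T1 T2.

Definition rest := S :\: [set x; y; z].

Let nback t := back S t x + back S t y + back S t z.

Lemma card_rest : #|rest| + 3 = #|S|.
Proof. by case: tri => -[? ? ?] [? ? ?] _ _ _ _ _; apply: card_triple. Qed.

Lemma gate_rest t : gate S t =
  gate rest t + (bef t x (lw t) + bef t y (lw t) + bef t z (lw t)).
Proof.
case: tri => -[xS yS zS] [xy yz xz] _ _ _ _ _; rewrite /gate /pos.
rewrite (cardsD1 x) (cardsD1 y) (cardsD1 z) !inE xS yS zS.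
rewrite [y == x]eq_sym (negbTE xy) [z == x]eq_sym (negbTE xz) [z == y]eq_sym (negbTE yz) /=.
rewrite !addnA addnC -!addnA; congr (_ + _).
apply: eq_card => m; rewrite !inE !negb_or.
by do 3!case: (m == _); rewrite ?andbF ?andbT.
Qed.

Lemma nback_ge1 t : T0 <= t -> t < T0 + M.*2 -> 1 <= nback t.
Proof.
case: tri => _ _ _ [l1 l2 l3] bx b_y bz ht1 ht2; rewrite /nback.
have [c|c] := ltnP t (T0 + M); first by rewrite bx ?ht1.
have [d|d] := ltnP t (T1 + M).
  by rewrite b_y ?addn1 ?addSn //; lia.
by rewrite bz ?addn1 //; lia.
Qed.

(** Three half turns cover the full turn; these arcs are their pairwise overlaps, the first one
    being that of [x] and [z] across the period. *)
Lemma nback_arcs t : (T0 <= t < T1) || (T2 <= t < T0 + M) || (T1 + M <= t < T2 + M) ->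
  2 <= nback t.
Proof.
case: tri => _ _ _ [l1 l2 l3] bx b_y bz; rewrite /nback => /orP[/orP[]|] ht.
- rewrite bx; last by lia.
  by rewrite -(back_period _ t z) bz ?addn1 ?add1n //; lia.
- by rewrite bx ?b_y //; lia.
- by rewrite b_y ?bz ?addn1 //; lia.
Qed.

Lemma back_gate t w : w \in S -> back S t w -> bef t w (lw t) -> #|S|./2 < gate S t.
Proof. by move=> wS b h; apply: leq_ltn_trans b _; exact: pos_lt_mono. Qed.

Lemma back_gate2 t w w' : w \in S -> w' \in S -> w != w' -> back S t w -> back S t w' ->
  bef t w (lw t) -> bef t w' (lw t) -> #|S|./2.+1 < gate S t.
Proof.
move=> wS wS' ne b b' h h'; move: (pos_lt_mono wS h) (pos_lt_mono wS' h').
rewrite -/(gate S t); move: b b'; rewrite /back.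
have : pos S t w != pos S t w' by apply: contra ne => /eqP /(pos_inj wS wS') ->.
by move: (pos S t w) (pos S t w') (gate S t) #|S|./2; lia.
Qed.

Lemma gate_one_back k t : k.+2.*2 < #|S| -> 1 <= nback t -> gate rest t < k ->
  gate S t < k.+2.
Proof.
case: tri => -[xS yS zS] [xy yz xz] _ _ _ _ _ kS nb g.
rewrite gate_rest; apply: (@one_back_arith _ _ #|S|./2 k _ _ _ _ _ _ erefl _ g nb);
  rewrite -?gate_rest.
- by move: #|S| kS; lia.
- exact: back_gate.
- exact: back_gate.
- exact: back_gate.
Qed.

Lemma gate_two_back k t : k.+2.*2 < #|S| -> 2 <= nback t -> gate rest t = k ->
  gate S t < k.+2.
Proof.
case: tri => -[xS yS zS] [xy yz xz] _ _ _ _ _ kS nb g.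
rewrite gate_rest; apply: (@two_back_arith _ _ #|S|./2 k _ _ _ _ _ _ erefl _ g nb);
  rewrite -?gate_rest.
- by move: #|S| kS; lia.
- exact: back_gate.
- exact: back_gate.
- exact: back_gate.
- by move=> b1 b2; apply: back_gate2.
- by move=> b1 b2; apply: back_gate2.
- by move=> b1 b2; apply: back_gate2.
Qed.

(** One removed point is always behind the median, so a gate below [k] in the rest is below [k + 2]
    in [S]. Gate [k] itself gains at most one when two of the points are behind. *)
Lemma rest_edges k : k.+2.*2 < #|S| ->
  edges_lt q rest k + \sum_(0 <= t < M.*2) (act rest t && (gate rest t == k) && (2 <= nback t))
  <= \sum_(0 <= t < M.*2) (act rest t && (gate S t < k.+2)).
Proof.
move=> kS; rewrite /edges_lt -big_split /=.
pose f1 t := (act rest t && (gate rest t < k)) + (act rest t && (gate rest t == k) && (2 <= nback t)).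
pose f2 t := nat_of_bool (act rest t && (gate S t < k.+2)).
rewrite -[X in X <= _](@sum_nat_period f1 M.*2 T0); last first.
  by move=> t; rewrite /f1 act_period2 gate_period2 /nback !back_period.
rewrite -[X in _ <= X](@sum_nat_period f2 M.*2 T0); last first.
  by move=> t; rewrite /f2 act_period2 gate_period2.
apply: sum_nat_leq => t /andP[ht1 ht2]; rewrite /f1 /f2.
case: (act rest t) => //=.
have nb := nback_ge1 ht1 ht2.
have [g|] := ltnP (gate rest t) k.
  by rewrite (gate_one_back kS nb g) eqn_leq [k <= _]leqNgt g andbF.
case: eqP => //= e _; case: ltnP => // nb2; by rewrite (gate_two_back kS nb2 e).
Qed.

(** Let [F t] be the first [k + 1] wires of the rest. On each arc, the wires of [F] lost between its
    ends are paid for by swaps at gate [k]. The wires kept form [Z1], [Z2], [Z3]; any two of these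
    lie in opposite fronts [F t] and [F (t + M)], hence they are disjoint and have at most [#|rest|]
    elements together. *)
Lemma arcs_edges k : k.+2.*2 < #|S| ->
  3 * k.+1 <= \sum_(0 <= t < M.*2) (act rest t && (gate rest t == k) && (2 <= nback t)) + #|rest|.
Proof.
move=> kS; case: (tri) => _ _ _ [l1 l2 l3] _ _ _.
pose f t := nat_of_bool (act rest t && (gate rest t == k) && (2 <= nback t)).
rewrite -[X in _ <= X + _](@sum_nat_period f M.*2 T0); last first.
  by move=> t; rewrite /f act_period2 gate_period2 /nback !back_period.
pose F := front rest k.+1.
have kr : k.+1.*2 <= #|rest| by have := card_rest; move: #|S| #|rest| kS; lia.
have cF t : #|F t| = k.+1 by apply: card_front; move: #|rest| kr; lia.
have dF t : [disjoint F t & F (t + M)] by exact: front_disjoint.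
have arc a b : a <= b ->
    (forall t, a <= t < b -> (T0 <= t < T1) || (T2 <= t < T0 + M) || (T1 + M <= t < T2 + M)) ->
    #|F a :\: F b| <= \sum_(a <= t < b) f t.
  move=> ab h; apply: leq_trans (front_moves _ _ ab) _.
  by apply: sum_nat_leq => t ht; rewrite /f (nback_arcs (h t ht)) andbT.
have a1 : #|F T0 :\: F T1| <= \sum_(T0 <= t < T1) f t.
  by apply: arc => // t ->.
have a2 : #|F T2 :\: F (T0 + M)| <= \sum_(T2 <= t < T0 + M) f t.
  by apply: arc => // t ->; rewrite orbT.
have a3 : #|F (T1 + M) :\: F (T2 + M)| <= \sum_(T1 + M <= t < T2 + M) f t.
  by apply: arc => [|t ->]; rewrite ?orbT // leq_add2r.
have splitS : \sum_(T0 <= t < T1) f t + \sum_(T2 <= t < T0 + M) f t +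
    \sum_(T1 + M <= t < T2 + M) f t <= \sum_(T0 <= t < T0 + M.*2) f t.
  rewrite (big_cat_nat (n := T1) (p := T0 + M.*2)) //=; last by lia.
  rewrite (big_cat_nat (n := T2) (p := T0 + M.*2)) //=; last by lia.
  rewrite (big_cat_nat (n := T0 + M) (p := T0 + M.*2)) //=; last by lia.
  rewrite (big_cat_nat (n := T1 + M) (p := T0 + M.*2)) //=; [|lia|lia].
  rewrite (big_cat_nat (n := T2 + M) (p := T0 + M.*2)) //=; [|lia|lia].
  by move: (\sum_(_ <= t < _) _) => s1; do 5!(move: (\sum_(_ <= t < _) _) => ?); lia.
pose Z1 := F T0 :&: F T1; pose Z2 := F T2 :&: F (T0 + M);
pose Z3 := F (T1 + M) :&: F (T2 + M).
have d12 : [disjoint Z1 & Z2].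
  apply: disjointWl (subsetIl _ _) _; apply: disjointWr (subsetIr _ _) _; exact: dF.
have d13 : [disjoint Z1 & Z3].
  apply: disjointWl (subsetIr _ _) _; apply: disjointWr (subsetIl _ _) _; exact: dF.
have d23 : [disjoint Z2 & Z3].
  apply: disjointWl (subsetIl _ _) _; apply: disjointWr (subsetIr _ _) _; exact: dF.
have cU : #|Z1| + #|Z2| + #|Z3| <= #|rest|.
  apply: cards_disjoint3 d12 d13 d23; apply/subsetP => m /setIP[];
    by rewrite inE => /andP[->].
have e1 := cardsID (F T1) (F T0); have e2 := cardsID (F (T0 + M)) (F T2).
have e3 := cardsID (F (T2 + M)) (F (T1 + M)).
rewrite cF in e1; rewrite cF in e2; rewrite cF in e3.
rewrite -/Z1 in e1; rewrite -/Z2 in e2; rewrite -/Z3 in e3.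
move: splitS a1 a2 a3 e1 e2 e3 cU; move: (\sum_(_ <= t < _) _) => s0.
do 3!(move: (\sum_(_ <= t < _) _) => ?).
move: #|_ :\: _| #|_ :\: _| #|_ :\: _| #|Z1| #|Z2| #|Z3| #|rest|.
clear; lia.
Qed.

Lemma peel k : k.+2.*2 < #|S| ->
  6 * k + 9 + edges_lt q rest k + (3 * k.+1 - #|rest|) <= edges_lt q S k.+2.
Proof.
move=> kS; have h1 := rest_edges kS; have h2 := arcs_edges kS.
case: tri => -[? ? ?] [? ? ?] [? ? ?] _ _ _ _.
have : 6 * k.+2 + \sum_(0 <= t < M.*2) (act rest t && (gate S t < k.+2)) <= edges_lt q S k.+2 + 3.
  exact: hull_swaps.
move: h1 h2; do 2!(move: (\sum_(_ <= t < _) _) => ?); move: #|_| (edges_lt _ _ _) (edges_lt _ _ _).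
by clear; lia.
Qed.

End Tri.
End Front.

(** For [c = 30] the value is three times the binomial coefficient of [k + 1] over 2 when [k <= 10];
    the truncated difference adds 3, 9 and 18 to this at 11, 12 and 13. *)
Fixpoint edges_bound k c :=
  match k with
  | 0 => 0
  | 1 => 3
  | k'.+2 => 6 * k' + 9 + edges_bound k' (c - 3) + (3 * k'.+1 - (c - 3))
  end.

(** * Existence of three hull points in tripod position *)

Section Existence.
Variables (n M : nat) (q : aseq n M).
Implicit Types (S : {set 'I_n}) (t s r k : nat) (i j m w : 'I_n).
Notation pos := (pos q).
Notation bef := (bef q).

Lemma pos0_bef S t w m : pos S t w = 0 -> m \in S -> m != w -> bef t w m.
Proof.
move=> p0 mS mw; rewrite befN //; apply/negP => h.
by have := pos_lt_mono mS h; rewrite p0.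
Qed.

Lemma hull_mono S t0 t r w : pos S t0 w = 0 -> t0 <= t -> t <= r -> r <= t0 + M ->
  pos S t w <= pos S r w.
Proof.
move=> p0 h1 h2 h3; apply: subset_leq_card; apply/subsetP => m; rewrite !inE.
move=> /andP[mS b]; rewrite mS /=; apply: (bef_mono h1 h2 h3 _ b).
exact: pos0_bef p0 mS (bef_neq b).
Qed.

Variables (S : {set 'I_n}).
Hypothesis S3 : 2 < #|S|.
Let h := #|S|./2.

(** The hull point [w], first at time [t0], passes the median at time [s] and then stays behind it
    for half a turn. *)
Definition turns w s := exists t0, [/\ pos S t0 w = 0, t0 < s <= t0 + M,
  forall t, t0 <= t < s -> pos S t w < h & forall t, s <= t <= t0 + M -> h <= pos S t w].

Lemma half_bounds : 0 < h /\ h + h <= #|S|.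
Proof. by rewrite /h; split; [rewrite half_gt0; lia | rewrite addnn; lia]. Qed.

Lemma turns_exist w t0 : w \in S -> pos S t0 w = 0 -> exists2 s, turns w s & t0 < s <= t0 + M.
Proof.
move=> wS p0; have [h0 hh] := half_bounds.
have e : exists s, (t0 <= s) && (h <= pos S s w).
  exists (t0 + M); rewrite leq_addr /=; have := pos_period q t0 wS.
  by rewrite p0 addn0 => ->; move: h #|S| h0 hh => ? ?; lia.
have [s /andP[ts hs] smin] := ex_minnP e.
have st : t0 != s by apply: contraL hs => /eqP <-; rewrite p0 -ltnNge.
have sM : s <= t0 + M.
  apply: smin; rewrite leq_addr /=; have := pos_period q t0 wS.
  by rewrite p0 addn0 => ->; move: h #|S| h0 hh => ? ?; lia.
have b : t0 < s <= t0 + M by rewrite sM ltn_neqAle st ts.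
exists s => //; exists t0; split=> //.
  move=> t /andP[t1 t2]; rewrite ltnNge; apply/negP => c.
  by have := smin t; rewrite t1 c => /(_ isT); rewrite leqNgt t2.
by move=> t /andP[t1 t2]; apply: leq_trans hs (hull_mono p0 ts t1 t2).
Qed.

Lemma turns_back w s t : w \in S -> turns w s -> s <= t < s + M -> back q S t w.
Proof.
move=> wS [t0 [p0 b h1 h2]] /andP[c1 c2]; rewrite /back -/h; have [h0 hh] := half_bounds.
have [l|l] := leqP t (t0 + M); first by apply: h2; rewrite c1.
have e : t = (t - M) + M by lia.
have := h1 (t - M) ltac:(lia); have := pos_period q (t - M) wS; rewrite -e.
by move: (pos S t w) (pos S (t - M) w) h #|S| h0 hh => *; lia.
Qed.

Lemma turns_hull w s : turns w s -> exists t, pos S t w = 0.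
Proof. by case=> t0 [p0 _ _ _]; exists t0. Qed.

Lemma pos_stepS t w : pos S t.+1 w <= (pos S t w).+1.
Proof.
have [->|l] := eqVneq w (lw q t).
  by rewrite pos_step_l /gate; case: (_ \in S); rewrite ?addn0 ?addn1 // leqnSn.
have [->|r] := eqVneq w (rw q t); last by rewrite pos_step_other // leqnSn.
by rewrite pos_step_r /gate ltnW // ltnS; apply: subset_leq_card; apply/subsetP => m;
  rewrite !inE => /andP[-> b]; apply: bef_trans b (bef_lr q t).
Qed.

Lemma back_not0 t w : back q S t w -> pos S t w <> 0.
Proof. by have [h0 _] := half_bounds; rewrite /back -/h => b p0; rewrite p0 leqNgt h0 in b. Qed.

Lemma turns_not0 w s t : w \in S -> turns w s -> s <= t <= s + M -> pos S t w <> 0.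
Proof.
move=> wS ts /andP[l1]; rewrite leq_eqVlt => /orP[/eqP ->|l2]; last first.
  by apply: back_not0; apply: (turns_back wS ts); rewrite l1.
case: (ts) => t0 [p0 b h1 h2]; have [h0 hh] := half_bounds.
have := h1 s.-1 ltac:(lia); have := pos_stepS s.-1 w; rewrite prednK; last by lia.
have := pos_period q s wS; move: #|S| S3 hh h0.
by move: (pos S _ w) (pos S _ w) (pos S _ w) h; clear; lia.
Qed.

(** Each new point is the first wire at the moment when the previous one passes the median. If the
    third point [z] still turns no later than [sx + M], it replaces [y] and the search continues;
    [sy] grows, so this ends. Otherwise [z] turns after [sx + M] but by [sy + M], which is the
    required cyclic order. *)
Lemma tripod_exists : exists x y z T0 T1 T2, tripod q S x y z T0 T1 T2.
Proof.
have S0 : 0 < #|S| by apply: ltn_trans S3.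
have [x xS px] := pos_surj q 0 S0; have [sx tx _] := turns_exist xS px.
have M0 : 0 < M by case: tx => t0 [_ b _ _]; lia.
have [y yS py] := pos_surj q sx S0; have [sy ty bsy] := turns_exist yS py.
have yx : y != x.
  by apply/eqP => e; apply: (turns_not0 (t := sx) xS tx); [lia | rewrite -e].
have [d] := ubnP (sx + M - sy).
elim: d y sy yS ty bsy yx {py} => // d IH y sy yS ty bsy yx hd.
have [z zS pz] := pos_surj q sy S0; have [sz tz bsz] := turns_exist zS pz.
have zy : z != y by apply/eqP => e; apply: (turns_not0 (t := sy) yS ty); [lia | rewrite -e].
have zx : z != x by apply/eqP => e; apply: (turns_not0 (t := sy) xS tx); [lia | rewrite -e].
have [bad|good] := leqP sz (sx + M).
  by apply: (IH z sz zS tz _ zx); move: bsy bsz bad hd; clear; lia.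
exists x, y, z, sx, (sz - M), sy; split.
- by [].
- by rewrite eq_sym yx eq_sym zy eq_sym zx.
- by split; [exact: turns_hull tx|exact: turns_hull ty|exact: turns_hull tz].
- by split; lia.
- by move=> t; apply: turns_back.
- by move=> t; apply: turns_back.
- by move=> t ht; apply: (turns_back zS tz); lia.
Qed.

End Existence.

Lemma edges_lower n M (q : aseq n M) (S : {set 'I_n}) k :
  k.*2 < #|S| -> edges_bound k #|S| <= edges_lt q S k.
Proof.
have [c] := ubnP k; elim: c k S => // c IH [|[|k]] S hk kS //.
  have [x [y [z [T0 [T1 [T2 [[? ? ?] [? ? ?] [? ? ?] _ _ _ _]]]]]]] := tripod_exists q kS.
  rewrite -(leq_add2r 3).
  apply: leq_trans (hull_swaps (x := x) (y := y) (z := z) _ _ _ _ _ _ _ _ _ kS) => //.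
have S3 : 2 < #|S| by move: #|S| kS; clear; lia.
have [x [y [z [T0 [T1 [T2 tri]]]]]] := tripod_exists q S3.
apply: leq_trans (peel tri kS) => /=; have cr := card_rest tri.
rewrite (_ : #|S| - 3 = #|rest S x y z|); last by rewrite -cr addnK.
rewrite leq_add2r leq_add2l; apply: IH; first by move: hk; clear; lia.
by move: #|S| #|rest S x y z| kS cr; clear; lia.
Qed.

(** * Tight sequences decompose into three classes *)

Lemma sum_nat_eq_pointwise (f g : nat -> nat) a b :
  (forall t, f t <= g t) -> \sum_(a <= t < b) g t <= \sum_(a <= t < b) f t ->
  forall t, a <= t < b -> f t = g t.
Proof.
move=> fg h t ht; apply/eqP; rewrite eqn_leq fg /= leqNgt; apply/negP => lt.
have tb : t < b by case/andP: ht.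
move: h; rewrite leqNgt => /negP; apply; case/andP: ht => at1 _.
rewrite (big_cat_nat (n := t)) ?(ltnW tb) //= [X in _ < X](big_cat_nat (n := t)) ?(ltnW tb) //=.
rewrite -addnS leq_add //; first by apply: sum_nat_leq.
by rewrite !(big_ltn tb) -addSn leq_add //; apply: sum_nat_leq.
Qed.

Lemma periodic_window (P : nat -> Prop) a p : 0 < p ->
  (forall t, P (t + p) <-> P t) -> (forall t, a <= t < a + p -> P t) -> forall t, P t.
Proof.
move=> p0 per win.
have hi t : a <= t -> P t.
  elim/ltn_ind: t => t IH at1; have [l|g] := ltnP t (a + p); first by apply: win; rewrite at1.
  rewrite -(subnK (_ : p <= t)); last by move: g; clear; lia.
  by apply/per/IH; move: at1 g p0; clear; lia.
move=> t; have : P (t + a * p) by apply: hi; case: p p0 {per win} => // p _; rewrite mulnS; lia.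
by elim: (a) => [|c IH]; rewrite ?addn0 // mulSn addnCA addnC => /per.
Qed.

Lemma cards_cover3 (T : finType) (A B C D : {set T}) :
  A \subset D -> B \subset D -> C \subset D ->
  [disjoint A & B] -> [disjoint A & C] -> [disjoint B & C] ->
  #|D| <= #|A| + #|B| + #|C| -> D = A :|: B :|: C.
Proof.
move=> sA sB sC dAB dAC dBC h; apply/esym/eqP; rewrite eqEcard !subUset sA sB sC /=.
have e1 := cardsUI A B; have e2 := cardsUI (A :|: B) C.
rewrite (disjoint_setI0 dAB) cards0 in e1.
rewrite setIUl (disjoint_setI0 dAC) (disjoint_setI0 dBC) setU0 cards0 in e2.
by apply: leq_trans h _; rewrite -e1 addn0 -e2 addn0.
Qed.

Section Decomp.
Variables (n M : nat) (q : aseq n M).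
Implicit Types (S : {set 'I_n}) (t s r k : nat) (i j m w : 'I_n).
Notation pos := (pos q).
Notation act := (act q).
Notation gate := (gate q).
Notation lw := (lw q).
Notation rw := (rw q).
Notation bef := (bef q).

Lemma front_const S k a b : a <= b ->
  (forall t, a <= t < b -> ~~ (act S t && (gate S t == k))) ->
  front q S k.+1 b = front q S k.+1 a.
Proof.
elim: b => [|b IH] ab h; first by move: ab; rewrite leqn0 => /eqP ->.
move: ab; rewrite leq_eqVlt => /orP[/eqP -> //|]; rewrite ltnS => ab.
rewrite front_step; last by apply: h; rewrite ab leqnn.
by apply: IH => // t /andP[h1 h2]; apply: h; rewrite h1 ltnS ltnW.
Qed.

Lemma bef_between s t r i j : s <= t -> t <= r -> r <= s + M ->
  bef s i j -> bef r i j -> bef t i j.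
Proof.
move=> h1 h2 h3 b1 b2; apply: contraT => b3.
have ij := bef_neq b1; rewrite -befN in b3 => //.
by have := bef_asym (bef_mono h1 h2 h3 b1 b3); rewrite b2.
Qed.

Lemma pos_stepP S t w : w \in S -> pos S t w <= (pos S t.+1 w).+1.
Proof.
move=> wS; have := pos_stepS q S (t + M) w.
have := pos_period q t wS; have := pos_period q t.+1 wS; rewrite addSn.
by move: (pos _ _ _) (pos _ _ _) (pos _ _ _) (pos _ _ _) #|S|; clear; lia.
Qed.

Lemma aseq_pos : 0 < M.
Proof.
rewrite lt0n; apply/eqP => e; have := lr_neq q 0.
by rewrite -(lw_period q 0) add0n (congr1 lw e) eqxx.
Qed.

Definition all_bef t (X Y : {set 'I_n}) := forall i j, i \in X -> j \in Y -> bef t i j.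

Section OneBlock.
Variables (x y z : 'I_n) (T0 T1 T2 : nat).
Hypothesis n30 : n = 30.
Let S := [set: 'I_n].
Hypothesis tri : tripod q S x y z T0 T1 T2.
Let R := rest S x y z.
(** What tightness at 10 and at 2 says about swaps among the 27 remaining points; [dec_exists]
    derives both. *)
Hypothesis edge8 : forall t, act R t -> gate S t < 10 -> gate R t < 8.
Hypothesis edge0 : forall t, act R t -> 1 < gate S t.

Let cS : #|S| = 30. Proof. by rewrite cardsT card_ord. Qed.
Let cR : #|R| = 27. Proof. by have := card_rest tri; rewrite cS -/R; move: #|R|; clear; lia. Qed.

(** On an arc with two points behind the median, a swap of [R] at gate 8 would have gate below 10 in
    [S], which [edge8] excludes. So the first nine wires of [R] do not change there. *)
Lemma arc_const a b : a <= b ->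
  (forall t, a <= t < b -> (T0 <= t < T1) || (T2 <= t < T0 + M) || (T1 + M <= t < T2 + M)) ->
  front q R 9 b = front q R 9 a.
Proof.
move=> ab h; apply: front_const => // t ht; apply/negP => /andP[ha /eqP g8].
have nb := nback_arcs tri (h t ht).
have := edge8 ha (@gate_two_back _ _ _ _ _ _ _ _ _ _ tri 8 t _ nb g8).
by rewrite cS g8 => /(_ isT).
Qed.

Let Z1 := front q R 9 T0.
Let Z2 := front q R 9 T2.
Let Z3 := front q R 9 (T1 + M).

Lemma front_T1 : front q R 9 T1 = Z1.
Proof. by case: (tri) => _ _ _ [l1 l2 l3] _ _ _; apply: arc_const => // t ->. Qed.
Lemma front_T0M : front q R 9 (T0 + M) = Z2.
Proof.
by case: (tri) => _ _ _ [l1 l2 l3] _ _ _; apply: arc_const => // t ->; rewrite orbT.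
Qed.
Lemma front_T2M t : T1 + M <= t -> t <= T2 + M -> front q R 9 t = Z3.
Proof.
move=> h1 h2; apply: arc_const => // s hs.
by rewrite [X in _ || X](_ : _ = true) ?orbT //; move: hs h1 h2; clear; lia.
Qed.

Lemma front_disj : [/\ [disjoint Z1 & Z2], [disjoint Z1 & Z3] & [disjoint Z2 & Z3]].
Proof.
case: (tri) => _ _ _ [l1 l2 l3] _ _ _; split.
- by rewrite -front_T0M; apply: front_disjoint; rewrite cR.
- by rewrite -front_T1; apply: front_disjoint; rewrite cR.
- rewrite -(@front_T2M (T2 + M)) //; last by rewrite leq_add2r.
  by apply: front_disjoint; rewrite cR.
Qed.

Lemma card_Z : [/\ #|Z1| = 9, #|Z2| = 9 & #|Z3| = 9].
Proof. by split; apply: card_front; rewrite cR. Qed.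

Lemma Z_R m : (m \in R) = [|| m \in Z1, m \in Z2 | m \in Z3].
Proof.
have [d12 d13 d23] := front_disj; have [c1 c2 c3] := card_Z.
have [s1 s2 s3] : [/\ Z1 \subset R, Z2 \subset R & Z3 \subset R].
  by split; apply/subsetP => i; rewrite inE => /andP[].
by rewrite {1}(cards_cover3 s1 s2 s3 d12 d13 d23) ?cR ?c1 ?c2 ?c3 // !in_setU orbA.
Qed.

(** The first wire of [R] lies in [Z1] at [T1] and in [Z2] at [T2], so a swap at gate 0 of [R]
    occurs in between. By [edge0] two removed points precede it, and [x], being behind the median,
    is not one of them. *)
Lemma two_first : exists2 t, T1 <= t < T2 &
  forall m, m \in R -> bef t y m /\ bef t z m.
Proof.
case: (tri) => -[xS yS zS] [xy yz xz] _ [l1 l2 l3] bx _ _.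
have [/hasP[t]|/hasPn no] := boolP (has (fun t => act R t && (gate R t == 0)) (index_iota T1 T2)).
  rewrite mem_index_iota => ht /andP[ha /eqP g0]; exists t => //.
  have xb : bef t x (lw t) = false.
    apply/negP => b; have := back_gate xS (bx t _) b.
    rewrite (gate_rest tri) -/R g0 add0n cS => /(_ ltac:(move: ht l1 l3; clear; lia)).
    by do 3!case: (bef _ _ _).
  have /andP[by1 bz1] : bef t y (lw t) && bef t z (lw t).
    by have := edge0 ha; rewrite (gate_rest tri) -/R g0 xb; do 2!case: (bef _ _ _).
  move=> m mR; have [-> //|ne] := eqVneq m (lw t).
  have lm := pos0_bef g0 mR ne.
  by split; [exact: bef_trans by1 lm | exact: bef_trans bz1 lm].
have [d12 _ _] := front_disj.
have e : front q R 1 T2 = front q R 1 T1.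
  by apply: front_const => // t ht; apply: no; rewrite mem_index_iota.
have : 0 < #|front q R 1 T1| by rewrite card_front ?cR.
case/card_gt0P => m mf; have m1 : m \in Z1.
  by rewrite -front_T1; move: mf; rewrite !inE => /andP[-> h]; apply: leq_trans h _.
have m2 : m \in Z2.
  by move: mf; rewrite -e !inE => /andP[-> h]; apply: leq_trans h _.
by move: (disjointFr d12 m1); rewrite m2.
Qed.
End OneBlock.

Lemma rest_rot S x y z : rest S y z x = rest S x y z.
Proof. by rewrite /rest; congr (_ :\: _); apply/setP => i; rewrite !inE orbC orbA. Qed.

Lemma in_front S k t w : (w \in front q S k t) = (w \in S) && (pos S t w < k).
Proof. by rewrite inE. Qed.

Section Block.
Variables (x y z : 'I_n) (T0 T1 T2 : nat).
Hypothesis n30 : n = 30.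
Let S := [set: 'I_n].
Hypothesis tri : tripod q S x y z T0 T1 T2.
Let R := rest S x y z.
Hypothesis edge8 : forall t, act R t -> gate S t < 10 -> gate R t < 8.
Hypothesis edge0 : forall t, act R t -> 1 < gate S t.

Let Z1 := front q R 9 T0.
Let Z2 := front q R 9 T2.
Let Z3 := front q R 9 (T1 + M).

Lemma bef_flip t i j : bef (t + M) j i -> bef t i j.
Proof. by rewrite bef_period. Qed.

(** The witness [c] is the first swap after [a] that brings [z] before a wire of [Z1]. At that
    moment [z] sits exactly between [Z1] and the rest of [R], while [y] precedes and [x] follows all
    of [R]. *)
Lemma block_time : exists2 c, T1 + M.*2 <= c < T2 + M.*2 &
  all_bef c (y |: Z1) (z |: Z2) /\ all_bef c (z |: Z2) (x |: Z3).
Proof.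
have tri' := tripod_rot tri; have tri'' := tripod_rot tri'.
have r1 : rest S y z x = R by exact: rest_rot.
have r2 : rest S z x y = R by rewrite rest_rot.
have cS : #|S| = 30 by rewrite cardsT card_ord.
case: (tri) => -[xS yS zS] [xy yz xz] _ [l1 l2 l3] bx b_y bz.
have [t1 ht1 y1] := two_first n30 tri edge8 edge0.
have [t2 ht2 z2] : exists2 t, T0 + M <= t < T1 + M & forall m, m \in R -> bef t z m /\ bef t x m.
  by have := two_first n30 tri'; rewrite r1 => /(_ edge8 edge0).
have [t3 ht3 x3] : exists2 t, T2 + M <= t < T0 + M + M & forall m, m \in R -> bef t x m /\ bef t y m.
  by have := two_first n30 tri''; rewrite r2 => /(_ edge8 edge0).
have [d12 d13 d23] := front_disj n30 tri edge8.
have [c1 c2 c3] := card_Z n30 tri.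
have ZR := Z_R n30 tri edge8; rewrite -/R -/Z1 -/Z2 -/Z3 in ZR d12 d13 d23 c1 c2 c3.
have yR t m : t3 <= t <= t1 + M.*2 -> m \in R -> bef t y m.
  move=> /andP[h1 h2] mR; apply: (bef_between h1 h2).
  - by move: ht1 ht3; clear; lia.
  - by case: (x3 m mR).
  - by rewrite bef_period2; case: (y1 m mR).
have xR t m : T1 + M.*2 <= t <= T2 + M.*2 -> m \in R -> bef t m x.
  move=> ht mR; have [e|] := leqP M t; last by move: ht; clear; lia.
  rewrite -(subnK e) bef_period; apply: (@bef_between t2 _ t3).
  - by move: ht ht2; clear; lia.
  - by move: ht ht3; clear; lia.
  - by move: ht2 ht3; clear; lia.
  - by case: (z2 m mR).
  - by case: (x3 m mR).
have ZinR m : [|| m \in Z1, m \in Z2 | m \in Z3] -> m \in R by rewrite ZR.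
have nR m : m \in R -> [/\ m != x, m != y & m != z].
  by rewrite !inE !negb_or => /andP[/andP[/andP[-> ->] ->] _].
set a := T1 + M.*2; pose P t := [forall m in Z1, bef t m z].
have front_a : front q R 9 a = Z1 by rewrite front_period; exact: front_T1 n30 tri edge8.
(* Just before [a] the wire [z] is behind the median, so at [a] at least 14 wires precede it. If [z]
   preceded some [m] of [Z1], these could only be [x], [y] and at most eight wires of [R]. *)
have Pa : P a.
  apply/forallP => m; apply/implyP => mZ; have mR : m \in R by rewrite ZR mZ.
  have [mx my mz] := nR m mR.
  apply: contraT; rewrite -befN // => zm.
  have p1 : 15 <= pos S a.-1 z.
    have : back q S a.-1 z by apply: bz; rewrite /a; move: aseq_pos ht1; clear; lia.
    by rewrite /back cS.
  have p2 : 14 <= pos S a z.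
    have := pos_stepP a.-1 zS; rewrite prednK; last by rewrite /a; move: aseq_pos; clear; lia.
    by move: (pos _ _ _) (pos _ _ _) p1; clear; lia.
  have sub : [set w in S | bef a w z] \subset y |: (x |: [set w in R | bef a w m]).
    apply/subsetP => w; rewrite !inE => /andP[_ wz].
    rewrite (bef_trans wz zm) andbT (negbTE (bef_neq wz)) orbF andbT.
    by case: (w == y) => //=; case: (w == x).
  have : pos R a m < 9 by move: mZ; rewrite -front_a in_front => /andP[].
  move: (subset_leq_card sub); rewrite !cardsU1 -!/(pos _ _ _) => h; move: h p2.
  by do 2!case: (_ \notin _); move: (pos R a m) (pos S a z); clear; lia.
have nPb : ~~ P (t1 + M.*2).
  have : 0 < #|Z1| by rewrite c1.
  case/card_gt0P => m mZ; rewrite negb_forall; apply/existsP; exists m.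
  rewrite negb_imply mZ bef_period2; apply: bef_asym.
  by case: (y1 m _) => //; rewrite ZR mZ.
have ex : exists t, (a <= t) && ~~ P t by exists (t1 + M.*2); rewrite nPb andbT /a; move: ht1; clear; lia.
have [ts /andP[ats nP] tmin] := ex_minnP ex.
have ts_ne : a != ts by apply: contraNneq nP => <-.
have tsb : ts <= t1 + M.*2.
  by apply: tmin; rewrite nPb andbT /a; move: ht1; clear; lia.
case: ts => [|c] in ats nP tmin ts_ne tsb.
  by move: ats ts_ne; clear; lia.
have ac : a <= c by move: ats ts_ne; clear; lia.
have Plow t : a <= t <= c -> P t.
  move=> /andP[h1 h2]; apply: contraT => nPt; have := tmin t; rewrite h1 nPt => /(_ isT).
  by move: h2; clear; lia.
have cT : T1 + M.*2 <= c < T2 + M.*2 by move: ac tsb ht1; rewrite /a; clear; lia.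
have xa t w : a <= t <= c -> act R t -> bef t x (lw t) = false.
  move=> ht /andP[lR _]; apply/negP => b; have := xR t (lw t) _ lR.
  by rewrite (negbTE (bef_asym b)) => /(_ ltac:(move: ht cT; rewrite /a; clear; lia)).
(* A change needs a swap of [R] at gate 8, hence by [edge8] at gate at least 10 in [S]: both [y] and
   [z] would precede it, but [z] still follows all of [Z1]. *)
have front_t t : a <= t <= c -> front q R 9 t = Z1.
  elim: t => [|t IH] ht.
    by rewrite -front_a; congr (front _ _ _ _); move: ht; clear; lia.
  have [e|ne] := eqVneq t.+1 a; first by rewrite e.
  have ht' : a <= t <= c by move: ht ne; clear; lia.
  rewrite front_step; first exact: IH.
  apply/negP => /andP[ha /eqP g8].
  have := edge8 ha; rewrite g8 (gate_rest tri) -/R g8 (xa t x ht' ha).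
  have [bz'|] := boolP (bef t z (lw t)); last by case: (bef t y (lw t)) => _ /(_ isT).
  have lZ : lw t \in Z1 by rewrite -(IH ht') in_front -/(gate R t) g8 andbT; case/andP: ha.
  have := forallP (Plow t ht') (lw t); rewrite lZ /=.
  by rewrite (negbTE (bef_asym bz')).
have acc : a <= c <= c by rewrite ac leqnn.
have [m /andP[mZ mz]] : exists m, (m \in Z1) && ~~ bef c.+1 m z.
  by move: nP; rewrite negb_forall => /existsP[m]; rewrite negb_imply; exists m.
have mzc : bef c m z by have := forallP (Plow c acc) m; rewrite mZ.
have [lm rz] : lw c = m /\ rw c = z.
  have : [set m; z] == [set lw c; rw c].
    by apply: contraT => /bef_step_stay e; rewrite e mzc in mz.
  move=> /eqP /setP e; have := e m; have := e z; rewrite !inE !eqxx orbT => /esym e1 /esym e2.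
  have := bef_lr q c; case/orP: e1 => /eqP e1; case/orP: e2 => /eqP e2; rewrite -?e1 -?e2 //.
  - by rewrite e1 e2 in mzc; rewrite bef_irr in mzc.
  - by move/bef_asym; rewrite mzc.
  - by rewrite e1 e2 in mzc; rewrite bef_irr in mzc.
have mR : m \in R by rewrite ZR mZ.
have mfr : pos R c m < 9 by move: mZ; rewrite -(front_t c acc) in_front => /andP[].
have Zout w : w \in R -> w \notin Z1 -> bef c m w.
  move=> wR wZ; rewrite (bef_pos q c mR wR); apply: leq_trans mfr _.
  by move: wZ; rewrite -(front_t c acc) in_front wR /= -leqNgt.
have Zz w : w \in R -> w \notin Z1 -> bef c z w.
  move=> wR wZ; have [wx wy wz] := nR w wR.
  rewrite befN // -{1}rz bef_lr_other ?lm ?rz // ?bef_asym ?Zout //.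
  by apply: contraNneq wZ => ->.
have Z12 w v : w \in Z1 -> v \in R -> v \notin Z1 -> bef c w v.
  move=> wZ vR vZ; have wR : w \in R by rewrite ZR wZ.
  rewrite (bef_pos q c wR vR); move: wZ vZ; rewrite -(front_t c acc) !in_front vR /= -leqNgt.
  by case/andP => _; exact: leq_trans.
have n21 w : w \in Z2 -> w \notin Z1 by move=> h; rewrite (disjointFl d12 h).
have n31 w : w \in Z3 -> w \notin Z1 by move=> h; rewrite (disjointFl d13 h).
have i2 w : w \in Z2 -> w \in R by move=> h; rewrite ZR h orbT.
have i3 w : w \in Z3 -> w \in R by move=> h; rewrite ZR h !orbT.
(* Half a turn away the front is [Z3], so [Z3] forms the last nine wires of [R] at time [c]. *)
have Z23 w v : w \in Z2 -> v \in Z3 -> bef c w v.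
  move=> wZ vZ; apply: bef_flip; rewrite (bef_pos q _ (i3 v vZ) (i2 w wZ)).
  have e : front q R 9 (c + M) = Z3.
    rewrite -(subnK (_ : M.*2 <= c + M)) ?front_period; last by move: cT; clear; lia.
    by apply: (front_T2M n30 tri edge8); move: cT; clear; lia.
  have : w \notin Z3 by rewrite (disjointFr d23 wZ).
  move: vZ; rewrite -e !in_front (i2 w wZ) /= -leqNgt; case/andP => _; exact: leq_trans.
have yc w : w \in R -> bef c y w by apply: yR; move: cT tsb ht3 l1; clear; lia.
have xc w : w \in R -> bef c w x by apply: xR; move: cT; clear; lia.
exists c => //; split=> i j.
  rewrite !in_setU1 => /orP[/eqP ->|iZ] /orP[/eqP ->|jZ].
  - by apply: bef_trans (yc m mR) mzc.
  - exact/yc/i2.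
  - by have := forallP (Plow c acc) i; rewrite iZ.
  - by apply: Z12; rewrite ?i2 ?n21.
rewrite !in_setU1 => /orP[/eqP ->|iZ] /orP[/eqP ->|jZ].
- have : 0 < #|Z2| by rewrite c2.
  by case/card_gt0P => w wZ; apply: bef_trans (Zz w (i2 w wZ) (n21 w wZ)) (xc w (i2 w wZ)).
- by apply: Zz; rewrite ?i3 ?n31.
- exact/xc/i2.
- exact: Z23.
Qed.

End Block.

(* Blocks of ten: at the times c1, c2, c3 the order is ABC, BAC and BCA. *)
Record dec (A B C : {set 'I_n}) c1 c2 c3 : Prop := Dec {
  dec_card : [/\ #|A| = 10, #|B| = 10 & #|C| = 10];
  dec_cover : A :|: B :|: C = setT;
  dec_lt : [/\ c1 < c2, c2 < c3 & c3 < c1 + M];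
  dec1 : all_bef c1 A B /\ all_bef c1 B C;
  dec2 : all_bef c2 B A /\ all_bef c2 A C;
  dec3 : all_bef c3 B C /\ all_bef c3 C A }.

Lemma all_bef_flip t X Y : all_bef t X Y -> all_bef (t + M) Y X.
Proof. by move=> h i j iY jX; rewrite bef_period; apply: h. Qed.

(** Half a turn after [c2] the order BAC has become CAB. Three such shifts restore the classes and
    advance time by [4 * M]. *)
Lemma dec_shift A B C c1 c2 c3 :
  dec A B C c1 c2 c3 -> dec C A B (c2 + M) (c3 + M) (c1 + M.*2).
Proof.
case=> -[cA cB cC] cov [l1 l2 l3] [b1 b2] [b3 b4] [b5 b6]; split.
- by [].
- by rewrite -cov -setUA setUC.
- by split; lia.
- by split; apply: all_bef_flip.
- by split; apply: all_bef_flip.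
- by rewrite -addnn addnA; split; do 2!apply: all_bef_flip.
Qed.

Lemma dec_exists : n = 30 -> edges_lt q setT 10 = 165 -> edges_lt q setT 2 = 9 ->
  exists A B C c1 c2 c3, dec A B C c1 c2 c3.
Proof.
move=> n30 E10 E2; have cS : #|[set: 'I_n]| = 30 by rewrite cardsT card_ord.
have [|x [y [z [T0 [T1 [T2 tri]]]]]] := @tripod_exists n M q setT; first by rewrite cS.
have cR := card_rest tri; rewrite cS in cR; pose R := rest setT x y z; rewrite -/R in cR.
have {}cR : #|R| = 27 by move: #|R| cR; clear; lia.
case: (tri) => -[xS yS zS] [xy yz xz] [hx hy hz] [l1 l2 l3] _ _ _.
have nb t : 1 <= back q setT t x + back q setT t y + back q setT t z.
  move: t; apply: (@periodic_window _ T0 M.*2) => [|t|t /andP[h1 h2]].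
  - by rewrite double_gt0 aseq_pos.
  - by rewrite !back_period.
  - exact: nback_ge1 tri _ h1 h2.
have hs k : k.*2 < 30 -> 6 * k + \sum_(0 <= t < M.*2) (act R t && (gate setT t < k)) <=
    edges_lt q setT k + 3 by move=> hk; apply: hull_swaps; rewrite ?cS.
have edge8 t : act R t -> gate setT t < 10 -> gate R t < 8.
  pose f t := nat_of_bool (act R t && (gate R t < 8)).
  pose g t := nat_of_bool (act R t && (gate setT t < 10)).
  have fg s : f s <= g s.
    rewrite /f /g; case: (act R s) => //=; case: ltnP => // h.
    by rewrite (gate_one_back tri _ (nb s) h) // cS.
  (* Removal costs at least [60 - 3] of the 165 swaps, leaving at most 108, which is also the lower
     bound for 27 points at 8. With [fg] this forces equality at every time. *)
  have le : \sum_(0 <= t < M.*2) g t <= \sum_(0 <= t < M.*2) f t.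
    have h1 := hs 10 isT; have := @edges_lower n M q R 8; rewrite cR => /(_ isT) h2.
    have eb : edges_bound 8 27 = 108 by [].
    rewrite E10 in h1; rewrite eb in h2; apply: leq_trans h2; move: h1; rewrite -/g.
    by move: (\sum_(_ <= t < _) _) => s; clear; lia.
  have eqfg s : f s = g s.
    move: s; apply: (@periodic_window _ 0 M.*2) => [|s|s hs'].
    - by rewrite double_gt0 aseq_pos.
    - by rewrite /f /g !act_period2 !gate_period2.
    - exact: (sum_nat_eq_pointwise fg le).
  by move: (eqfg t); rewrite /f /g => e ha hg; move: e; rewrite ha hg; case: ltnP.
have edge0 t : act R t -> 1 < gate setT t.
  move=> ha; rewrite ltnNge -ltnS; apply/negP => hg.
  (* [12 + sum <= 9 + 3]: all swaps at gates 0 and 1 involve a removed point. *)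
  have := hs 2 isT; rewrite E2 => h.
  pose f t := nat_of_bool (act R t && (gate setT t < 2)).
  have s0 : \sum_(0 <= t < M.*2) f t = 0.
    by move: h; rewrite -/f; move: (\sum_(_ <= t < _) _) => s; clear; lia.
  suff : f t = 0 by rewrite /f ha hg.
  move: {ha hg} t; apply: (@periodic_window _ 0 M.*2) => [|s|s hs'].
  - by rewrite double_gt0 aseq_pos.
  - by rewrite /f !act_period2 !gate_period2.
  - move/eqP: s0; rewrite sum_nat_seq_eq0 => /allP /(_ s).
    by rewrite mem_index_iota => /(_ hs') /eqP.
have tri' := tripod_rot tri; have tri'' := tripod_rot tri'.
have r1 : rest setT y z x = R by exact: rest_rot.
have r2 : rest setT z x y = R by rewrite rest_rot.
have [e8' e0'] : (forall t, act (rest setT y z x) t -> gate setT t < 10 ->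
    gate (rest setT y z x) t < 8) /\ (forall t, act (rest setT y z x) t -> 1 < gate setT t).
  by rewrite r1.
have [e8'' e0''] : (forall t, act (rest setT z x y) t -> gate setT t < 10 ->
    gate (rest setT z x y) t < 8) /\ (forall t, act (rest setT z x y) t -> 1 < gate setT t).
  by rewrite r2.
have [a la [ab bc]] := block_time n30 tri edge8 edge0.
have [c lc [bc' ca']] := block_time n30 tri' e8' e0'.
have [b lb [ca'' ab'']] := block_time n30 tri'' e8'' e0''.
have [c1 c2 c3] := card_Z n30 tri.
have ZR := Z_R n30 tri edge8.
have [d12 d13 d23] := front_disj n30 tri edge8.
have e3 : front q R 9 (T0 + M + M) = front q R 9 T0 by rewrite -addnA addnn front_period.
have e4 : front q R 9 (T2 + M + M) = front q R 9 T2 by rewrite -addnA addnn front_period.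
rewrite r1 e3 in bc' ca'; rewrite r2 e3 e4 in ca'' ab''; rewrite -/R in ab bc ZR c1 c2 c3.
(* The time [b] is found half a turn after its place between [a] and [c]. *)
exists (y |: front q R 9 T0), (z |: front q R 9 T2), (x |: front q R 9 (T1 + M)), a, (b - M), c.
have Mb : M <= b by move: lb; clear; lia.
have nin w T : w \in [set x; y; z] -> (w \in front q R 9 T) = false.
  by move=> wH; rewrite in_front /R /rest in_setD wH.
split.
- by rewrite !cardsU1 !nin ?c1 ?c2 ?c3 // !inE eqxx ?orbT.
- apply/setP => w; have := ZR w.
  have -> : (w \in R) = ~~ [|| w == x, w == y | w == z].
    by rewrite /R /rest in_setD in_setT andbT !in_setU !in_set1 orbA.
  by rewrite !in_setU !in_set1 in_setT; do 3!case: (w == _); rewrite /= ?orbT // -?orbA => <-; rewrite ?orbT.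
- by split; move: la lb lc l1 l2 l3 aseq_pos; clear; lia.
- by split.
- by split => i j hi hj; apply: bef_flip; rewrite subnK //; [apply: ab''|apply: ca''].
- by split.
Qed.
End Decomp.

(** * The four central wires *)

Section Center.
Variables (n M : nat) (q : aseq n M).
Implicit Types (t s r k : nat) (i j m w : 'I_n).
Hypothesis n30 : n = 30.
Notation lw := (lw q).
Notation rw := (rw q).
Notation bef := (bef q).

Definition ps t i := pos q [set: 'I_n] t i.
Definition gt t := gate q [set: 'I_n] t.

Let cT : #|[set: 'I_n]| = 30. Proof. by rewrite cardsT card_ord. Qed.

Lemma ps_lt t i : ps t i < 30.
Proof. by rewrite -cT; apply: pos_lt; rewrite in_setT. Qed.

Lemma gt_lt t : gt t < 29.
Proof. by have := @gate_lt _ _ q setT t; rewrite cT /act !in_setT => /(_ isT). Qed.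

Lemma ps_inj t i j : ps t i = ps t j -> i = j.
Proof. by apply: pos_inj; rewrite in_setT. Qed.

Lemma ps_surj t p : p < 30 -> exists i, ps t i = p.
Proof. by rewrite -cT => /(pos_surj q t)[i _ e]; exists i. Qed.

Lemma ps_bef t i j : bef t i j = (ps t i < ps t j).
Proof. by apply: bef_pos; rewrite in_setT. Qed.

Lemma ps_l t : ps t (lw t) = gt t. Proof. by []. Qed.
Lemma ps_r t : ps t (rw t) = (gt t).+1. Proof. by apply: pos_lr; rewrite in_setT. Qed.
Lemma ps_l1 t : ps t.+1 (lw t) = (gt t).+1.
Proof. by rewrite /ps pos_step_l in_setT addn1. Qed.
Lemma ps_r1 t : ps t.+1 (rw t) = gt t. Proof. exact: pos_step_r. Qed.
Lemma ps_o1 t i : i != lw t -> i != rw t -> ps t.+1 i = ps t i.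
Proof. exact: pos_step_other. Qed.

Lemma ps_period t i : ps (t + M) i + ps t i = 29.
Proof. by rewrite /ps pos_period ?in_setT // cT. Qed.

Lemma gt_period t : gt (t + M) + gt t = 28.
Proof. by rewrite /gt gate_period ?cT // /act !in_setT. Qed.

(* The four central positions; an event is a swap exchanging a central wire
   with an outer one. *)
Definition K t := [set i | 13 <= ps t i <= 16].
Definition ev t := (gt t == 12) || (gt t == 16).
Definition ctr t := 13 <= gt t <= 15.
Definition ent t := if gt t == 12 then lw t else rw t.
Definition ext t := if gt t == 12 then rw t else lw t.

Lemma in_K t i : (i \in K t) = (13 <= ps t i <= 16).
Proof. by rewrite inE. Qed.

Lemma K_period t : K (t + M) = K t.
Proof.
apply/setP => i; rewrite !in_K; have := ps_period t i.
by move: (ps _ _) (ps _ _); clear; lia.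
Qed.

Lemma ev_period t : ev (t + M) = ev t.
Proof. by rewrite /ev; have := gt_period t; move: (gt _) (gt _); clear; lia. Qed.

Lemma ctr_period t : ctr (t + M) = ctr t.
Proof. by rewrite /ctr; have := gt_period t; move: (gt _) (gt _); clear; lia. Qed.

Lemma K_step t : ~~ ev t -> K t.+1 = K t.
Proof.
rewrite /ev => h; apply/setP => i; rewrite !in_K.
have [->|l] := eqVneq i (lw t); first by rewrite ps_l1 ps_l; move: (gt t) h; clear; lia.
have [->|r] := eqVneq i (rw t); first by rewrite ps_r1 ps_r; move: (gt t) h; clear; lia.
by rewrite ps_o1.
Qed.

Lemma K_ev t : ev t -> [/\ ext t \in K t, ent t \notin K t, ext t != ent t &
  K t.+1 = ent t |: (K t :\ ext t)].
Proof.
rewrite /ev /ext /ent !in_K => h; have lr := lr_neq q t.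
have [g|g] := eqVneq (gt t) 12.
  rewrite ps_l ps_r g; split; rewrite // 1?eq_sym //.
  apply/setP => i; rewrite in_setU1 in_setD1 !in_K.
  have [->|l] := eqVneq i (lw t); first by rewrite ps_l1 g.
  have [->|r] := eqVneq i (rw t); first by rewrite ps_r1 g.
  by rewrite ps_o1.
rewrite (negbTE g) /= in h; move/eqP: h => h.
rewrite ps_l ps_r h; split; rewrite // 1?eq_sym //.
apply/setP => i; rewrite in_setU1 in_setD1 !in_K.
have [->|r] := eqVneq i (rw t); first by rewrite ps_r1 h.
have [->|l] := eqVneq i (lw t); first by rewrite ps_l1 h.
by rewrite ps_o1.
Qed.

Lemma card_K t : #|K t| = 4.
Proof.
have -> : K t = front q setT 17 t :\: front q setT 13 t.
  apply/setP => i; rewrite in_setD !in_front in_K !in_setT /= -/(ps t i).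
  by move: (ps t i); clear; lia.
rewrite cardsD (setIidPr _) ?card_front ?cT //.
apply/subsetP => i; rewrite !in_front !in_setT /= => h; exact: leq_trans h _.
Qed.

Lemma ctr_K t : (lw t \in K t) && (rw t \in K t) = ctr t.
Proof. by rewrite !in_K ps_l ps_r /ctr; move: (gt t); clear; lia. Qed.

(* i and j have been swapped and both have stayed central ever since. *)
Fixpoint crossed t i j : bool :=
  if t is t'.+1 then
    [&& i \in K t, j \in K t, i \in K t', j \in K t' & crossed t' i j || pswap q t' i j]
  else false.

Lemma crossed_sym t i j : crossed t i j = crossed t j i.
Proof.
elim: t i j => // t IH i j /=; rewrite IH /pswap [X in _ || X]orbC.
by do 4!case: (_ \in _).
Qed.

Lemma crossed_in t i j : crossed t i j -> (i \in K t) && (j \in K t).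
Proof. by case: t => // t /= /and3P[-> ->]. Qed.

Lemma crossed_swap t i j : crossed t i j ->
  exists s, [/\ s < t, pswap q s i j & forall r, s <= r <= t -> (i \in K r) && (j \in K r)].
Proof.
elim: t => // t IH /= /and5P[k1 k2 k3 k4 /orP[/IH[s [st sw h]]|sw]].
  exists s; split=> //; first exact: ltnW.
  move=> r hr; have [e|ne] := eqVneq r t.+1; first by rewrite e k1.
  by apply: h; move: hr ne; clear; lia.
exists t; split=> // r hr; have [e|ne] := eqVneq r t.+1; first by rewrite e k1.
by rewrite (_ : r = t) ?k3 //; move: hr ne; clear; lia.
Qed.

Variables (A B C : {set 'I_n}) (c1 c2 c3 : nat).
Hypothesis D : dec q A B C c1 c2 c3.

Lemma blocks_pos t (X Y Z : {set 'I_n}) : #|X| = 10 -> #|Y| = 10 -> #|Z| = 10 ->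
  X :|: Y :|: Z = setT -> all_bef q t X Y -> all_bef q t Y Z ->
  forall i, [/\ (i \in X) = (ps t i < 10), (i \in Y) = (10 <= ps t i < 20) &
     (i \in Z) = (20 <= ps t i)].
Proof.
move=> cX cY cZ cov XY YZ.
have XZ i j : i \in X -> j \in Z -> bef t i j.
  move=> iX jZ; have : 0 < #|Y| by rewrite cY.
  by case/card_gt0P => m mY; apply: bef_trans (XY i m iX mY) (YZ m j mY jZ).
have dX i : i \in X -> ps t i < 10.
  move=> iX; rewrite -cX; apply: proper_card; apply/properP; split; last first.
    by exists i; rewrite // inE bef_irr andbF.
  apply/subsetP => m; rewrite inE => /andP[_ mi].
  have : m \in X :|: Y :|: Z by rewrite cov in_setT.
  case/setUP => [/setUP[//|mY]|mZ]; have /negP[] := bef_asym mi; [exact: XY|exact: XZ].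
have dZ i : i \in Z -> 20 <= ps t i.
  move=> iZ; have e := cardsUI X Y.
  have d : X :&: Y = set0.
    by apply/setP => m; rewrite !inE; apply/negP => /andP[mX mY]; have := XY m m mX mY; rewrite bef_irr.
  rewrite d cards0 addn0 cX cY in e; rewrite (_ : 20 = #|X :|: Y|); last by rewrite e.
  apply: subset_leq_card; apply/subsetP => m; rewrite !inE => /orP[mX|mY]; [exact: XZ|exact: YZ].
have dY i : i \in Y -> 10 <= ps t i < 20.
  move=> iY; apply/andP; split.
    by rewrite -{1}cX; apply: subset_leq_card; apply/subsetP => m mX; rewrite !inE; exact: XY.
  have e := cardsUI Y X; have d : Y :&: X = set0.
    by apply/setP => m; rewrite !inE; apply/negP => /andP[mY mX]; have := XY m m mX mY; rewrite bef_irr.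
  rewrite d cards0 addn0 cX cY in e; rewrite (_ : 20 = #|Y :|: X|); last by rewrite e.
  apply: proper_card; apply/properP; split; last first.
    by exists i; rewrite !inE ?iY // bef_irr.
  apply/subsetP => m; rewrite !inE => /= mi.
  have : m \in X :|: Y :|: Z by rewrite cov in_setT.
  case/setUP => [/setUP[-> |->]|mZ]; rewrite ?orbT //.
  by have /negP[] := bef_asym mi; exact: YZ.
move=> i; have : i \in X :|: Y :|: Z by rewrite cov in_setT.
have hX := dX i; have hY := dY i; have hZ := dZ i.
rewrite !in_setU; move: hX hY hZ.
case: (i \in X); case: (i \in Y); case: (i \in Z) => //= hX hY hZ _;
  try (have := hX isT); try (have := hY isT); try (have := hZ isT);
  by move: (ps t i); clear; split; lia.
Qed.

Lemma pos_c1 i : [/\ (i \in A) = (ps c1 i < 10), (i \in B) = (10 <= ps c1 i < 20) &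
     (i \in C) = (20 <= ps c1 i)].
Proof. by case: D => -[cA cB cC] cov _ [h1 h2] _ _; apply: blocks_pos. Qed.
Lemma pos_c2 i : [/\ (i \in B) = (ps c2 i < 10), (i \in A) = (10 <= ps c2 i < 20) &
     (i \in C) = (20 <= ps c2 i)].
Proof. by case: D => -[cA cB cC] cov _ _ [h1 h2] _; apply: blocks_pos => //; rewrite [B :|: A]setUC. Qed.
Lemma pos_c3 i : [/\ (i \in B) = (ps c3 i < 10), (i \in C) = (10 <= ps c3 i < 20) &
     (i \in A) = (20 <= ps c3 i)].
Proof. by case: D => -[cA cB cC] cov _ _ _ [h1 h2]; apply: blocks_pos => //; rewrite setUC setUA cov. Qed.

Lemma K_c1 i : i \in K c1 -> i \in B.
Proof. by case: (pos_c1 i) => _ -> _; rewrite in_K; move: (ps c1 i); clear; lia. Qed.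
Lemma K_c2 i : i \in K c2 -> i \in A.
Proof. by case: (pos_c2 i) => _ -> _; rewrite in_K; move: (ps c2 i); clear; lia. Qed.

(** At [c1] only wires of [B] are central, at [c2] only wires of [A]. *)
Lemma leave i : exists2 r, r < M & i \notin K r.
Proof.
have [r hr] : exists r, i \notin K r.
  have [k1|] := boolP (i \in K c1); last by exists c1.
  exists c2; apply/negP => /K_c2; have := K_c1 k1; case: (pos_c1 i) => -> -> _.
  by case: (pos_c1 i) => _ _ _; move: (ps c1 i); clear; lia.
exists (r %% M); first by rewrite ltn_mod; exact: aseq_pos q.
apply: contra hr => h; rewrite (divn_eq r M) addnC.
by elim: (r %/ M) => [|k IH]; rewrite ?mul0n ?addn0 // mulSn addnCA addnC K_period.
Qed.

Lemma leave_window i a : exists2 r, a <= r < a + M & i \notin K r.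
Proof.
have [/hasP[r]|/hasPn no] := boolP (has (fun r => i \notin K r) (index_iota a (a + M))).
  by rewrite mem_index_iota => hr ki; exists r.
have [r _ /negP[]] := leave i; move: r.
apply: (@periodic_window _ a M) => [|t|t ht]; first exact: aseq_pos q.
- by rewrite K_period.
- by apply: contraT => h; have := no t; rewrite mem_index_iota ht h => /(_ isT).
Qed.

Lemma pswap_far s t i j : s < t -> pswap q s i j -> pswap q t i j -> s + M <= t.
Proof.
move=> st h1 h2; apply: (@swap_once _ _ q _ _ st).
have e t' : pswap q t' i j -> [set lw t'; rw t'] = [set i; j].
  by case/orP=> /andP[/eqP <- /eqP <-] //; rewrite setUC.
by rewrite (e s h1) (e t h2).
Qed.

(** An earlier swap of the same pair lies at least [M] back, and no wire stays central for so
    long. *)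
Lemma crossed_once t i j : pswap q t i j -> crossed t i j = false.
Proof.
move=> sw; apply/negP => /crossed_swap[s [st sw' h]].
have far := pswap_far st sw' sw.
have [r hr /negP[]] := leave_window i s.
have hr2 : s <= r <= t by move: hr far; clear; lia.
by case/andP: (h r hr2).
Qed.

(** The record starts empty at time 0, and an absence of [i] from the centre resets it; before time
    [M] such an absence has occurred. *)
Lemma crossed_period t i j : M <= t -> crossed (t + M) i j = crossed t i j.
Proof.
have [r rM ki] := leave i; have : forall t, r <= t -> crossed (t + M) i j = crossed t i j.
  elim=> [|{}t IH].
    rewrite leqn0 => /eqP r0; rewrite add0n /=; apply/negP => /crossed_in /andP[].
    by rewrite -(add0n M) K_period -r0 (negbTE ki).
  rewrite leq_eqVlt => /orP[/eqP e|/IH {}IH].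
    have no s : K s = K t.+1 -> crossed s i j = false.
      by move=> e'; apply/negP => /crossed_in /andP[]; rewrite e' -e (negbTE ki).
    by rewrite !no // K_period.
  by rewrite addSn /= IH -addSn !K_period pswap_period.
by move=> h Mt; apply: h; apply: ltnW; apply: leq_trans rM Mt.
Qed.

(** A potential counting ordered crossed pairs: a central swap adds 2, an event removes the pairs of
    the leaving wire, in both orders. *)
Let Phi t := \sum_i \sum_j crossed t i j.

Lemma crossed_step t i j : ~~ ev t ->
  crossed t.+1 i j = crossed t i j || ctr t && pswap q t i j.
Proof.
move=> h; rewrite /= K_step // -ctr_K; have [cr|_] := boolP (crossed t i j).
  by case/andP: (crossed_in cr) => -> ->.
rewrite /=; have [sw|] := boolP (pswap q t i j); last by rewrite !andbF.
have -> : (lw t \in K t) && (rw t \in K t) = (i \in K t) && (j \in K t).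
  by case/orP: sw => /andP[/eqP -> /eqP ->]; rewrite // andbC.
by do 2!case: (_ \in _).
Qed.

Lemma crossed_ev t i j : ev t ->
  crossed t.+1 i j = [&& crossed t i j, i != ext t & j != ext t].
Proof.
move=> h; have [k1 k2 k3 k4] := K_ev h; rewrite /= k4 !in_setU1 !in_setD1.
have no : pswap q t i j -> (i \in K t) && (j \in K t) = false.
  move=> sw; apply/negP => /andP[ki kj]; have : ctr t.
    rewrite -ctr_K; move: sw; rewrite /pswap.
    by case/orP=> /andP[/eqP -> /eqP ->]; rewrite ki kj.
  by move: h; rewrite /ev /ctr; move: (gt t); clear; lia.
have [cr|_] := boolP (crossed t i j).
  case/andP: (crossed_in cr) => ki kj; rewrite ki kj !andbT /=.
  have -> : (i == ent t) = false by apply: contraNF k2 => /eqP <-.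
  have -> : (j == ent t) = false by apply: contraNF k2 => /eqP <-.
  by do 2!case: (_ == _).
rewrite /=; have [/no /negbT|_] := boolP (pswap q t i j); last by rewrite !andbF.
by rewrite negb_and; do 2!case: (_ \in _); rewrite ?andbF.
Qed.

Lemma crossed_irr t i : crossed t i i = false.
Proof.
apply/negP => /crossed_swap[s [_ sw _]]; have := lr_neq q s; move: sw.
by case/orP=> /andP[/eqP -> /eqP ->]; rewrite eqxx.
Qed.

Lemma Phi_ctr t : ctr t -> Phi t.+1 = Phi t + 2.
Proof.
move=> c; have nev : ~~ ev t by move: c; rewrite /ev /ctr; move: (gt t); clear; lia.
have lr := lr_neq q t.
have e i j : crossed t.+1 i j = crossed t i j + ((i == lw t) && (j == rw t))
    + ((i == rw t) && (j == lw t)) :> nat.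
  rewrite crossed_step // c /=.
  have [sw|] := boolP (pswap q t i j).
    rewrite (crossed_once sw); move: sw; rewrite /pswap.
    by case/orP=> /andP[/eqP <- /eqP <-]; rewrite !eqxx // [rw t == _]eq_sym (negbTE lr).
  rewrite /pswap negb_or orbF [lw t == i]eq_sym [rw t == j]eq_sym.
  by rewrite [lw t == j]eq_sym [rw t == i]eq_sym andbC [(j == lw t) && _]andbC => /andP[/negbTE -> /negbTE ->]; rewrite !addn0.
rewrite /Phi; under eq_bigr => i _ do (under eq_bigr => j _ do rewrite e).
have s1 (a b : 'I_n) : \sum_i \sum_j ((i == a) && (j == b)) = 1.
  rewrite (bigD1 a) //= (bigD1 b) //= !eqxx big1 ?big1 // => i.
    by move=> /negbTE h; rewrite big1 // => j _; rewrite h.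
  by move=> /negbTE ->.
by under eq_bigr => i _ do rewrite 2!big_split; rewrite 2!big_split /= !s1 -addnA.
Qed.

Let dg t := \sum_j crossed t (ext t) j.

Lemma dg_le t : ev t -> dg t <= 3.
Proof.
move=> h; have [k1 _ _ _] := K_ev h.
apply: (@leq_trans #|K t :\ ext t|); last first.
  by have := card_K t; rewrite (cardsD1 (ext t)) k1; move: #|_|; clear; lia.
rewrite -sum1_card [X in _ <= X]big_mkcond /=; apply: leq_sum => j _.
have [cr|//] := boolP (crossed t (ext t) j).
rewrite in_setD1; case/andP: (crossed_in cr) => _ ->.
by have [e|//] := eqVneq j (ext t); rewrite e crossed_irr in cr.
Qed.

Lemma Phi_ev t : ev t -> Phi t.+1 + 2 * dg t = Phi t.
Proof.
move=> h; rewrite /Phi /dg mul2n -addnn.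
have e i j : crossed t i j = crossed t.+1 i j + (i == ext t) * crossed t i j +
    (j == ext t) * crossed t i j :> nat.
  rewrite crossed_ev //; have [cr|] := boolP (crossed t i j) => /=; last by rewrite !muln0.
  have [ei|] := eqVneq i (ext t); have [ej|] := eqVneq j (ext t) => //=.
  by rewrite ei ej crossed_irr in cr.
have e2 : \sum_i \sum_j crossed t i j = \sum_i \sum_j crossed t.+1 i j +
    \sum_i \sum_j (i == ext t) * crossed t i j + \sum_i \sum_j (j == ext t) * crossed t i j.
  rewrite -2!big_split; apply: eq_bigr => i _; rewrite -2!big_split; apply: eq_bigr => j _.
  exact: e.
rewrite [RHS]e2 addnA; congr (_ + _ + _).
  rewrite [RHS](bigD1 (ext t)) //= [X in _ = _ + X]big1 ?addn0.
    by apply: eq_bigr => j _; rewrite eqxx mul1n.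
  by move=> i /negbTE ne; rewrite big1 // => j _; rewrite ne.
apply: eq_bigr => i _; rewrite [RHS](bigD1 (ext t)) //= [X in _ = _ + X]big1 ?addn0.
  by rewrite eqxx mul1n crossed_sym.
by move=> j /negbTE ->.
Qed.

Lemma Phi_other t : ~~ ev t -> ~~ ctr t -> Phi t.+1 = Phi t.
Proof.
move=> h1 h2; apply: eq_bigr => i _; apply: eq_bigr => j _.
by rewrite crossed_step // (negbTE h2) orbF.
Qed.

Hypothesis events : \sum_(0 <= t < M) ev t = 48.
Hypothesis centers : \sum_(0 <= t < M) ctr t = 144.

Lemma Phi_sum a b : a <= b ->
  Phi b + 2 * \sum_(a <= t < b) (ev t * dg t) = Phi a + 2 * \sum_(a <= t < b) ctr t.
Proof.
elim: b => [|b IH]; first by rewrite leqn0 => /eqP ->; rewrite !big_geq.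
rewrite leq_eqVlt => /orP[/eqP ->|]; first by rewrite !big_geq.
rewrite ltnS => ab; have := IH ab; rewrite !big_nat_recr //=.
have [h|h] := boolP (ev b).
  have -> : ctr b = false by move: h; rewrite /ev /ctr; move: (gt b); clear; lia.
  have := Phi_ev h; rewrite mul1n.
  by move: (Phi _) (Phi _) (Phi _) (dg _) (\sum_(_ <= t < _) _) (\sum_(_ <= t < _) _); clear; lia.
have [c|c] := boolP (ctr b); [have := Phi_ctr c|have := Phi_other h c]; rewrite mul0n;
  by move: (Phi _) (Phi _) (Phi _) (\sum_(_ <= t < _) _) (\sum_(_ <= t < _) _); clear; lia.
Qed.

(* No waste: in a half turn 144 central swaps are undone by 48 events, and an
   event undoes at most three of them, so each undoes exactly three. *)
Lemma exit_crossed t j : M <= t -> ev t -> j \in K t -> j != ext t ->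
  crossed t (ext t) j.
Proof.
move=> Mt et kj jx; have := Phi_sum (leq_addr M t).
have -> : Phi (t + M) = Phi t.
  by apply: eq_bigr => i _; apply: eq_bigr => k _; rewrite crossed_period.
have -> : \sum_(t <= s < t + M) ctr s = 144.
  by rewrite -centers -(@sum_nat_period (fun s => ctr s) M t) // => s; rewrite ctr_period.
move=> s144.
have e48 : \sum_(t <= s < t + M) (ev s * 3) = 144.
  rewrite -big_distrl /= (@sum_nat_period (fun s => ev s)) ?events // => s.
  by rewrite ev_period.
have le s : ev s * dg s <= ev s * 3.
  by rewrite leq_mul2l; have [/dg_le ->|//] := boolP (ev s); rewrite orbT.
have d3 : dg t = 3.
  have := @sum_nat_eq_pointwise (fun s => ev s * dg s) (fun s => ev s * 3) t (t + M) le.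
  rewrite e48; have -> : \sum_(t <= s < t + M) ev s * dg s = 144.
    by move: s144; move: (Phi t) (\sum_(_ <= s < _) _); clear; lia.
  move=> /(_ (leqnn _) t); rewrite leqnn et !mul1n -{1}[t]addn0 ltn_add2l.
  by move=> /(_ (aseq_pos q)).
apply: contraT => nc; have [k1 _ _ _] := K_ev et.
suff : dg t <= 2 by rewrite d3.
apply: (@leq_trans #|K t :\ ext t :\ j|); last first.
  have := card_K t; rewrite (cardsD1 (ext t)) k1 (cardsD1 j) in_setD1 jx kj.
  by move: #|_|; clear; lia.
rewrite -sum1_card [X in _ <= X]big_mkcond /=; apply: leq_sum => i _.
have [cr|//] := boolP (crossed t (ext t) i).
rewrite !in_setD1; case/andP: (crossed_in cr) => _ ->.
have [e|_] := eqVneq i (ext t); first by rewrite e crossed_irr in cr.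
by have [e|_] := eqVneq i j; first by rewrite -e cr in nc.
Qed.

(** At the end [e] of the common stay around [t] one of the two leaves; by [exit_crossed] it has
    crossed the other, and [crossed] places that swap inside this stay. *)
Lemma coexist_swap t i j a b : M <= t -> i != j -> i \in K t -> j \in K t ->
  a < t -> ~~ ((i \in K a) && (j \in K a)) -> t < b -> ~~ ((i \in K b) && (j \in K b)) ->
  exists s, [/\ a <= s < b, pswap q s i j & 
    forall r, (s <= r <= t) || (t <= r <= s) -> (i \in K r) && (j \in K r)].
Proof.
move=> Mt ij ki kj at1 na tb nb.
have ex : exists r, (t <= r) && ~~ ((i \in K r) && (j \in K r)).
  by exists b; rewrite nb ltnW.
have [e /andP[te ne] emin] := ex_minnP ex.
have inr r : t <= r < e -> (i \in K r) && (j \in K r).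
  by move=> /andP[h1 h2]; apply: contraT => h; have := emin r; rewrite h1 h => /(_ isT); rewrite leqNgt h2.
have eb : e <= b by apply: emin; rewrite nb ltnW.
case: e => [|e] in te ne emin inr eb.
  by move: te at1; clear; lia.
have te' : t <= e.
  by move: te; rewrite leq_eqVlt => /orP[/eqP et|//]; move: ne; rewrite -et ki kj.
have kie : (i \in K e) && (j \in K e) by apply: inr; rewrite te' leqnn.
case/andP: (kie) => kie1 kie2.
have eve : ev e by apply: contraT => h; move: ne; rewrite K_step // kie.
have cr : crossed e i j.
  have [_ _ _ ke] := K_ev eve; have Me := leq_trans Mt te'.
  move: ne; rewrite ke !in_setU1 !in_setD1 kie1 kie2 !andbT negb_and !negb_or !negbK.
  case/orP=> /andP[_ /eqP e1].
    by rewrite e1; apply: exit_crossed; rewrite // -e1 eq_sym.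
  by rewrite crossed_sym e1; apply: exit_crossed; rewrite // -e1.
have [s [se sw h]] := crossed_swap cr.
exists s; split=> //.
  apply/andP; split; last by move: se eb; clear; lia.
  rewrite leqNgt; apply: contra na => sa; apply: h.
  by move: sa at1 te'; clear; lia.
by move=> r /orP[] hr; [apply: h|apply: inr]; move: hr se te'; clear; lia.
Qed.

Hypothesis c1M : M <= c1.

Let l1 : c1 < c2. Proof. by case: D => _ _ []. Qed.
Let l2 : c2 < c3. Proof. by case: D => _ _ []. Qed.
Let l3 : c3 < c1 + M. Proof. by case: D => _ _ []. Qed.

Lemma A_c1 i : i \in A -> i \notin K c1.
Proof. by case: (pos_c1 i) => -> _ _; rewrite in_K; move: (ps c1 i); clear; lia. Qed.
Lemma A_c3 i : i \in A -> i \notin K c3.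
Proof. by case: (pos_c3 i) => _ _ ->; rewrite in_K; move: (ps c3 i); clear; lia. Qed.

(** A wire of [A] is outside the centre at [c1] and at [c3], so a common stay in between lies within
    the window together with its swap. *)
Lemma A_meet t i j : c1 <= t <= c3 -> i \in A -> i != j -> i \in K t -> j \in K t ->
  exists s, [/\ c1 <= s < c3, pswap q s i j & ctr s].
Proof.
move=> ht iA ij ki kj.
have ne1 : c1 != t by apply: contraTneq ki => <-; exact: A_c1.
have ne3 : t != c3 by apply: contraTneq ki => ->; exact: A_c3.
have [|||||s [hs sw h]] := @coexist_swap t i j c1 c3 _ ij ki kj.
- by move: ht c1M; clear; lia.
- by move: ht ne1; clear; lia.
- by rewrite (negbTE (A_c1 iA)).
- by move: ht ne3; clear; lia.
- by rewrite (negbTE (A_c3 iA)).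
exists s; split=> //; rewrite -ctr_K.
have := h s; rewrite leqnn andbT /= leq_total => /(_ isT).
by case/orP: sw => /andP[/eqP -> /eqP ->] /andP[-> ->].
Qed.

(** Two separate common stays would contain two swaps of the same pair less than half a turn
    apart. *)
Lemma coexist_convex s r t i j : i \in A -> i != j -> c1 <= s -> s <= r -> r <= t -> t <= c3 ->
  i \in K s -> j \in K s -> i \in K t -> j \in K t -> (i \in K r) && (j \in K r).
Proof.
move=> iA ij h1 h2 h3 h4 si sj ti tj; apply: contraT => nr.
have n1 : c1 != s by apply: contraTneq si => <-; exact: A_c1.
have n2 : s != r by apply: contraNneq nr => <-; rewrite si sj.
have n3 : r != t by apply: contraNneq nr => ->; rewrite ti tj.
have n4 : t != c3 by apply: contraTneq ti => ->; exact: A_c3.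
have [|||||a [ha swa _]] := @coexist_swap s i j c1 r _ ij si sj.
- by move: h1 c1M; clear; lia.
- by move: h1 n1; clear; lia.
- by rewrite (negbTE (A_c1 iA)).
- by move: h2 n2; clear; lia.
- by [].
have [|||||b [hb swb _]] := @coexist_swap t i j r c3 _ ij ti tj.
- by move: h1 h2 h3 c1M; clear; lia.
- by move: h3 n3; clear; lia.
- by [].
- by move: h4 n4; clear; lia.
- by rewrite (negbTE (A_c3 iA)).
have := @pswap_far a b i j _ swa swb.
by move: ha hb l3; clear; lia.
Qed.

End Center.

(** * Counting central swaps and events class by class *)

Lemma sum_eq_in (T : finType) (X : {set T}) (b : bool) (w : T) :
  \sum_(i in X) (b && (w == i)) = b && (w \in X).
Proof.
have [wX|wX] := boolP (w \in X).
  rewrite (bigD1 w) //= eqxx big1 ?addn0 // => i /andP[_ /negbTE ne].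
  by rewrite eq_sym ne andbF.
rewrite big1 ?andbF // => i iX; have [e|] := eqVneq w i; last by rewrite andbF.
by rewrite e iX in wX.
Qed.

Lemma card_above x : x < 10 -> #|[set p : 'I_10 | x < p]| <= 9 - x.
Proof.
move=> hx; rewrite -sum1_card big_mkcond /=.
under eq_bigr => p _ do rewrite inE.
rewrite !big_ord_recl big_ord0.
by move: hx; do 10!(case: x => [|x] //).
Qed.

(** The constraints give [o l <= minn (9 - l) (3 + l)], and these minima 3, 4, 5, 6, 5, 4, 3, 2, 1,
    0 add up to 33. So all are attained, and for [l < 4] the second term leaves no slack in [i] and
    [b]. *)
Lemma degree_arith (o i b : nat -> nat) k :
  (forall l, l < 10 -> [/\ o l <= 9 - l, i l <= l & o l + b l = 3 + i l]) ->
  \sum_(l < 10) o l = 33 -> k < 4 -> [/\ b k = 0, i k = k & o k = 3 + k].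
Proof.
move=> h; have -> : \sum_(l < 10) o l = o 0 + o 1 + o 2 + o 3 + o 4 + o 5 + o 6 + o 7 + o 8 + o 9.
  by rewrite -(big_mkord xpredT o) unlock /= addn0 !addnA.
have [x0 y0 z0] := h 0 isT; have [x1 y1 z1] := h 1 isT; have [x2 y2 z2] := h 2 isT.
have [x3 y3 z3] := h 3 isT; have [x4 _ _] := h 4 isT; have [x5 _ _] := h 5 isT.
have [x6 _ _] := h 6 isT; have [x7 _ _] := h 7 isT; have [x8 _ _] := h 8 isT.
have [x9 _ _] := h 9 isT; clear h.
by case: k => [|[|[|[|//]]]] e _; split; lia.
Qed.

Section Counts.
Variables (n M : nat) (q : aseq n M).
Implicit Types (t s r k : nat) (i j m w : 'I_n) (X : {set 'I_n}).
Hypothesis n30 : n = 30.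
Notation lw := (lw q).
Notation rw := (rw q).
Notation bef := (bef q).
Notation ps := (ps q).
Notation gt := (gt q).
Notation ev := (ev q).
Notation ctr := (ctr q).
Notation K := (K q).

Definition mono X t := (lw t \in X) && (rw t \in X).
Definition mix X t := (lw t \in X) (+) (rw t \in X).

Lemma mono_period X t : mono X (t + M) = mono X t.
Proof. by rewrite /mono lw_period rw_period andbC. Qed.
Lemma mix_period X t : mix X (t + M) = mix X t.
Proof. by rewrite /mix lw_period rw_period addbC. Qed.

(** Only swaps at gate [g] change this count, so its growth measures the flow of [X] through that
    gate. *)
Definition beyond X g t := \sum_(i in X) (g < ps t i).

Lemma beyond_step X g t :
  beyond X g t.+1 + ((gt t == g) && (rw t \in X)) = beyond X g t + ((gt t == g) && (lw t \in X)).
Proof.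
rewrite -!(sum_eq_in X) /beyond -!big_split; apply: eq_bigr => i _ /=.
have lr := lr_neq q t.
have [<-|l] := eqVneq (lw t) i.
  rewrite ps_l1 (ps_l q t) [rw t == _]eq_sym (negbTE lr) andbF andbT.
  by move: (gt t); clear; lia.
have [<-|r] := eqVneq (rw t) i.
  by rewrite ps_r1 (ps_r q t) andbF andbT; move: (gt t); clear; lia.
by rewrite ps_o1 // 1?eq_sym // !andbF.
Qed.

Lemma beyond_sum X g a b : a <= b ->
  beyond X g b + \sum_(a <= t < b) ((gt t == g) && (rw t \in X)) =
  beyond X g a + \sum_(a <= t < b) ((gt t == g) && (lw t \in X)).
Proof.
elim: b => [|b IH]; first by rewrite leqn0 => /eqP ->; rewrite !big_geq.
rewrite leq_eqVlt => /orP[/eqP ->|]; first by rewrite !big_geq.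
rewrite ltnS => ab; have := IH ab; have := beyond_step X g b; rewrite !big_nat_recr //=.
move: (beyond _ _ _) (beyond _ _ _) (beyond _ _ _) => x y z.
by do 2!(move: (\sum_(_ <= t < _) _) => ?); do 2!case: (_ && _); clear; lia.
Qed.

Variables (A B C : {set 'I_n}) (c1 c2 c3 : nat).
Hypothesis D : dec q A B C c1 c2 c3.

Let l1 : c1 < c2. Proof. by case: D => _ _ []. Qed.
Let l2 : c2 < c3. Proof. by case: D => _ _ []. Qed.
Let l3 : c3 < c1 + M. Proof. by case: D => _ _ []. Qed.

Lemma A_first i j : i \in A -> j \notin A -> bef c1 i j.
Proof.
by rewrite (ps_bef q c1); case: (pos_c1 D i) => -> _ _; case: (pos_c1 D j) => -> _ _;
  rewrite -leqNgt; exact: leq_trans.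
Qed.

Lemma A_last i j : i \in A -> j \notin A -> bef c3 j i.
Proof.
by rewrite (ps_bef q c3); case: (pos_c3 D i) => _ _ ->; case: (pos_c3 D j) => _ _ ->;
  rewrite -ltnNge => h1 h2; exact: leq_trans h1.
Qed.

(** [A] is first at [c1] and last at [c3], so in this window its wires pass all others from left to
    right. *)
Lemma A_right t : c1 <= t < c3 -> rw t \in A -> lw t \in A.
Proof.
move=> /andP[h1 h2] rA; apply: contraT => lA.
have b1 := A_first rA lA; have b2 := bef_lr q t.
have h3 : t.+1 <= c1 + M by apply: leq_trans h2 (ltnW l3).
have := bef_mono h1 (leqnSn t) h3 b1 b2.
by have := bef_asym (bef_step_swap q t) => /negbTE ->.
Qed.

Lemma A_after t i j : c3 <= t <= c1 + M -> i \in A -> j \notin A -> bef t j i.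
Proof.
move=> /andP[h1 h2] iA jA; apply: (bef_between h1 h2).
- by move: l1 l2; clear; lia.
- exact: A_last.
- by rewrite bef_period; exact: A_first.
Qed.

Lemma A_late t : c3 <= t < c1 + M -> (lw t \in A) = (rw t \in A).
Proof.
move=> /andP[h1 h2]; have h3 : c3 <= t <= c1 + M by rewrite h1 ltnW.
have h4 : c3 <= t.+1 <= c1 + M by rewrite h2 andbT ltnW.
apply/idP/idP => h; apply: contraT => h'.
  by have := bef_asym (A_after h3 h h'); rewrite bef_lr.
by have := bef_asym (A_after h4 h h'); rewrite bef_step_swap.
Qed.

Lemma A_late_pos t i : c3 <= t <= c1 + M -> i \in A -> 20 <= ps t i.
Proof.
move=> h iA; case: D => -[cA _ _] _ _ _ _ _.
have cI : #|'I_n| = 30 by rewrite card_ord.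
have -> : 20 = #|~: A| by have := cardsC A; rewrite cA cI; move: #|_|; clear; lia.
apply: subset_leq_card; apply/subsetP => j; rewrite !inE => jA; exact: A_after h iA jA.
Qed.

Lemma beyond_c1 X g : X \subset A -> 10 <= g -> beyond X g c1 = 0.
Proof.
move=> XA hg; apply: big1 => i iX; have := subsetP XA i iX.
by case: (pos_c1 D i) => -> _ _; move: (ps c1 i) hg; clear; lia.
Qed.

Lemma beyond_c3 X g : X \subset A -> g < 20 -> beyond X g c3 = #|X|.
Proof.
move=> XA hg; rewrite -sum1_card; apply: eq_bigr => i iX; have := subsetP XA i iX.
by case: (pos_c3 D i) => _ _ ->; move: (ps c3 i) hg; clear; lia.
Qed.

Lemma cross_sum X g : X \subset A -> 10 <= g < 20 ->
  #|X| + \sum_(c1 <= t < c3) ((gt t == g) && (rw t \in X)) =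
  \sum_(c1 <= t < c3) ((gt t == g) && (lw t \in X)).
Proof.
move=> XA /andP[g1 g2]; have := @beyond_sum X g c1 c3 (ltnW (ltn_trans l1 l2)).
by rewrite beyond_c1 // beyond_c3.
Qed.

(** All ten wires of [A] move from before gate [g] to beyond it. Swaps inside [A] carry no net flow
    and mixed ones carry exactly one wire. *)
Lemma mix_gate g : 10 <= g < 20 -> \sum_(c1 <= t < c3) ((gt t == g) && mix A t) = 10.
Proof.
move=> hg; have := cross_sum (subxx A) hg; case: D => -[-> _ _] _ _ _ _ _.
have -> : \sum_(c1 <= t < c3) ((gt t == g) && (lw t \in A)) =
    \sum_(c1 <= t < c3) ((gt t == g) && mix A t) + \sum_(c1 <= t < c3) ((gt t == g) && (rw t \in A)).
  rewrite -big_split big_nat [RHS]big_nat; apply: eq_bigr => t ht; rewrite /mix /=.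
  have := A_right ht; case: (rw t \in A) => [/(_ isT) ->|_]; case: (gt t == g) => //=.
  by rewrite addbF addn0.
by do 2!(move: (\sum_(_ <= t < _) _) => ?); clear; lia.
Qed.

Lemma ctr_gates t : ctr t = (gt t == 13) + (gt t == 14) + (gt t == 15) :> nat.
Proof. by rewrite /ctr; move: (gt t); clear; lia. Qed.
Lemma ev_gates t : ev t = (gt t == 12) + (gt t == 16) :> nat.
Proof. by rewrite /ev; move: (gt t); clear; lia. Qed.

Lemma window_split (f : nat -> nat) : (forall t, f (t + M) = f t) ->
  \sum_(0 <= t < M) f t = \sum_(c1 <= t < c3) f t + \sum_(c3 <= t < c1 + M) f t.
Proof.
move=> fp; rewrite -(@sum_nat_period f M c1 fp) (big_cat_nat (n := c3)) //; last exact: ltnW.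
exact: ltnW (ltn_trans l1 l2).
Qed.

Lemma mix_late (f : nat -> bool) : \sum_(c3 <= t < c1 + M) (f t && mix A t) = 0.
Proof.
rewrite big_nat big1 // => t ht; rewrite /mix (A_late ht).
by case: (rw t \in A); rewrite andbF.
Qed.

Lemma mix_ctr : \sum_(0 <= t < M) (ctr t && mix A t) = 30.
Proof.
rewrite (@window_split (fun t => ctr t && mix A t)) => [|t]; last first.
  by rewrite mix_period ctr_period.
rewrite mix_late addn0.
have e t : ctr t && mix A t = ((gt t == 13) && mix A t) + ((gt t == 14) && mix A t) +
    ((gt t == 15) && mix A t) :> nat.
  by have := ctr_gates t; case: (mix A t); rewrite ?andbT ?andbF.
by under eq_bigr => t _ do rewrite e; rewrite !big_split /= !mix_gate.
Qed.

Lemma mix_ev : \sum_(0 <= t < M) (ev t && mix A t) = 20.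
Proof.
rewrite (@window_split (fun t => ev t && mix A t)) => [|t]; last first.
  by rewrite mix_period ev_period.
rewrite mix_late addn0.
have e t : ev t && mix A t = ((gt t == 12) && mix A t) + ((gt t == 16) && mix A t) :> nat.
  by have := ev_gates t; case: (mix A t); rewrite ?andbT ?andbF.
by under eq_bigr => t _ do rewrite e; rewrite !big_split /= !mix_gate.
Qed.

Lemma mono_late (f : nat -> bool) : (forall t, f t -> gt t < 20) ->
  \sum_(c3 <= t < c1 + M) (f t && mono A t) = 0.
Proof.
move=> fg; rewrite big_nat big1 // => t ht; have [ft|//] := boolP (f t).
have [/andP[lA _]|//] := boolP (mono A t).
have h : 20 <= gt t by apply: (A_late_pos _ lA); case/andP: ht => -> /ltnW.
by have := fg t ft; rewrite ltnNge h.
Qed.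

Lemma mono_ctr : \sum_(0 <= t < M) (ctr t && mono A t) = \sum_(c1 <= t < c3) (ctr t && mono A t).
Proof.
rewrite (@window_split (fun t => ctr t && mono A t)) => [|t]; last first.
  by rewrite mono_period ctr_period.
by rewrite mono_late ?addn0 // => t; rewrite /ctr; move: (gt t); clear; lia.
Qed.

Lemma mono_ev : \sum_(0 <= t < M) (ev t && mono A t) = \sum_(c1 <= t < c3) (ev t && mono A t).
Proof.
rewrite (@window_split (fun t => ev t && mono A t)) => [|t]; last first.
  by rewrite mono_period ev_period.
by rewrite mono_late ?addn0 // => t; rewrite /ev; move: (gt t); clear; lia.
Qed.

(* Out- and in-degree of i in the digraph of central swaps inside A, and number
   of central swaps of i with the other two classes. *)
Definition outd i := \sum_(c1 <= t < c3) (ctr t && mono A t && (lw t == i)).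
Definition ind i := \sum_(c1 <= t < c3) (ctr t && mono A t && (rw t == i)).
Definition bic i := \sum_(c1 <= t < c3) (ctr t && mix A t && (lw t == i)).

(** A wire of [A] has net flow one through each of the gates 13, 14, 15. It moves right in out-swaps
    and mixed swaps, left in in-swaps. *)
Lemma degree i : i \in A -> outd i + bic i = 3 + ind i.
Proof.
move=> iA; have sA : [set i] \subset A by rewrite sub1set.
have e g : 10 <= g < 20 -> 1 + \sum_(c1 <= t < c3) ((gt t == g) && (rw t == i)) =
    \sum_(c1 <= t < c3) ((gt t == g) && (lw t == i)).
  move=> /(cross_sum sA); rewrite cards1; under eq_bigr => t _ do rewrite in_set1.
  by under [in X in _ = X -> _]eq_bigr => t _ do rewrite in_set1.
have eo : outd i + bic i = \sum_(c1 <= t < c3) (ctr t && (lw t == i)).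
  rewrite /outd /bic -big_split; apply: eq_bigr => t _ /=.
  have [e1|] := eqVneq (lw t) i; last by rewrite !andbF.
  by rewrite /mono /mix e1 iA; case: (ctr t); case: (rw t \in A).
have ei : ind i = \sum_(c1 <= t < c3) (ctr t && (rw t == i)).
  rewrite /ind big_nat [RHS]big_nat; apply: eq_bigr => t ht.
  have [e1|] := eqVneq (rw t) i; last by rewrite !andbF.
  have := A_right ht; rewrite e1 iA => /(_ isT) lA.
  by rewrite /mono e1 iA lA !andbT.
rewrite eo ei.
have sp (f : nat -> 'I_n) : \sum_(c1 <= t < c3) (ctr t && (f t == i)) =
    \sum_(c1 <= t < c3) ((gt t == 13) && (f t == i)) +
    \sum_(c1 <= t < c3) ((gt t == 14) && (f t == i)) +
    \sum_(c1 <= t < c3) ((gt t == 15) && (f t == i)).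
  rewrite -!big_split; apply: eq_bigr => t _; have := ctr_gates t.
  by case: (f t == i); rewrite ?andbT ?andbF.
rewrite !sp -!e //.
by do 3!(move: (\sum_(_ <= t < _) _) => ?); clear; lia.
Qed.

Lemma outd_sum : \sum_(i in A) outd i = \sum_(c1 <= t < c3) (ctr t && mono A t).
Proof.
rewrite exchange_big; apply: eq_bigr => t _; rewrite sum_eq_in.
by rewrite /mono; case: (lw t \in A); rewrite ?andbT ?andbF.
Qed.

Lemma mono_once t i j : i \in A -> c1 <= t < c3 -> lw t = i -> rw t = j -> bef c1 i j.
Proof.
move=> iA /andP[h1 h2] e1 e2; apply: contraT => nb.
have ij : i != j by rewrite -e1 -e2; exact: lr_neq.
rewrite -befN in nb => //.
have b2 := bef_lr q t; rewrite e1 e2 in b2.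
have h3 : t.+1 <= c1 + M by apply: leq_trans h2 (ltnW l3).
have := bef_mono h1 (leqnSn t) h3 nb b2.
by have := bef_asym (bef_step_swap q t); rewrite e1 e2 => /negbTE ->.
Qed.

Lemma outd_le i : i \in A -> outd i <= 9 - ps c1 i.
Proof.
move=> iA; have : outd i <= #|[set j in A | ps c1 i < ps c1 j]|.
  apply: (@leq_trans (\sum_(j in [set j in A | ps c1 i < ps c1 j])
      \sum_(c1 <= t < c3) pswap q t i j)); last first.
    rewrite -sum1_card; apply: leq_sum => j _; apply: pswap_once.
    exact: ltnW.
  rewrite exchange_big /outd; apply: sum_nat_leq => t ht.
  have [/andP[/andP[_ /andP[lA rA]] /eqP li]|//] := boolP (ctr t && mono A t && (lw t == i)).
  rewrite (bigD1 (rw t)) /=; first by rewrite /pswap li !eqxx.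
  by rewrite inE rA -(ps_bef q c1) (mono_once iA ht li erefl).
move=> h1; apply: (leq_trans h1) => {h1}.
pose f j := inord (ps c1 j) : 'I_10.
have fj j : j \in A -> f j = ps c1 j :> nat.
  by case: (pos_c1 D j) => -> _ _ h; rewrite inordK.
have fin : {in [set j in A | ps c1 i < ps c1 j] &, injective f}.
  move=> j k; rewrite !inE => /andP[jA _] /andP[kA _] /(congr1 val) /=.
  by rewrite !fj // => /ps_inj.
rewrite -(card_in_imset fin); apply: (@leq_trans #|[set p : 'I_10 | ps c1 i < p]|).
  apply: subset_leq_card; apply/subsetP => p /imsetP[j]; rewrite inE => /andP[jA h] ->.
  by rewrite inE fj.
by apply: card_above; move: iA; case: (pos_c1 D i) => ->.
Qed.

Lemma ind_le i : i \in A -> ind i <= ps c1 i.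
Proof.
move=> iA; suff h : ind i <= #|[set j in A | ps c1 j < ps c1 i]|.
  apply: (leq_trans h); apply: subset_leq_card; apply/subsetP => j.
  by rewrite inE => /andP[_ h']; rewrite !inE (ps_bef q c1).
apply: (@leq_trans (\sum_(j in [set j in A | ps c1 j < ps c1 i])
    \sum_(c1 <= t < c3) pswap q t i j)); last first.
  rewrite -sum1_card; apply: leq_sum => j _; apply: pswap_once.
  exact: ltnW.
rewrite exchange_big /ind; apply: sum_nat_leq => t ht.
have [/andP[/andP[_ /andP[lA rA]] /eqP ri]|//] := boolP (ctr t && mono A t && (rw t == i)).
rewrite (bigD1 (lw t)) /=; first by rewrite /pswap ri !eqxx orbT.
by rewrite inE lA -(ps_bef q c1) (mono_once lA ht erefl ri).
Qed.

(** The wire at position [k] at time [c1]; the default is never reached for [k < 30]. *)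
Definition wr k := odflt (lw 0) [pick i | ps c1 i == k].

Lemma wr_ps k : k < 30 -> ps c1 (wr k) = k.
Proof.
move=> h; rewrite /wr; case: pickP => [i /eqP //|no].
by have [i e] := ps_surj q n30 c1 h; have := no i; rewrite e eqxx.
Qed.

Lemma wr_A k : k < 10 -> wr k \in A.
Proof. by move=> h; case: (pos_c1 D (wr k)) => -> _ _; rewrite wr_ps ?h // (ltn_trans h). Qed.

Lemma wr_inj k l : k < 30 -> l < 30 -> wr k = wr l -> k = l.
Proof. by move=> hk hl e; rewrite -(wr_ps hk) -(wr_ps hl) e. Qed.

Lemma wr_of_ps i : wr (ps c1 i) = i.
Proof. by apply: (@ps_inj _ _ q c1); rewrite wr_ps // ps_lt. Qed.

Lemma sum_A (f : 'I_n -> nat) : \sum_(i in A) f i = \sum_(k < 10) f (wr k).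
Proof.
have e : A = [set wr k | k : 'I_10].
  apply/setP => i; apply/idP/imsetP => [iA|[k _ ->]]; last exact: wr_A.
  have h : ps c1 i < 10 by move: (iA); case: (pos_c1 D i) => ->.
  by exists (Ordinal h); rewrite // wr_of_ps.
rewrite e big_imset //= => k l _ _ /wr_inj h; apply: val_inj; apply: h.
  by apply: ltn_trans (ltn_ord k) _.
by apply: ltn_trans (ltn_ord l) _.
Qed.

Lemma mono_le33 : \sum_(0 <= t < M) (ctr t && mono A t) <= 33.
Proof.
rewrite mono_ctr -outd_sum sum_A.
have b k : k < 10 -> outd (wr k) <= 9 - k /\ outd (wr k) <= 3 + k.
  move=> h; have wA := wr_A h; have := outd_le wA; have := ind_le wA; have := degree wA.
  rewrite wr_ps ?(ltn_trans h) //.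
  by move: (outd _) (ind _) (bic _); clear; lia.
apply: (@leq_trans (\sum_(k < 10) minn (9 - k) (3 + k))).
  by apply: leq_sum => k _; rewrite leq_min; have [-> ->] := b k (ltn_ord k).
by rewrite !big_ord_recl big_ord0.
Qed.

Hypothesis full : \sum_(0 <= t < M) (ctr t && mono A t) = 33.

Lemma degree_eq k : k < 4 -> [/\ bic (wr k) = 0, ind (wr k) = k & outd (wr k) = 3 + k].
Proof.
move=> k4; apply: (@degree_arith (fun l => outd (wr l)) (fun l => ind (wr l)) (fun l => bic (wr l))).
- move=> l h; have wA := wr_A h; have := outd_le wA; have := ind_le wA; have := degree wA.
  by rewrite wr_ps ?(ltn_trans h).
- by move: full; rewrite mono_ctr -outd_sum sum_A.
- by [].
Qed.

Definition met i := [set j | has (fun t => ctr t && pswap q t i j) (index_iota c1 c3)].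

(** Since [bic (wr k) = 0], every central swap of [wr k] is counted by its out-degree [3 + k] or its
    in-degree [k]. *)
Lemma card_met k : k < 4 -> #|met (wr k)| <= 3 + 2 * k.
Proof.
move=> k4; have [b0 i0 o0] := degree_eq k4.
have -> : 3 + 2 * k = outd (wr k) + ind (wr k) by rewrite i0 o0; clear; lia.
apply: (@leq_trans (\sum_j \sum_(c1 <= t < c3) (ctr t && pswap q t (wr k) j))).
  rewrite -sum1_card big_mkcond /=; apply: leq_sum => j _; rewrite inE.
  case: ifP => // /hasP[t ht h]; rewrite lt0n sum_nat_seq_neq0.
  by apply/hasP; exists t; rewrite //= h.
rewrite exchange_big /outd /ind -big_split; apply: sum_nat_leq => t ht /=.
have wA : wr k \in A by apply: wr_A; apply: leq_trans k4 _.
have [c|] := boolP (ctr t) => /=; last by rewrite big1.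
have lr := lr_neq q t.
have [e|l] := eqVneq (lw t) (wr k).
  have rA : rw t \in A.
    apply: contraT => rA; move/eqP: b0; rewrite sum_nat_seq_eq0 => /allP /(_ t).
    by rewrite mem_index_iota ht /= c /mix e wA (negbTE rA) eqxx => /(_ isT).
  rewrite (bigD1 (rw t)) //= big1 ?addn0 => [|j /negbTE ne].
    by rewrite /mono e wA rA; case: (pswap _ _ _ _).
  have nr : (rw t == wr k) = false by rewrite -e eq_sym; exact: negbTE lr.
  by rewrite /pswap nr andbF orbF [rw t == j]eq_sym ne andbF.
have [e|r] := eqVneq (rw t) (wr k); last first.
  by rewrite big1 // => j _; rewrite /pswap (negbTE l) (negbTE r) andbF.
have lA : lw t \in A by apply: A_right; rewrite // e.
rewrite (bigD1 (lw t)) //= big1 ?addn0 => [|j /negbTE ne].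
  by rewrite /mono e wA lA; case: (pswap _ _ _ _).
by rewrite /pswap (negbTE l) [lw t == j]eq_sym ne.
Qed.

Lemma met_A k j : k < 4 -> j \in met (wr k) -> j \in A.
Proof.
move=> k4; rewrite inE => /hasP[t]; rewrite mem_index_iota => ht /andP[c].
have wA : wr k \in A by apply: wr_A; apply: leq_trans k4 _.
case/orP => [/andP[/eqP e1 /eqP e2]|/andP[/eqP e1 /eqP e2]]; last first.
  by rewrite -e1; apply: (A_right ht); rewrite e2.
have [b0 _ _] := degree_eq k4.
apply: contraT => rA; move/eqP: b0; rewrite sum_nat_seq_eq0 => /allP /(_ t).
by rewrite mem_index_iota ht /= c /mix e1 e2 wA (negbTE rA) eqxx => /(_ isT).
Qed.

Lemma met_sym i j : (i \in met j) = (j \in met i).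
Proof.
by rewrite !inE; apply: eq_has => t; rewrite /pswap orbC.
Qed.

Lemma ind_le_met i : i \in A -> ind i <= #|[set j in met i | bef c1 j i]|.
Proof.
move=> iA; apply: (@leq_trans (\sum_(j in [set j in met i | bef c1 j i])
    \sum_(c1 <= t < c3) pswap q t i j)); last first.
  rewrite -sum1_card; apply: leq_sum => j _; apply: pswap_once; exact: ltnW.
rewrite exchange_big /ind; apply: sum_nat_leq => t ht.
have [/andP[/andP[c /andP[lA rA]] /eqP ri]|//] := boolP (ctr t && mono A t && (rw t == i)).
rewrite (bigD1 (lw t)) /=; first by rewrite /pswap ri !eqxx orbT.
rewrite !inE (mono_once lA ht erefl ri) andbT; apply/hasP; exists t.
  by rewrite mem_index_iota.
by rewrite c /pswap ri !eqxx orbT.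
Qed.

(** For [0 < k < 4] the in-degree [k] of [wr k] means that it meets all [k] wires before it, [wr 0]
    included; three wires already exhaust [met (wr 0)]. *)
Lemma met_wr0 j : j \in met (wr 0) -> j \in [set wr 1; wr 2; wr 3].
Proof.
have sub k : 0 < k < 4 -> wr k \in met (wr 0).
  move=> /andP[k0 k4]; rewrite met_sym; apply: contraT => no.
  have k10 : k < 10 by apply: leq_trans k4 _.
  have [_ ik _] := degree_eq k4; have := ind_le_met (wr_A k10); rewrite ik leqNgt.
  suff h : #|[set j in met (wr k) | bef c1 j (wr k)]| < k by rewrite h.
  have e : pos q setT c1 (wr k) = k by apply: wr_ps; apply: ltn_trans k10 _.
  rewrite -[X in _ < X]e; apply: proper_card; apply/properP; split.
    by apply/subsetP => i; rewrite !inE => /andP[_ ->].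
  exists (wr 0); first by rewrite inE in_setT (ps_bef q c1) !wr_ps // (ltn_trans k10).
  by rewrite inE (negbTE no).
move=> jm; have : [set wr 1; wr 2; wr 3] == met (wr 0).
  rewrite eqEcard !subUset !sub1set !sub //=; apply: (leq_trans (card_met _)) => //.
  rewrite -setUA !cardsU1 cards1 !inE.
  have ne k l : k < 30 -> l < 30 -> k != l -> wr k == wr l = false.
    by move=> hk hl kl; apply/negP => /eqP /(wr_inj hk hl) e; rewrite e eqxx in kl.
  by rewrite !ne.
by move=> /eqP ->.
Qed.

End Counts.

Section Totals.
Variables (n M : nat) (q : aseq n M).
Hypothesis n30 : n = 30.
Variables (A B C : {set 'I_n}) (c1 c2 c3 : nat).
Hypothesis D : dec q A B C c1 c2 c3.
Hypothesis events : \sum_(0 <= t < M) ev q t = 48.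
Hypothesis centers : \sum_(0 <= t < M) ctr q t = 144.

(** A mixed swap is seen by both of its classes, a swap inside a class by one; hence the weights. *)
Lemma mono_mix t : 2 = 2 * (mono q A t + mono q B t + mono q C t) +
  (mix q A t + mix q B t + mix q C t).
Proof.
have one i : (i \in A) + (i \in B) + (i \in C) = 1.
  have [-> -> ->] := pos_c1 D i; have := ps_lt q n30 c1 i; move: (ps _ _ _); clear; lia.
rewrite /mono /mix; have := one (lw q t); have := one (rw q t).
by do 6!case: (_ \in _).
Qed.

Let D2 := dec_shift D.
Let D3 := dec_shift D2.

Lemma mix_total (f : nat -> bool) : 2 * \sum_(0 <= t < M) f t =
  2 * (\sum_(0 <= t < M) (f t && mono q A t) + \sum_(0 <= t < M) (f t && mono q B t) +
       \sum_(0 <= t < M) (f t && mono q C t)) +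
  (\sum_(0 <= t < M) (f t && mix q A t) + \sum_(0 <= t < M) (f t && mix q B t) +
       \sum_(0 <= t < M) (f t && mix q C t)).
Proof.
rewrite -!big_split !big_distrr -big_split; apply: eq_bigr => t _ /=.
by case: (f t); rewrite //= ?muln1; exact: mono_mix.
Qed.

(** [2 * 144 = 2 * 99 + 3 * 30]: the three counts add up to 99 and none exceeds 33. *)
Lemma mono_ctr33 : [/\ \sum_(0 <= t < M) (ctr q t && mono q A t) = 33,
  \sum_(0 <= t < M) (ctr q t && mono q B t) = 33 &
  \sum_(0 <= t < M) (ctr q t && mono q C t) = 33].
Proof.
have := mix_total (ctr q); rewrite centers (mix_ctr n30 D) (mix_ctr n30 D2) (mix_ctr n30 D3).
have := mono_le33 n30 D; have := mono_le33 n30 D2; have := mono_le33 n30 D3.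
by do 3!(move: (\sum_(_ <= t < _) _) => ?); clear; split; lia.
Qed.

Lemma mono_ev18 : \sum_(0 <= t < M) (ev q t && mono q A t) +
  \sum_(0 <= t < M) (ev q t && mono q B t) + \sum_(0 <= t < M) (ev q t && mono q C t) = 18.
Proof.
have := mix_total (ev q); rewrite events (mix_ev n30 D) (mix_ev n30 D2) (mix_ev n30 D3).
by do 3!(move: (\sum_(_ <= t < _) _) => ?); clear; lia.
Qed.

End Totals.

(** * Blocks of events *)

Section Events.
Variables (n M : nat) (q : aseq n M).
Implicit Types (t s r k : nat) (i j m w : 'I_n) (X : {set 'I_n}).
Hypothesis n30 : n = 30.
Notation lw := (lw q).
Notation rw := (rw q).
Notation ps := (ps q).
Notation gt := (gt q).
Notation ev := (ev q).
Notation K := (K q).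

(** Events serve as a clock: the set of central wires depends only on this count. *)
Definition evs t := \sum_(0 <= s < t) ev s.

Lemma evs_step t : evs t.+1 = evs t + ev t.
Proof. by rewrite /evs big_nat_recr. Qed.

Lemma evs_cat s t : s <= t -> evs t = evs s + \sum_(s <= r < t) ev r.
Proof. by move=> st; rewrite /evs (big_cat_nat (n := s)). Qed.

Lemma evs_mono s t : s <= t -> evs s <= evs t.
Proof. by move=> st; rewrite (evs_cat st) leq_addr. Qed.

Lemma evs_inj s t : ev s -> ev t -> evs s = evs t -> s = t.
Proof.
wlog st : s t / s <= t.
  by move=> W es et e; case: (leqP s t) => h; [exact: W|apply/esym; apply: W => //; exact: ltnW].
move=> es et e; apply/eqP; apply: contraT => ne.
have lt : s.+1 <= t by move: st ne; clear; lia.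
have := evs_mono lt; rewrite evs_step es e; clear; lia.
Qed.

Lemma evs_lt s t : ev s -> s < t -> evs s < evs t.
Proof. by move=> es st; have := evs_mono st; rewrite evs_step es addn1. Qed.

Lemma evs_le_lt s t : evs s < evs t -> s < t.
Proof. by move=> h; rewrite ltnNge; apply: contraTN h => /evs_mono; rewrite -leqNgt. Qed.

Lemma K_evs s t : s <= t -> evs s = evs t -> K s = K t.
Proof.
elim: t => [|t IH]; first by rewrite leqn0 => /eqP ->.
rewrite leq_eqVlt => /orP[/eqP -> //|]; rewrite ltnS => st; rewrite evs_step => e.
have h := evs_mono st; have e2 : ev t = false by move: h e; case: (ev t) => //; clear; lia.
by rewrite K_step ?e2 //; apply: IH => //; move: e; rewrite e2 addn0.
Qed.

Lemma ps_step_up t i g : ps t i <= g -> g < ps t.+1 i -> gt t = g /\ lw t = i.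
Proof.
have [->|l] := eqVneq i (lw t).
  by rewrite ps_l1 (ps_l q t); split => //; move: (gt t) H H0; clear; lia.
have [->|r] := eqVneq i (rw t); last by rewrite ps_o1 // => h1; rewrite ltnNge h1.
by rewrite ps_r1 (ps_r q t); move: (gt t); clear; lia.
Qed.

Lemma ps_step_down t i g : g < ps t i -> ps t.+1 i <= g -> gt t = g /\ rw t = i.
Proof.
have [->|r] := eqVneq i (rw t).
  by rewrite ps_r1 (ps_r q t); split => //; move: (gt t) H H0; clear; lia.
have [->|l] := eqVneq i (lw t); last by rewrite ps_o1 // ltnNge => /negbTE ->.
by rewrite ps_l1 (ps_l q t); move: (gt t); clear; lia.
Qed.

Lemma side_const g s t i : s <= t -> (forall r, s <= r < t -> gt r != g) ->
  (ps s i <= g) = (ps t i <= g).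
Proof.
elim: t => [|t IH]; first by rewrite leqn0 => /eqP ->.
rewrite leq_eqVlt => /orP[/eqP -> //|]; rewrite ltnS => st h.
rewrite IH //; last by move=> r /andP[h1 h2]; apply: h; rewrite h1 ltnW.
have nt := h t; rewrite st leqnn in nt; have {}nt := nt isT.
apply/idP/idP => a; rewrite leqNgt; apply/negP => b.
  by have [e _] := ps_step_up a b; rewrite e eqxx in nt.
by have [e _] := ps_step_down b a; rewrite e eqxx in nt.
Qed.

Lemma side_out s t i : s <= t -> (forall r, s <= r <= t -> i \notin K r) ->
  (ps s i <= 12) = (ps t i <= 12).
Proof.
elim: t => [|t IH]; first by rewrite leqn0 => /eqP ->.
rewrite leq_eqVlt => /orP[/eqP -> //|]; rewrite ltnS => st h.
rewrite IH //; last by move=> r /andP[h1 h2]; apply: h; rewrite h1 leqW.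
have n1 : i \notin K t by apply: h; rewrite st leqnSn.
have n2 : i \notin K t.+1 by apply: h; rewrite leqnn leqW.
rewrite !in_K in n1 n2; apply/idP/idP => a; rewrite leqNgt; apply/negP => b.
  by have [e e2] := ps_step_up a b; move: n2; rewrite -e2 ps_l1 e.
have [e e2] := ps_step_down b a; move: n1; rewrite -e2 (ps_r q t) e.
by [].
Qed.

Lemma in_K_out i t : (i \notin K t) = (ps t i <= 12) || (16 < ps t i).
Proof. by rewrite in_K; move: (ps t i); clear; lia. Qed.

End Events.

Section Block.
Variables (n M : nat) (q : aseq n M).
Implicit Types (t s r k : nat) (i j m w : 'I_n) (X : {set 'I_n}).
Hypothesis n30 : n = 30.
Notation lw := (lw q).
Notation rw := (rw q).
Notation ps := (ps q).
Notation gt := (gt q).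
Notation ev := (ev q).
Notation ctr := (ctr q).
Notation K := (K q).
Notation evs := (evs q).

Variables (A B C : {set 'I_n}) (c1 c2 c3 : nat).
Hypothesis D : dec q A B C c1 c2 c3.
Hypothesis events : \sum_(0 <= t < M) ev t = 48.
Hypothesis centers : \sum_(0 <= t < M) ctr t = 144.
Hypothesis c1M : M <= c1.

Let full : \sum_(0 <= t < M) (ctr t && mono q A t) = 33.
Proof. by case: (mono_ctr33 n30 D centers). Qed.

Let l1 : c1 < c2. Proof. by case: D => _ _ []. Qed.
Let l2 : c2 < c3. Proof. by case: D => _ _ []. Qed.
Let l3 : c3 < c1 + M. Proof. by case: D => _ _ []. Qed.

(** A maximal interval of central times. The wire enters at the event [p.-1] and leaves at the event
    [r], so [evs r - evs p] counts the events strictly between. *)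
Record stay i p r : Prop := Stay {
  stay_lt : [/\ c1 < p, p <= r & r < c3];
  stay_in : forall s, p <= s <= r -> i \in K s;
  stay_l : i \notin K p.-1;
  stay_r : i \notin K r.+1 }.

Lemma stay_exists i t : i \in A -> c1 <= t <= c3 -> i \in K t ->
  exists p r, stay i p r /\ p <= t <= r.
Proof.
move=> iA /andP[h1 h2] ki.
have ex1 : exists s, (s <= t) && (i \notin K s) by exists c1; rewrite h1 (A_c1 D iA).
have b1 s : (s <= t) && (i \notin K s) -> s <= t by case/andP.
have [p /andP[pt np] pmax] := ex_maxnP ex1 b1.
have ex2 : exists s, (t <= s) && (i \notin K s) by exists c3; rewrite h2 (A_c3 D iA).
have [r /andP[tr nr] rmin] := ex_minnP ex2.
have pc : c1 <= p by apply: pmax; rewrite h1 (A_c1 D iA).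
have rc : r <= c3 by apply: rmin; rewrite h2 (A_c3 D iA).
have pt' : p != t by apply: contraNneq np => ->.
have tr' : t != r by apply: contraNneq nr => <-.
exists p.+1, r.-1; split; last by move: pt pt' tr tr'; clear; lia.
split => //.
- by split; move: pc rc pt pt' tr tr'; clear; lia.
- move=> s hs; apply: contraT => ns; have [st|ts] := leqP s t.
    by have := pmax s; rewrite st ns => /(_ isT); move: hs; clear; lia.
  by have := rmin s; rewrite (ltnW ts) ns => /(_ isT); move: hs ts tr'; clear; lia.
- by rewrite prednK //; move: tr tr'; clear; lia.
Qed.

Definition company i p r := [set j | (j != i) && has (fun s => j \in K s) (index_iota p r.+1)].

Lemma in_company i p r j : (j \in company i p r) =
  (j != i) && has (fun s => j \in K s) (index_iota p r.+1).
Proof. by rewrite inE. Qed.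

Lemma in_met i j : (j \in met q c1 c3 i) =
  has (fun t => ctr t && pswap q t i j) (index_iota c1 c3).
Proof. by rewrite inE. Qed.

(** Three companions are there from the start, and each event during the stay brings a new one: by
    convexity, a wire seen earlier with [i] could not be absent just before it enters. *)
Lemma company_card i p r s : i \in A -> stay i p r -> p <= s <= r ->
  3 + (evs s - evs p) <= #|company i p s|.
Proof.
move=> iA [[h1 h2 h3] hin _ _]; elim: s => [|s IH] hs.
  by move: h1 hs; clear; lia.
have [e|ne] := eqVneq s.+1 p.
  rewrite e subnn addn0; have ki : i \in K p by apply: hin; rewrite leqnn.
  have := card_K q n30 p; rewrite (cardsD1 i) ki => -[<-].
  apply: subset_leq_card; apply/subsetP => j; rewrite in_setD1 in_company => /andP[-> kj] /=.
  by apply/hasP; exists p; rewrite // mem_index_iota leqnn ltnS leqnn.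
have hs' : p <= s <= r by move: hs ne; clear; lia.
have {}IH := IH hs'; rewrite evs_step.
have sub : company i p s \subset company i p s.+1.
  apply/subsetP => j; rewrite !in_company => /andP[-> /hasP[t ht kj]] /=; apply/hasP; exists t => //.
  by move: ht; rewrite !mem_index_iota; clear; lia.
have [evt|] := boolP (ev s); last first.
  by rewrite addn0 => _; exact: leq_trans IH (subset_leq_card sub).
have [k1 k2 k3 k4] := K_ev evt; set j := ent q s in k2 k3 k4.
have ji : j != i by apply: contraNneq k2 => ->; apply: hin.
have jn : j \notin company i p s.
  rewrite in_company ji /=; apply/hasPn => t; rewrite mem_index_iota => ht; apply/negP => kj.
  have kj' : j \in K s.+1 by rewrite k4 in_setU1 eqxx.
  suff : (i \in K s) && (j \in K s) by rewrite (negbTE k2) andbF.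
  apply: (@coexist_convex _ _ _ n30 _ _ _ _ _ _ D events centers c1M t s s.+1) => //.
  - by rewrite eq_sym.
  - by move: h1 ht; clear; lia.
  - by move: ht; clear; lia.
  - by move: hs h3; clear; lia.
  - by apply: hin; move: ht hs'; clear; lia.
  - exact: hin.
have sub2 : j |: company i p s \subset company i p s.+1.
  rewrite subUset sub andbT sub1set in_company ji /=; apply/hasP; exists s.+1.
    by rewrite mem_index_iota; move: hs; clear; lia.
  by rewrite k4 in_setU1 eqxx.
apply: leq_trans (subset_leq_card sub2); rewrite cardsU1 jn.
by move: IH; move: (evs s) (evs p) #|_|; clear; lia.
Qed.

Lemma company_met i p r : i \in A -> stay i p r -> company i p r \subset met q c1 c3 i.
Proof.
move=> iA [[h1 h2 h3] hin _ _]; apply/subsetP => j; rewrite in_company in_met => /andP[ji /hasP[s]].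
rewrite mem_index_iota => hs kj.
have [|||||t [ht sw ct]] := @A_meet _ _ _ n30 _ _ _ _ _ _ D events centers c1M s i j.
- by move: hs h1 h3; clear; lia.
- by [].
- by rewrite eq_sym.
- by apply: hin; move: hs; clear; lia.
- by [].
by apply/hasP; exists t; rewrite ?mem_index_iota // ct.
Qed.

Lemma stay_evs k p r : k < 4 -> stay (wr q c1 k) p r -> evs r - evs p <= 2 * k.
Proof.
move=> k4 st; have wA : wr q c1 k \in A by apply: (wr_A n30 D); apply: leq_trans k4 _.
have := subset_leq_card (company_met wA st); have [[h1 h2 h3] _ _ _] := st.
have hr : p <= r <= r by rewrite h2 leqnn.
have := company_card wA st hr; have := card_met n30 D full k4.
by move: #|_| #|_| (evs r) (evs p); clear; lia.
Qed.

(** A stay of maximal length has all of [met] as its company. A companion at a time outside it would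
    belong to both stays, against convexity. *)
Lemma stay_unique k p r s : k < 4 -> stay (wr q c1 k) p r -> 2 * k <= evs r - evs p ->
  c1 <= s <= c3 -> wr q c1 k \in K s -> p <= s <= r.
Proof.
move=> k4 st ek hs ks; have wA : wr q c1 k \in A by apply: (wr_A n30 D); apply: leq_trans k4 _.
have [[h1 h2 h3] hin nl nr] := st; set i := wr q c1 k in st ks wA hin nl nr *.
have hr : p <= r <= r by rewrite h2 leqnn.
have eqm : company i p r = met q c1 c3 i.
  apply/eqP; rewrite eqEcard company_met //=; apply: leq_trans (card_met n30 D full k4) _.
  apply: leq_trans (company_card wA st hr); rewrite leq_add2l //.
have : 0 < #|K s :\ i|.
  by have := card_K q n30 s; rewrite (cardsD1 i) ks; case: #|_|.
case/card_gt0P => j; rewrite in_setD1 => /andP[ji kj].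
have [|||||t [ht sw ct]] := @A_meet _ _ _ n30 _ _ _ _ _ _ D events centers c1M s i j => //.
  by rewrite eq_sym.
have : j \in met q c1 c3 i.
  by rewrite in_met; apply/hasP; exists t; rewrite ?mem_index_iota // ct.
rewrite -eqm in_company ji /= => /hasP[u]; rewrite mem_index_iota => hu ku.
have conv := @coexist_convex _ _ _ n30 _ _ _ _ _ _ D events centers c1M.
have ij : i != j by rewrite eq_sym.
apply/andP; split; rewrite leqNgt; apply/negP => lt.
  have := conv s p.-1 u i j wA ij; rewrite ks kj ku hin ?(negbTE nl) /=.
    by case/andP: hs => -> _; move=> /(_ isT) H; apply: notF; apply: H => //;
      move: lt hu h3 h1; clear; lia.
  by move: hu; clear; lia.
have := conv u r.+1 s i j wA ij; rewrite ks kj ku hin ?(negbTE nr) /=.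
  by case/andP: hs => _ hs2 H; apply: notF; apply: H => //; move: lt hu h3 h1; clear; lia.
by move: hu; clear; lia.
Qed.

Lemma stay_events i p r : stay i p r -> [/\ ev p.-1, ev r, p.-1.+1 = p, ent q p.-1 = i & ext q r = i].
Proof.
move=> [[h1 h2 h3] hin nl nr].
have e : p.-1.+1 = p by rewrite prednK //; move: h1; clear; lia.
have kp : i \in K p by apply: hin; rewrite leqnn.
have kr : i \in K r by apply: hin; rewrite leqnn h2.
have ev1 : ev p.-1 by apply: contraT => h; move: nl; rewrite -K_step // e kp.
have ev2 : ev r by apply: contraT => h; move: nr; rewrite K_step // kr.
split => //.
  have [_ _ _] := K_ev ev1; rewrite e => k; move: kp; rewrite k in_setU1 in_setD1 (negbTE nl) andbF orbF.
  by move/eqP.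
have [_ _ _ k] := K_ev ev2; move: nr; rewrite k in_setU1 in_setD1 kr andbT negb_or negbK.
by case/andP => _ /eqP.
Qed.

(** The event [p.-1] brings in [i] and the event [r] removes [i]; neither moves [j], so the stay of
    [j] extends beyond both ends. *)
Lemma nest i j p r : j \in A -> i != j -> stay i p r -> (forall s, p <= s <= r -> j \in K s) ->
  exists p' r', [/\ stay j p' r', p' < p, r < r' & 
    (j \in K p.-1) && (j \in K r.+1)].
Proof.
move=> jA ij st hj; have [[h1 h2 h3] hin nl nr] := st.
have [e1 e2 ep en ex] := stay_events st.
have jp : j \in K p.-1.
  have [_ _ _] := K_ev e1; rewrite ep => k; have := hj p; rewrite leqnn h2 k in_setU1 in_setD1 en.
  by rewrite eq_sym (negbTE ij) /= => /(_ isT) /andP[].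
have jr : j \in K r.+1.
  have [_ _ _ k] := K_ev e2; rewrite k in_setU1 in_setD1 ex [j == i]eq_sym ij hj ?orbT //.
  by rewrite leqnn h2.
have hp : c1 <= p <= c3 by move: h1 h2 h3; clear; lia.
have kp : j \in K p by apply: hj; rewrite leqnn.
have [p' [r' [st' hpr]]] := stay_exists jA hp kp.
have [[g1 g2 g3] hin' nl' nr'] := st'.
exists p', r'; split=> //; last by rewrite jp.
  rewrite ltnNge; apply/negP => le; have e : p' = p by move: hpr le; clear; lia.
  by rewrite e jp in nl'.
rewrite ltnNge; apply/negP => le.
have [e|ne] := eqVneq r' r; first by rewrite e jr in nr'.
by move: nr'; rewrite hj //; move: ne le hpr; clear; lia.
Qed.

(** The larger stay contains the two end events of the smaller one. With at most two events more it
    contains no others, so the central set is constant on both added pieces. *)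
Lemma widen i p r p' r' : stay i p r -> p' < p -> r < r' ->
  evs r' - evs p' <= evs r - evs p + 2 ->
  [/\ evs p = evs p' + 1, evs r' = evs r + 1 & forall l,
    (forall s, p <= s <= r -> l \in K s) -> (l \in K p.-1) && (l \in K r.+1) ->
    forall s, p' <= s <= r' -> l \in K s].
Proof.
move=> st pp rr le; have [e1 e2 ep _ _] := stay_events st; have [[h1 h2 h3] _ _ _] := st.
have a1 : evs p = evs p.-1 + 1 by rewrite -{1}ep evs_step e1.
have a2 : evs r.+1 = evs r + 1 by rewrite evs_step e2.
have pp' : p' <= p.-1 by move: pp; clear; lia.
have b1 := evs_mono q pp'; have b2 := evs_mono q rr; have b3 := evs_mono q h2.
have c1' : evs p = evs p' + 1 by move: a1 a2 b1 b2 b3 le; do 6!(move: (evs _)); clear; lia.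
have c2' : evs r' = evs r + 1.
  by move: c1' a1 a2 b1 b2 b3 le; do 6!(move: (evs _)); clear; lia.
split=> // l hl /andP[lp lr] s /andP[s1 s2].
have [s3|s3] := leqP s p.-1.
  rewrite (@K_evs _ _ q s p.-1) //.
  by have := evs_mono q s1; have := evs_mono q s3; move: c1' a1; do 4!(move: (evs _)); clear; lia.
have [s4|s4] := leqP s r; first by apply: hl; move: s3 s4; clear; lia.
rewrite -(@K_evs _ _ q r.+1 s) //.
by have := evs_mono q s4; have := evs_mono q s2; move: c2' a2; do 4!(move: (evs _)); clear; lia.
Qed.

Lemma wrA4 k : k < 4 -> wr q c1 k \in A.
Proof. by move=> h; apply: (wr_A n30 D); apply: leq_trans h _. Qed.

Lemma wr_neq k l : k < 4 -> l < 4 -> k != l -> wr q c1 k != wr q c1 l.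
Proof.
move=> hk hl; apply: contra => /eqP /(wr_inj n30) -> //; [exact: leq_trans hk _|exact: leq_trans hl _].
Qed.

(** [wr 0] must pass through the centre; it sees no event there, and its companions can only be the
    three wires of [met (wr 0)]. *)
Lemma first_stay : exists p r, [/\ stay (wr q c1 0) p r, evs r = evs p,
  forall k s, k < 4 -> p <= s <= r -> wr q c1 k \in K s &
  forall j, j \in K p -> exists2 k, k < 4 & j = wr q c1 k].
Proof.
set a := wr q c1 0; have aA : a \in A by exact: wrA4.
have [/hasP[t]|/hasPn no] := boolP (has (fun t => a \in K t) (index_iota c1 c3.+1)); last first.
  have l13 : c1 <= c3 by move: l1 l2; clear; lia.
  have := @side_out _ _ q c1 c3 a l13.
  have -> : ps c1 a <= 12 by move: aA; case: (pos_c1 D a) => -> _ _; move: (ps c1 a); clear; lia.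
  have -> : (ps c3 a <= 12) = false.
    by move: aA; case: (pos_c3 D a) => _ _ ->; move: (ps c3 a); clear; lia.
  by move=> H; suff : true = false by []; apply: H => r hr; apply: no; rewrite mem_index_iota ltnS.
rewrite mem_index_iota ltnS => ht kt.
have [p [r [st hpr]]] := stay_exists aA ht kt.
have [[h1 h2 h3] hin _ _] := st.
have e0 : evs r = evs p.
  have := @stay_evs 0 p r isT st; have := evs_mono q h2; move: (evs r) (evs p); clear; lia.
have kp : a \in K p by apply: hin; rewrite leqnn.
have sub : K p \subset a |: [set wr q c1 1; wr q c1 2; wr q c1 3].
  apply/subsetP => j kj; rewrite in_setU1; have [//|ja] := eqVneq j a.
  have [|||||u [hu sw cu]] := @A_meet _ _ _ n30 _ _ _ _ _ _ D events centers c1M p a j => //.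
  - by move: h1 h2 h3; clear; lia.
  - by rewrite eq_sym.
  apply: (met_wr0 n30 D full); rewrite in_met; apply/hasP; exists u.
    by rewrite mem_index_iota.
  by rewrite cu.
have eqK : K p = a |: [set wr q c1 1; wr q c1 2; wr q c1 3].
  apply/eqP; rewrite eqEcard sub card_K // -!setUA !cardsU1 cards1.
  by do 3!case: (_ \notin _).
exists p, r; split=> // [k s k4 hs|j].
  have -> : K s = K p.
    apply/esym/K_evs; first by case/andP: hs.
    case/andP: hs => s1 s2; have := evs_mono q s1; have := evs_mono q s2.
    by rewrite e0; move: (evs s) (evs p); clear; lia.
  by rewrite eqK; case: k k4 => [|[|[|[|//]]]] _; rewrite !inE eqxx ?orbT.
rewrite eqK !inE => /orP[/eqP ->|/orP[/orP[]|] /eqP ->];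
  [by exists 0|by exists 1|by exists 2|by exists 3].
Qed.

(** The stay being the only one, the wire remains on the left from [c1] until it enters and on the
    right from its exit until [c3]. *)
Lemma stay_side k p r : k < 4 -> stay (wr q c1 k) p r -> 2 * k <= evs r - evs p ->
  [/\ gt p.-1 = 12, lw p.-1 = wr q c1 k, gt r = 16 & lw r = wr q c1 k] /\
  (forall s, c1 <= s < p -> ps s (wr q c1 k) <= 12) /\
  (forall s, r < s <= c3 -> 16 < ps s (wr q c1 k)).
Proof.
move=> k4 st ek; have [[h1 h2 h3] hin nl nr] := st; set a := wr q c1 k in st hin nl nr *.
have aA : a \in A by exact: wrA4.
have [_ _ ep _ _] := stay_events st.
have uni s := @stay_unique k p r s k4 st ek.
have low s : c1 <= s < p -> ps s a <= 12.
  move=> /andP[s1 s2]; rewrite -(@side_out _ _ q c1 s a s1).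
    by move: aA; case: (pos_c1 D a) => -> _ _; move: (ps c1 a); clear; lia.
  move=> u /andP[u1 u2]; apply/negP => /uni; rewrite u1 => H.
  have := H ltac:(move: u2 s2 h2 h3; clear; lia); move: u2 s2; clear; lia.
have high s : r < s <= c3 -> 16 < ps s a.
  move=> /andP[s1 s2]; have out u : r < u <= c3 -> a \notin K u.
    move=> /andP[u1 u2]; apply/negP => /uni; rewrite u2 andbT => H.
    by have := H ltac:(move: u1 h1 h2; clear; lia); move: u1; clear; lia.
  have : a \notin K s by apply: out; rewrite s1.
  rewrite in_K_out; have -> // : (ps s a <= 12) = false.
  rewrite (@side_out _ _ q s c3 a s2); last first.
    by move=> u /andP[u1 u2]; apply: out; rewrite u2 (leq_trans s1).
  by move: aA; case: (pos_c3 D a) => _ _ ->; move: (ps c3 a); clear; lia.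
split; last by [].
have kp : 12 < ps p a by have := hin p; rewrite leqnn h2 in_K => /(_ isT) /andP[].
have kr : ps r a <= 16 by have := hin r; rewrite leqnn h2 in_K => /(_ isT) /andP[].
have lp : ps p.-1 a <= 12 by apply: low; move: h1; clear; lia.
have hr : 16 < ps r.+1 a by apply: high; rewrite leqnn.
rewrite -ep in kp; have [g1 w1] := ps_step_up lp kp; have [g2 w2] := ps_step_up kr hr.
by split.
Qed.

Lemma phase1 t : c1 <= t < c2 -> lw t \in A -> rw t \notin A -> rw t \in B.
Proof.
move=> /andP[h1 h2] lA rA; apply: contraT => rB.
have rC : rw t \in C.
  have : rw t \in A :|: B :|: C by case: D => _ -> _ _ _ _; rewrite in_setT.
  by rewrite !in_setU (negbTE rA) (negbTE rB).
case: D => _ _ _ _ [_ AC] _; have b2 := AC _ _ lA rC.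
have b1 := A_first D lA rA; have h3 : c2 <= c1 + M by move: l2 l3; clear; lia.
have := bef_between (leqW h1) h2 h3 b1 b2.
by have := bef_asym (bef_step_swap q t) => /negbTE ->.
Qed.

Lemma phase2 t : c2 <= t < c3 -> lw t \in A -> rw t \notin A -> rw t \in C.
Proof.
move=> /andP[h1 h2] lA rA; apply: contraT => rC.
have rB : rw t \in B.
  have : rw t \in A :|: B :|: C by case: D => _ -> _ _ _ _; rewrite in_setT.
  by rewrite !in_setU (negbTE rA) (negbTE rC) orbF.
case: D => _ _ _ _ [BA _] _; have b2 := BA _ _ rB lA.
have b1 := A_first D lA rA; have h3 : t <= c1 + M by move: h2 l3; clear; lia.
have := bef_mono (ltnW l1) h1 h3 b1 b2.
by have := bef_asym (bef_lr q t) => /negbTE ->.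
Qed.

Lemma beyond_K t : beyond q A 12 t = beyond q A 16 t + #|A :&: K t|.
Proof.
have -> : #|A :&: K t| = \sum_(i in A) (i \in K t).
  rewrite -sum1_card big_mkcond [RHS]big_mkcond /=; apply: eq_bigr => i _.
  by rewrite in_setI; case: (i \in A) => //=; case: (i \in K t).
rewrite /beyond -big_split; apply: eq_bigr => i _ /=; rewrite in_K.
by move: (ps t i); clear; lia.
Qed.

Lemma beyond_wr g t : beyond q A g t = \sum_(0 <= k < 10) (g < ps t (wr q c1 k)).
Proof. by rewrite /beyond (sum_A n30 D) big_mkord. Qed.

Lemma A_index i : i \in A -> exists2 k, k < 10 & i = wr q c1 k.
Proof. by move=> iA; exists (ps c1 i); [move: iA; case: (pos_c1 D i) => -> | rewrite wr_of_ps]. Qed.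

(* The wires of A that only meet A in the centre enter and leave it in a row. *)
Record block tL tR : Prop := Block {
  bl_range : [/\ c1 <= tL, tL < c2, c2 <= tR & tR < c3];
  bl_ev : [/\ ev tL, ev tR & evs tR = evs tL + 7];
  bl_side : forall t, tL <= t <= tR -> ev t -> gt t = if evs t < evs tL + 4 then 12 else 16;
  bl_ends : [/\ lw tL \in A, rw tL \in B, lw tR \in A & rw tR \in C];
  bl_before : beyond q A 12 tL = 6 /\ beyond q A 16 tL = 3;
  bl_after : beyond q A 12 tR.+1 = 7 /\ beyond q A 16 tR.+1 = 4;
  bl_Z : forall i, i \in A -> ps tR.+1 i <= 12 -> i \in K tL;
  bl_W : forall i, i \in A -> 16 < ps tL i -> i \in K tR.+1;
  bl_mid : exists2 m, tL < m <= tR & forall i, i \in K m -> ps tL i <= 12 /\ 16 < ps tR.+1 i;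
  bl_mono : \sum_(tL.+1 <= t < tR) (ev t && mono q A t) = 6 }.

(** The stays of [wr 0], ..., [wr 3] are nested and contain 0, 2, 4 and 6 events, each adding one at
    either end. Their entries, all on the left, and exits, all on the right, form the eight
    events. *)
Lemma block_exists : exists tL tR, block tL tR.
Proof.
have [p0 [r0 [st0 e0 in0 only0]]] := first_stay.
have ne k l : k < 4 -> l < 4 -> k != l -> wr q c1 k != wr q c1 l by exact: wr_neq.
have [p1 [r1 [st1 pp1 rr1 k1]]] := nest (wrA4 (isT : 1 < 4)) (ne 0 1 isT isT isT) st0 (fun s => in0 1 s isT).
have [_ [_ [_ _ _ k02]]] := nest (wrA4 (isT : 2 < 4)) (ne 0 2 isT isT isT) st0 (fun s => in0 2 s isT).
have [_ [_ [_ _ _ k03]]] := nest (wrA4 (isT : 3 < 4)) (ne 0 3 isT isT isT) st0 (fun s => in0 3 s isT).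
have b1 := @stay_evs 1 _ _ isT st1.
have [|ep1 er1 wid1] := widen st0 pp1 rr1; first by rewrite e0 subnn.
have in12 := wid1 _ (fun s => in0 2 s isT) k02; have in13 := wid1 _ (fun s => in0 3 s isT) k03.
have [p2 [r2 [st2 pp2 rr2 k2]]] := nest (wrA4 (isT : 2 < 4)) (ne 1 2 isT isT isT) st1 in12.
have [_ [_ [_ _ _ k13]]] := nest (wrA4 (isT : 3 < 4)) (ne 1 3 isT isT isT) st1 in13.
have b2 := @stay_evs 2 _ _ isT st2.
have d1 : evs r1 - evs p1 = 2 by move: ep1 er1 e0; do 4!(move: (evs _)); clear; lia.
have [|ep2 er2 wid2] := widen st1 pp2 rr2; first by rewrite d1.
have in23 := wid2 _ in13 k13.
have [p3 [r3 [st3 pp3 rr3 k3]]] := nest (wrA4 (isT : 3 < 4)) (ne 2 3 isT isT isT) st2 in23.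
have b3 := @stay_evs 3 _ _ isT st3.
have d2 : evs r2 - evs p2 = 4 by move: ep2 er2 ep1 er1 e0; do 6!(move: (evs _)); clear; lia.
have [|ep3 er3 _] := widen st2 pp3 rr3; first by rewrite d2.
have d3 : evs r3 - evs p3 = 6 by move: ep3 er3 ep2 er2 ep1 er1 e0; do 8!(move: (evs _)); clear; lia.
have d0 : evs r0 - evs p0 = 0 by rewrite e0 subnn.
have [[g0 w0 g0' w0'] [low0 high0]] := @stay_side 0 _ _ isT st0 ltac:(by rewrite d0).
have [[g1 w1 g1' w1'] [low1 high1]] := @stay_side 1 _ _ isT st1 ltac:(by rewrite d1).
have [[g2 w2 g2' w2'] [low2 high2]] := @stay_side 2 _ _ isT st2 ltac:(by rewrite d2).
have [[g3 w3 g3' w3'] [low3 high3]] := @stay_side 3 _ _ isT st3 ltac:(by rewrite d3).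
have [v0 v0' q0 _ _] := stay_events st0; have [v1 v1' q1 _ _] := stay_events st1.
have [v2 v2' q2 _ _] := stay_events st2; have [v3 v3' q3 _ _] := stay_events st3.
have [[x0 y0 z0] hin0 _ _] := st0; have [[x1 y1 z1] _ _ _] := st1.
have [[x2 y2 z2] _ _ _] := st2; have [[x3 y3 z3] hin3 _ _] := st3.
set tL := p3.-1; set tR := r3.
have f0 : evs p0 = evs p0.-1 + 1 by rewrite -{1}q0 evs_step v0.
have f1 : evs p1 = evs p1.-1 + 1 by rewrite -{1}q1 evs_step v1.
have f2 : evs p2 = evs p2.-1 + 1 by rewrite -{1}q2 evs_step v2.
have f3 : evs p3 = evs tL + 1 by rewrite -{1}q3 evs_step v3.
have eL : evs p0 = evs tL + 4.
  by move: f3 ep3 ep2 ep1; do 5!(move: (evs _)); clear; lia.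
have eR : evs tR = evs tL + 7.
  by rewrite /tR; move: f3 ep3 ep2 ep1 er1 er2 er3 e0; do 9!(move: (evs _)); clear; lia.
have tLR : tL <= tR by rewrite /tL /tR; move: y3; clear; lia.
have side t : tL <= t <= tR -> ev t -> gt t = if evs t < evs tL + 4 then 12 else 16.
  move=> /andP[t1 t2] evt; have m1 := evs_mono q t1; have m2 := evs_mono q t2.
  have same s : ev s -> evs t = evs s -> gt t = gt s by move=> es e; rewrite (evs_inj evt es e).
  have : exists d : nat, evs t = evs tL + d /\ d < 8.
    by exists (evs t - evs tL); move: m1 m2 eR; do 3!(move: (evs _)); clear; lia.
  case=> d [ej]; rewrite ej ltn_add2l.
  case: d ej => [|[|[|[|[|[|[|[|//]]]]]]]] ej _ /=.
  - by rewrite (same tL) ?addn0 // ej addn0.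
  - by rewrite (same p2.-1) //; move: ej f2 f3 ep3; do 5!(move: (evs _)); clear; lia.
  - by rewrite (same p1.-1) //; move: ej f1 f3 ep3 ep2; do 6!(move: (evs _)); clear; lia.
  - by rewrite (same p0.-1) //; move: ej f0 eL; do 4!(move: (evs _)); clear; lia.
  - by rewrite (same r0) //; move: ej e0 eL; do 4!(move: (evs _)); clear; lia.
  - by rewrite (same r1) //; move: ej e0 er1 eL; do 5!(move: (evs _)); clear; lia.
  - by rewrite (same r2) //; move: ej e0 er1 er2 eL; do 6!(move: (evs _)); clear; lia.
  - by rewrite (same r3) //; move: ej eR; rewrite /tR; do 3!(move: (evs _)); clear; lia.
have lowL k : k < 4 -> ps tL (wr q c1 k) <= 12.
  case: k => [|[|[|[|//]]]] _.
  - by apply: low0; rewrite /tL; move: x3 pp1 pp2 pp3; clear; lia.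
  - by apply: low1; rewrite /tL; move: x3 pp1 pp2 pp3; clear; lia.
  - by apply: low2; rewrite /tL; move: x3 pp1 pp2 pp3; clear; lia.
  - by apply: low3; rewrite /tL; move: x3 pp1 pp2 pp3; clear; lia.
have highR k : k < 4 -> 16 < ps tR.+1 (wr q c1 k).
  case: k => [|[|[|[|//]]]] _.
  - by apply: high0; rewrite /tR; move: z3 rr1 rr2 rr3; clear; lia.
  - by apply: high1; rewrite /tR; move: z3 rr1 rr2 rr3; clear; lia.
  - by apply: high2; rewrite /tR; move: z3 rr1 rr2 rr3; clear; lia.
  - by apply: high3; rewrite /tR; move: z3 rr1 rr2 rr3; clear; lia.
have KA r : p3 <= r <= r3 -> K r \subset A.
  move=> hr; apply/subsetP => j kj; have [->|ja] := eqVneq j (wr q c1 3); first exact: wrA4.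
  have [|||||u [hu sw cu]] := @A_meet _ _ _ n30 _ _ _ _ _ _ D events centers c1M r (wr q c1 3) j => //.
  - by move: hr x3 z3; clear; lia.
  - exact: wrA4.
  - by rewrite eq_sym.
  - exact: hin3.
  apply: (met_A n30 D full (isT : 3 < 4)); rewrite in_met; apply/hasP; exists u.
    by rewrite mem_index_iota.
  by rewrite cu.
have monoK r : p3 <= r < r3 -> ev r -> mono q A r.
  move=> hr evr; have [k4 _ _ k5] := K_ev evr.
  have a1 : ext q r \in A by apply: (subsetP (KA r _)) k4; move: hr; clear; lia.
  have a2 : ent q r \in A.
    apply: (subsetP (KA r.+1 _)); first by move: hr; clear; lia.
    by rewrite k5 in_setU1 eqxx.
  by move: a1 a2; rewrite /ext /ent /mono; case: ifP => _ -> ->.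
have constb g : (g == 12) || (g == 16) -> forall r, p3 <= r <= r3 -> beyond q A g r = beyond q A g p3.
  move=> hg; elim=> [|r IH] hr; first by move: hr x3; clear; lia.
  have [->//|nr] := eqVneq r.+1 p3.
  have hr' : p3 <= r <= r3 by move: hr nr; clear; lia.
  rewrite -IH //; have := beyond_step q A g r; have [e|] := eqVneq (gt r) g => /=; last by rewrite !addn0.
  have /andP[-> ->] : mono q A r.
    apply: monoK; first by move: hr nr; clear; lia.
    by rewrite /ev e.
  by rewrite !addn1 => -[].
have fL (k : nat) : (12 < ps tL (wr q c1 k)) <= (3 < k).
  have [h|] := ltnP 3 k; first by case: (_ < _).
  by rewrite -ltnS => /lowL; rewrite leqNgt => /negbTE ->.
have fR (k : nat) : (k < 4) <= (16 < ps tR.+1 (wr q c1 k)).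
  by have [/highR ->|] := ltnP k 4.
(* Before the block [wr 0], ..., [wr 3] are on the left, after it on the right; this bounds one
   count from above and another from below. *)
have b12L : beyond q A 12 tL <= 6.
  rewrite beyond_wr; apply: (@leq_trans (\sum_(0 <= k < 10) (3 < k))); last by rewrite unlock.
  by apply: sum_nat_leq => k _.
have b16R : 4 <= beyond q A 16 tR.+1.
  rewrite beyond_wr; apply: (@leq_trans (\sum_(0 <= k < 10) (k < 4))); first by rewrite unlock.
  by apply: sum_nat_leq => k _.
have sL12 := beyond_step q A 12 tL; have sL16 := beyond_step q A 16 tL.
have sR12 := beyond_step q A 12 tR; have sR16 := beyond_step q A 16 tR.
have wL : lw tL \in A by rewrite /tL w3; exact: wrA4.
have wR : lw tR \in A by rewrite /tR w3'; exact: wrA4.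
rewrite /tL q3 -/tL g3 wL /= in sL12 sL16; rewrite /tR g3' -/tR wR /= in sR12 sR16.
have cc12 : beyond q A 12 tR = beyond q A 12 p3 by apply: constb; rewrite // y3 leqnn.
have cc16 : beyond q A 16 tR = beyond q A 16 p3 by apply: constb; rewrite // y3 leqnn.
have b4 : beyond q A 12 p3 = beyond q A 16 p3 + 4.
  by rewrite beyond_K (setIidPr _) ?card_K //; apply: KA; rewrite leqnn.
rewrite addn0 in sL16; rewrite !addn0 in sL16 sR12.
(* At [tL] only the count beyond 12 can change, at [tR] only that beyond 16. In between both are
   constant and differ by four, since the centre lies in [A]. This leaves no slack in [b12L] and
   [b16R] and makes both end swaps mixed. *)
have [[n1 n2 n3 n4] [n5 n6]] : [/\ beyond q A 12 tL = 6, beyond q A 16 tL = 3,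
    beyond q A 12 tR.+1 = 7 & beyond q A 16 tR.+1 = 4] /\ (rw tL \in A = false) /\ (rw tR \in A = false).
  move: sL12 sL16 sR12 sR16 cc12 cc16 b4 b12L b16R.
  case: (rw tL \in A); case: (rw tR \in A); do 8!(move: (beyond _ _ _ _)); clear => *; repeat split => //; (lia || (exfalso; lia)).
have idL k : k < 10 -> (12 < ps tL (wr q c1 k)) = (3 < k).
  move=> hk; have := @sum_nat_eq_pointwise _ _ 0 10 fL.
  rewrite -beyond_wr n1 unlock => /(_ isT k); rewrite hk => /(_ isT).
  by case: (_ < ps _ _); case: (3 < k).
have idR k : k < 10 -> (16 < ps tR.+1 (wr q c1 k)) = (k < 4).
  move=> hk; have := @sum_nat_eq_pointwise _ _ 0 10 fR.
  rewrite -beyond_wr n4 unlock => /(_ isT k); rewrite hk => /(_ isT).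
  by case: (_ < ps _ _); case: (k < 4).
have mid1 i : (ps tL i <= 16) = (ps p0 i <= 16).
  apply: side_const; first by rewrite /tL; move: pp1 pp2 pp3; clear; lia.
  move=> r /andP[r1' r2']; apply/negP => /eqP g; have evr : ev r by rewrite /ev g orbT.
  have := side r; rewrite r1' g /=.
  have -> : r <= tR by rewrite /tR; move: r2' y0 rr1 rr2 rr3; clear; lia.
  have lt := evs_lt evr r2'; rewrite eL in lt; rewrite lt.
  by move=> /(_ isT evr).
have mid2 i : (ps p0 i <= 12) = (ps tR.+1 i <= 12).
  apply: side_const; first by rewrite /tR; move: y0 rr1 rr2 rr3; clear; lia.
  move=> r /andP[r1' r2']; apply/negP => /eqP g; have evr : ev r by rewrite /ev g.
  have := side r; rewrite g -(ltnS r) r2' andbT.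
  have -> : tL <= r by rewrite /tL; move: r1' pp1 pp2 pp3; clear; lia.
  have le := evs_mono q r1'; rewrite eL in le; rewrite ltnNge le.
  by move=> /(_ isT evr).
(* At [c2] the class [A] fills positions 10 to 19. The resulting counts 7 beyond 12 and 3 beyond 16,
   against 6 at [tL] and 4 after [tR], place [c2] inside the block. *)
have bc2 g : 10 <= g < 20 -> beyond q A g c2 = 19 - g.
  move=> hg; have -> : beyond q A g c2 = #|front q setT 20 c2 :\: front q setT g.+1 c2|.
    rewrite /beyond -sum1_card big_mkcond [RHS]big_mkcond /=; apply: eq_bigr => i _.
    rewrite in_setD !in_front !in_setT /= -/(ps c2 i); case: (pos_c2 D i) => _ -> _.
    by move: (ps c2 i) hg => p; clear; case: ifP; case: ifP; case: ltnP => //=; lia.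
  have cT : #|[set: 'I_n]| = 30 by rewrite cardsT card_ord.
  rewrite cardsD (setIidPr _) ?card_front ?cT //; try (by move: hg; clear; lia).
  by apply/subsetP => i; rewrite !in_front !in_setT /=; move: (pos _ _ _ _) hg; clear; lia.
have tLc3 : tR < c3 by [].
have c1tL : c1 <= tL by rewrite /tL; move: x3; clear; lia.
have mono_b g s t : c1 <= s -> s <= t -> t <= c3 -> beyond q A g s <= beyond q A g t.
  move=> s1; elim: t => [|t IH]; first by rewrite leqn0 => /eqP ->.
  rewrite leq_eqVlt => /orP[/eqP ->//|]; rewrite ltnS => st tc.
  apply: leq_trans (IH st (ltnW tc)) _; have := beyond_step q A g t.
  have := @A_right _ _ _ _ _ _ _ _ _ D t; rewrite tc (leq_trans s1 st) => /(_ isT).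
  case: (rw t \in A) => [/(_ isT) ->|_]; rewrite ?andbT ?andbF.
    by move=> /addIn ->.
  by rewrite addn0 => ->; exact: leq_addr.
have tLc2 : tL < c2.
  rewrite ltnNge; apply/negP => h; have lt : tL <= c3 by move: tLR tLc3; clear; lia.
  by have := mono_b 12 c2 tL (ltnW l1) h lt; rewrite n1 bc2.
have c2tR : c2 <= tR.
  rewrite leqNgt; apply/negP => h; have lt : c1 <= tR.+1 by move: tLR c1tL; clear; lia.
  by have := mono_b 16 tR.+1 c2 lt h (ltnW l2); rewrite n4 bc2.
exists tL, tR; split => //.
- split => //; [apply: phase1|apply: phase2]; rewrite ?n5 ?n6 //.
  + by rewrite c1tL tLc2.
  + by rewrite c2tR tLc3.
- move=> i iA lo; have [k hk e] := A_index iA.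
  have k4 : 3 < k.
    rewrite ltnNge; apply/negP => h; have := idR k hk; rewrite -e ltnS h.
    by move: lo; move: (ps _ _); clear; lia.
  have := idL k hk; rewrite -e k4; have := mid2 i; rewrite lo => h; have := mid1 i.
  by rewrite in_K; move: h; move: (ps _ _) (ps _ _); clear; lia.
- move=> i iA hi; have [k hk e] := A_index iA.
  have k4 : k < 4 = false.
    have := idL k hk; rewrite -e; move: hi; move: (ps _ _); clear; lia.
  have := idR k hk; rewrite -e k4; have := mid1 i; have := mid2 i.
  by rewrite in_K; move: hi; move: (ps tL i) (ps p0 i) (ps tR.+1 i); clear; lia.
- exists p0; first by rewrite /tL /tR; move: x3 pp1 pp2 pp3 y0 rr1 rr2 rr3; clear; lia.
  move=> i ki; by have [k k4 ->] := only0 i ki; rewrite lowL ?highR.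
- rewrite /tL q3 /tR; have := evs_cat q y3.
  have -> : \sum_(p3 <= t < r3) (ev t && mono q A t) = \sum_(p3 <= t < r3) ev t.
    rewrite big_nat [RHS]big_nat; apply: eq_bigr => t ht.
    by have [evt|//] := boolP (ev t); rewrite (monoK t ht evt).
  by move: d3; move: (evs _) (evs _) (\sum_(_ <= t < _) _); clear; lia.
Qed.

End Block.

(** * An automaton for the central wires *)

(* Which pairs among the four central positions 0, 1, 2, 3 have crossed:
   (01, 02, 03, (12, 13, 23)). *)
Definition cstate := (bool * bool * bool * (bool * bool * bool))%type.

(* Letters: 12 and 16 replace the wire in position 0 (resp. 3), which must have
   crossed the three others; 13, 14 and 15 swap adjacent positions. *)
Definition cstep (g : nat) (s : cstate) : option cstate :=
  let: (c01, c02, c03, (c12, c13, c23)) := s in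
  match g with
  | 12 => if [&& c01, c02 & c03] then Some (false, false, false, (c12, c13, c23)) else None
  | 13 => if c01 then None else Some (true, c12, c13, (c02, c03, c23))
  | 14 => if c12 then None else Some (c02, c01, c03, (true, c23, c13))
  | 15 => if c23 then None else Some (c01, c03, c02, (c13, c12, true))
  | 16 => if [&& c03, c13 & c23] then Some (c01, c02, false, (c12, false, false)) else None
  | _ => Some s
  end.

(** The partial inverse of [cstep]: a table entry is computed from the predecessors of its state. *)
Definition cback (g : nat) (s : cstate) : option cstate :=
  let: (c01, c02, c03, (c12, c13, c23)) := s in
  match g with
  | 12 => if c01 || c02 || c03 then None else Some (true, true, true, (c12, c13, c23))
  | 13 => if c01 then Some (false, c12, c13, (c02, c03, c23)) else None
  | 14 => if c12 then Some (c02, c01, c03, (false, c23, c13)) else None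
  | 15 => if c23 then Some (c01, c03, c02, (c13, c12, false)) else None
  | 16 => if c03 || c13 || c23 then None else Some (c01, c02, true, (c12, true, true))
  | _ => Some s
  end.

Lemma cstepK g s s' : cstep g s = Some s' -> cback g s' = Some s.
Proof.
case: s => [[[[] []] []] [[[] []] []]];
  by case: g => [|[|[|[|[|[|[|[|[|[|[|[|[|[|[|[|[|g]]]]]]]]]]]]]]]]] //= [<-].
Qed.

Definition bools := [:: false; true].
Definition triples := [seq (x, c) | x <- [seq (a, b) | a <- bools, b <- bools], c <- bools].
Definition cstates : seq cstate := [seq (t, u) | t <- triples, u <- triples].

(* A table gives for every state and every value of the flag "the last central
   swap was not the middle one" a lower bound, capped at 2, for the number of
   repetitions of that flag so far.  It is stored as a binary tree. *)
Fixpoint tree k : Type := if k is k'.+1 then (tree k' * tree k')%type else nat.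

Fixpoint tabulate k : (seq bool -> nat) -> tree k :=
  if k is k'.+1 then fun f => (tabulate k' (fun w => f (false :: w)), tabulate k' (fun w => f (true :: w)))
  else fun f => f [::].

Definition sel k (b : bool) (t : tree k.+1) : tree k := if b then t.2 else t.1.

Definition table (f : cstate -> bool -> nat) : tree 7 :=
  tabulate 7 (fun w => if w is [:: a; b; c; d; e; g; l] then f (a, b, c, (d, e, g)) l else 0).

Definition look (T : tree 7) (s : cstate) (l : bool) : nat :=
  let: (a, b, c, (d, e, g)) := s in
  sel l (sel g (sel e (sel d (sel c (sel b (sel a T)))))).

Lemma look_table f s l : look (table f) s l = f s l.
Proof. by case: s => [[[[] []] []] [[[] []] []]]; case: l. Qed.

Definition below (T U : tree 7) : bool :=
  all (fun s => (look T s false <= look U s false) && (look T s true <= look U s true)) cstates.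

(** The cap 2 stands for an impossible predecessor. *)
Definition olook T (o : option cstate) l := if o is Some s then look T s l else 2.

(** One backward step along a central swap. The flag becomes true after 13 or 15, at cost one if it
    was true already, and false after 14 at no cost. *)
Definition relax (T : tree 7) : tree 7 := table (fun s l =>
  minn (look T s l)
    (if l then
       minn (minn (olook T (cback 13 s) false) (olook T (cback 15 s) false))
         (minn 2 (minn (olook T (cback 13 s) true) (olook T (cback 15 s) true)).+1)
     else minn (olook T (cback 14 s) false) (olook T (cback 14 s) true))).

Definition event_table (left : bool) (T : tree 7) : tree 7 :=
  table (fun s l => olook T (cback (if left then 12 else 16) s) l).

(** A central swap crosses a new pair among six, so at most six of them fit between two events. *)
Definition saturate T := iter 6 relax T.
Definition start := saturate (table (fun _ _ => 0)).
Definition advance (x : bool) T := saturate (event_table x T).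

Definition tables (w : seq bool) : seq (tree 7) := scanl (fun T x => advance x T) start w.

(** Besides the final bound this checks that each table is closed under [relax], so that soundness
    does not rest on the number of rounds in [saturate]. *)
Definition forces (d : nat) (w : seq bool) : bool :=
  let Ts := start :: tables w in
  all (fun T => below T (relax T)) Ts &&
  (let T := last start Ts in all (fun s => (d <= look T s false) && (d <= look T s true)) cstates).

(** [true] is L (gate 12) and [false] is R (gate 16). *)
Definition phase_word (p : seq bool) := nseq 4 false ++ p ++ nseq 4 false.

Fixpoint words k : seq (seq bool) :=
  if k is k'.+1 then [seq b :: w | b <- bools, w <- words k'] else [:: [::]].

Fixpoint no_repeat (w : seq bool) : bool :=
  if w is a :: w' then ~~ (a && head false w') && no_repeat w' else true.

Definition word_ok p := (count id p == 3) && no_repeat p.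

(** There are 20 such words: three letters L among eight, no two of them adjacent. *)
Lemma words_forced : all (fun p =>
  forces (if head false p && last false p then 1 else 2) (phase_word p))
  [seq p <- words 8 | word_ok p].
Proof. by vm_compute. Qed.

Definition tab w k := foldl (fun T x => advance x T) start (take k w).

Lemma look_relax T s l : look (relax T) s l <= look T s l.
Proof. by rewrite look_table geq_minl. Qed.

Lemma look_saturate T s l : look (saturate T) s l <= look T s l.
Proof.
have h k : look (iter k relax T) s l <= look T s l.
  by elim: k => [|k IH] //=; exact: leq_trans (look_relax _ _ _) IH.
exact: h.
Qed.

Lemma mem_cstates s : s \in cstates.
Proof. by case: s => [[[[] []] []] [[[] []] []]]. Qed.

Lemma tab_nth w k : k <= size w -> tab w k = nth start (start :: tables w) k.
Proof.
case: k => [|k] kw; first by rewrite /tab take0.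
by rewrite /= /tables nth_scanl.
Qed.

Lemma forces_closed d w k s l : forces d w -> k <= size w ->
  look (tab w k) s l <= look (relax (tab w k)) s l.
Proof.
case/andP => /all_nthP h _ kw; have := h start k; rewrite tab_nth //.
rewrite /= size_scanl ltnS => /(_ kw) /allP /(_ s (mem_cstates s)) /andP[].
by case: l.
Qed.

Lemma forces_end d w s l : forces d w -> d <= look (tab w (size w)) s l.
Proof.
case/andP => _ /allP /(_ s (mem_cstates s)); rewrite -nth_last /= size_scanl -tab_nth //.
by case/andP; case: l.
Qed.

Section Run.
Variables (n M : nat) (q : aseq n M).
Implicit Types (t s r k : nat) (i j m : 'I_n).
Hypothesis n30 : n = 30.
Notation lw := (lw q).
Notation rw := (rw q).
Notation ps := (ps q).
Notation gt := (gt q).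
Notation ev := (ev q).
Notation ctr := (ctr q).
Notation K := (K q).
Notation evs := (evs q).
Notation wr := (wr q).

Variables (A B C : {set 'I_n}) (c1 c2 c3 : nat).
Hypothesis D : dec q A B C c1 c2 c3.
Hypothesis events : \sum_(0 <= t < M) ev t = 48.
Hypothesis centers : \sum_(0 <= t < M) ctr t = 144.

Lemma wr_l t : wr t (gt t) = lw t. Proof. by rewrite -(ps_l q t) (wr_of_ps q n30). Qed.
Lemma wr_r t : wr t (gt t).+1 = rw t. Proof. by rewrite -(ps_r q t) (wr_of_ps q n30). Qed.
Lemma wr_l1 t : wr t.+1 (gt t) = rw t. Proof. by rewrite -(ps_r1 q t) (wr_of_ps q n30). Qed.
Lemma wr_r1 t : wr t.+1 (gt t).+1 = lw t. Proof. by rewrite -(ps_l1 q t) (wr_of_ps q n30). Qed.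
Lemma wr_o t p : p < 30 -> p != gt t -> p != (gt t).+1 ->
  [/\ wr t.+1 p = wr t p, wr t p != lw t & wr t p != rw t].
Proof.
move=> hp n1 n2; have e := wr_ps q n30 t hp.
have nl : wr t p != lw t by apply: contra n1 => /eqP h; rewrite -e h (ps_l q t).
have nr : wr t p != rw t by apply: contra n2 => /eqP h; rewrite -e h (ps_r q t).
split=> //; apply: (@ps_inj _ _ q t.+1); rewrite (wr_ps q n30 t.+1 hp) ps_o1 //.
Qed.

Definition cst t : cstate :=
  let x a b := crossed q t (wr t a) (wr t b) in
  (x 13 14, x 13 15, x 13 16, (x 14 15, x 14 16, x 15 16)).

Lemma crossed_o t i j : ~~ ev t -> i != lw t -> i != rw t ->
  crossed q t.+1 i j = crossed q t i j.
Proof.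
move=> h nl nr; rewrite crossed_step // /pswap [lw t == i]eq_sym [rw t == i]eq_sym.
by rewrite (negbTE nl) (negbTE nr) !andbF orbF.
Qed.

Lemma crossed_o2 t i j : ~~ ev t -> i != lw t -> i != rw t ->
  crossed q t.+1 j i = crossed q t j i.
Proof. by move=> h nl nr; rewrite crossed_sym crossed_o // crossed_sym. Qed.

Lemma crossed_new t : ctr t -> crossed q t.+1 (rw t) (lw t).
Proof.
move=> c; rewrite crossed_step; last by move: c; rewrite /ev /ctr; move: (gt t); clear; lia.
by rewrite c /pswap !eqxx orbT orbT.
Qed.

Lemma crossed_lr t : crossed q t (lw t) (rw t) = false.
Proof. by apply: (crossed_once n30 D); rewrite /pswap !eqxx. Qed.

Lemma crossed_out t i j : i \notin K t -> crossed q t i j = false.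
Proof. by apply: contraNF => /crossed_in /andP[]. Qed.

(** For the letters 12 and 16 the test of [cstep] is [exit_crossed]; for 13, 14, 15 it is
    [crossed_once]. *)
Lemma cst_step t : M <= t -> cstep (gt t) (cst t) = Some (cst t.+1).
Proof.
move=> Mt; rewrite /cst.
have wl := wr_l t; have wr' := wr_r t; have wl1 := wr_l1 t; have wr1 := wr_r1 t.
have wo := @wr_o t.
have exit j : ev t -> j \in K t -> j != ext q t -> crossed q t (ext q t) j.
  by move=> evt; apply: (exit_crossed n30 D events centers Mt evt).
have inK p : 13 <= p <= 16 -> wr t p \in K t.
  by move=> hp; rewrite in_K wr_ps //; move: hp; clear; lia.
have [g12|n12] := eqVneq (gt t) 12.
  have evt : ev t by rewrite /ev g12.
  have ee : ext q t = rw t by rewrite /ext g12.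
  have [k1 k2 k3 _] := K_ev evt; rewrite /ent g12 eqxx in k2.
  rewrite g12 in wl wr' wl1 wr1 wo *.
  have [e14 l14 r14] := wo 14 isT isT isT; have [e15 l15 r15] := wo 15 isT isT isT.
  have [e16 l16 r16] := wo 16 isT isT isT.
  rewrite wr1 wr' e14 e15 e16 !crossed_ev //= !ee r14 r15 r16 !andbT.
  by rewrite !(crossed_out _ k2) -ee !exit ?inK // ee.
have [g16|n16] := eqVneq (gt t) 16.
  have evt : ev t by rewrite /ev g16.
  have ee : ext q t = lw t by rewrite /ext g16.
  have [k1 k2 k3 _] := K_ev evt; rewrite /ent g16 in k2.
  rewrite g16 in wl wr' wl1 wr1 wo *.
  have [e14 l14 r14] := wo 14 isT isT isT; have [e15 l15 r15] := wo 15 isT isT isT.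
  have [e13 l13 r13] := wo 13 isT isT isT.
  have cs i : crossed q t i (lw t) = crossed q t (ext q t) i by rewrite ee crossed_sym.
  rewrite wl1 wl e13 e14 e15.
  have no i : crossed q t i (rw t) = false by rewrite crossed_sym crossed_out.
  by rewrite !crossed_ev //= !ee l14 l15 l13 !andbT !no !cs !exit // ?ee // inK.
have nev : ~~ ev t by rewrite /ev negb_or n12.
have [g13|n13] := eqVneq (gt t) 13.
  have c : ctr t by rewrite /ctr g13.
  rewrite g13 in wl wr' wl1 wr1 wo *.
  have [e15 l15 r15] := wo 15 isT isT isT; have [e16 l16 r16] := wo 16 isT isT isT.
  rewrite wl wr' wl1 wr1 e15 e16 crossed_lr crossed_new //.
  by rewrite !(crossed_o2 _ nev l15 r15) !(crossed_o2 _ nev l16 r16).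
have [g14|n14] := eqVneq (gt t) 14.
  have c : ctr t by rewrite /ctr g14.
  rewrite g14 in wl wr' wl1 wr1 wo *.
  have [e13 l13 r13] := wo 13 isT isT isT; have [e16 l16 r16] := wo 16 isT isT isT.
  rewrite wl wr' wl1 wr1 e13 e16 crossed_lr crossed_new //.
  by rewrite !(crossed_o _ nev l13 r13) !(crossed_o2 _ nev l16 r16).
have [g15|n15] := eqVneq (gt t) 15.
  have c : ctr t by rewrite /ctr g15.
  rewrite g15 in wl wr' wl1 wr1 wo *.
  have [e13 l13 r13] := wo 13 isT isT isT; have [e14 l14 r14] := wo 14 isT isT isT.
  rewrite wl wr' wl1 wr1 e13 e14 crossed_lr crossed_new //.
  by rewrite !(crossed_o _ nev l13 r13) !(crossed_o _ nev l14 r14).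
have nc : ctr t = false.
  by move: n13 n14 n15; rewrite /ctr; move: (gt t); clear; lia.
have same p : 13 <= p <= 16 -> wr t.+1 p = wr t p.
  by move=> hp; have [] // := wo p; move: hp n12 n13 n14 n15 n16; move: (gt t); clear; lia.
rewrite !same // !crossed_step // nc /= !orbF.
move: n12 n13 n14 n15 n16; move: (gt t) => g.
by case: g => [|[|[|[|[|[|[|[|[|[|[|[|[|[|[|[|[|g]]]]]]]]]]]]]]]]].
Qed.

End Run.

Lemma tabS w k : k < size w -> tab w k.+1 = advance (nth false w k) (tab w k).
Proof. by move=> kw; rewrite /tab (take_nth false) // foldl_rcons. Qed.

Lemma look_start s l : look start s l = 0.
Proof.
have := look_saturate (table (fun _ _ => 0)) s l.
by rewrite (look_table (fun _ _ => 0)) leqn0 => /eqP.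
Qed.

Lemma look_event x T g s s' l : g = (if x then 12 else 16) -> cstep g s = Some s' ->
  look (advance x T) s' l <= look T s l.
Proof.
move=> eg /cstepK; rewrite eg => e; apply: leq_trans (look_saturate _ _ _) _.
by rewrite look_table e.
Qed.

Lemma cstep_other g s s' : ~~ (12 <= g <= 16) -> cstep g s = Some s' -> s = s'.
Proof.
case: s => [[[x1 x2] x3] [[x4 x5] x6]].
by case: g => [|[|[|[|[|[|[|[|[|[|[|[|[|[|[|[|[|g]]]]]]]]]]]]]]]]] //= _ [].
Qed.

Lemma look_mid T s s' l : cstep 14 s = Some s' -> look (relax T) s' false <= look T s l.
Proof.
move/cstepK => e; rewrite look_table e /=; apply: leq_trans (geq_minr _ _) _.
by case: l; [exact: geq_minr|exact: geq_minl].
Qed.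

Lemma look_side T g s s' l : (g == 13) || (g == 15) -> cstep g s = Some s' ->
  look (relax T) s' true <= look T s l + l.
Proof.
move=> hg /cstepK; rewrite look_table => e; apply: leq_trans (geq_minr _ _) _.
by move: e; case/orP: hg => /eqP -> ->; case: l; rewrite /= ?addn1 ?addn0; lia.
Qed.

(* Otherwise simplification starts to compute the tables. *)
Opaque look relax start advance table saturate forces.

Section Defects.
Variables (n M : nat) (q : aseq n M).
Implicit Types (t s r k : nat) (i j m : 'I_n).
Hypothesis n30 : n = 30.
Notation lw := (lw q).
Notation rw := (rw q).
Notation gt := (gt q).
Notation ev := (ev q).
Notation ctr := (ctr q).
Notation evs := (evs q).
Notation cst := (cst q).

Variables (A B C : {set 'I_n}) (c1 c2 c3 : nat).
Hypothesis D : dec q A B C c1 c2 c3.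
Hypothesis events : \sum_(0 <= t < M) ev t = 48.
Hypothesis centers : \sum_(0 <= t < M) ctr t = 144.

(** True if the last central swap before [t] was a side swap; the value at time 0 is arbitrary. *)
Fixpoint lst t := if t is r.+1 then
  if gt r == 14 then false else if ctr r then true else lst r else false.

Definition dft t : bool := [&& ctr t, gt t != 14 & lst t].

(** Invariant: the table after the events seen since [a], looked up at the actual state and flag,
    does not exceed the number of repetitions since [a]. *)
Lemma forces_sound a b d w : M <= a -> a <= b -> forces d w -> evs b = evs a + size w ->
  (forall t, a <= t < b -> ev t -> gt t = if nth false w (evs t - evs a) then 12 else 16) ->
  d <= \sum_(a <= t < b) dft t.
Proof.
move=> Ma ab fw eb word.
have base : look (tab w (evs a - evs a)) (cst a) (lst a) <= \sum_(a <= r < a) dft r.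
  by rewrite subnn /tab take0 look_start.
have inv t : a <= t -> t <= b ->
    look (tab w (evs t - evs a)) (cst t) (lst t) <= \sum_(a <= r < t) dft r.
  move=> /subnKC <-; elim: (t - a) => [|k]; first by rewrite addn0.
  rewrite addnS; have a_t := leq_addr k a; move: (a + k) a_t => {}t a_t IH tb.
  have {IH} IH := IH (ltnW tb).
  have Mt := leq_trans Ma a_t; have st := cst_step n30 D events centers Mt.
  have eat := evs_mono q a_t; have eb' := evs_mono q tb.
  rewrite big_nat_recr; last exact: a_t.
  rewrite evs_step.
  have -> : lst t.+1 = if gt t == 14 then false else if ctr t then true else lst t by [].
  cbv beta.
  have [evt|nev] := boolP (ev t).
    have kw : evs t - evs a < size w.
      by move: eb'; rewrite evs_step evt eb; move: eat; clear; lia.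
    have wt := word t; rewrite a_t tb evt in wt; have {wt} wt := wt isT isT.
    rewrite addn1 (subSn eat) (tabS kw).
    have nc : ctr t = false.
      by move: evt; rewrite /ev /ctr; move: (gt t); clear; lia.
    have n14 : (gt t == 14) = false.
      by move: evt; rewrite /ev; move: (gt t); clear; lia.
    rewrite n14 nc; apply: leq_trans (leq_trans IH (leq_addr _ _)); exact: look_event wt st.
  have -> : evs t + false = evs t by exact: addn0.
  set T := tab w _ in IH *.
  (* Closedness of the table absorbs any number of central swaps between two events. *)
  have Tc (s : cstate) l : look T s l <= look (relax T) s l.
    apply: (forces_closed _ _ fw); move: eb' eb; rewrite evs_step; move: (ev t) => e.
    by move: eat; clear; lia.
  clearbody T; have [g14|n14] := eqVneq (gt t) 14.
    rewrite g14 in st; apply: leq_trans (Tc _ _) _.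
    exact: leq_trans (look_mid T (lst t) st) (leq_trans IH (leq_addr _ _)).
  have [c|nc] := boolP (ctr t).
    apply: leq_trans (Tc _ _) _; rewrite /dft c n14 /=.
    have hg : (gt t == 13) || (gt t == 15).
      by move: c n14; rewrite /ctr; move: (gt t); clear; lia.
    apply: leq_trans (look_side T (lst t) hg st) _; rewrite leq_add2r; exact: IH.
  suff <- : cst t = cst t.+1 by exact: leq_trans IH (leq_addr _ _).
  have : ~~ (12 <= gt t <= 16).
    by move: nev nc n14; rewrite /ev /ctr; move: (gt t); clear; lia.
  move=> h; exact: cstep_other h st.
apply: leq_trans (inv b ab (leqnn b)).
have -> : evs b - evs a = size w by rewrite eb addKn.
exact: forces_end.
Qed.

End Defects.

(** * The events between two blocks *)

Lemma mem_words w : w \in words (size w).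
Proof.
elim: w => [|b w IH]; first by rewrite inE.
by apply/allpairsP; exists (b, w); split=> //; case: b.
Qed.

Lemma no_repeatP w : (forall k, k.+1 < size w -> ~~ (nth false w k && nth false w k.+1)) ->
  no_repeat w.
Proof.
elim: w => [|b w IH] //= h; apply/andP; split; last by apply: IH => k; apply: (h k.+1).
by case: w {IH} h => [|c w] h; [case: b h|apply: (h 0)].
Qed.

Section Words.
Variables (n M : nat) (q : aseq n M).
Implicit Types (t s r k : nat).
Notation gt := (gt q).
Notation ev := (ev q).
Notation evs := (evs q).

Definition word a b := [seq gt t == 12 | t <- index_iota a b & ev t].

Lemma word_cat a b c : a <= b -> b <= c -> word a c = word a b ++ word b c.
Proof.
move=> ab bc; rewrite /word -map_cat -filter_cat; congr (map _ (filter _ _)).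
rewrite /index_iota -(subnKC bc) -addnBAC // [X in _ ++ iota X _]/= addKn.
by rewrite iotaD subnKC.
Qed.

Lemma size_word a b : a <= b -> evs b = evs a + size (word a b).
Proof.
move=> ab; rewrite (evs_cat q ab) /word size_map size_filter -sum1_count [in RHS]big_mkcond.
by congr (_ + _); apply: eq_bigr => t _; case: (ev t).
Qed.

Lemma nth_word a b t : a <= t < b -> ev t -> nth false (word a b) (evs t - evs a) = (gt t == 12).
Proof.
case/andP => h1 h2 evt; have -> : evs t - evs a = size (word a t) by rewrite (size_word h1) addKn.
rewrite (word_cat h1 (ltnW h2)) nth_cat ltnn subnn (word_cat (leqnSn t) h2).
by rewrite {1}/word /index_iota subSnn /= evt.
Qed.

Lemma evs_reach a b k : a <= b -> evs a <= k <= evs b -> exists2 t, a <= t <= b & evs t = k.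
Proof.
move=> /subnKC <-; elim: (b - a) => [|d IH].
  rewrite addn0 -eqn_leq => /eqP <-; exists a => //; by rewrite leqnn.
rewrite addnS evs_step => /andP[h1 h2]; have [h3|h3] := leqP k (evs (a + d)).
  by have [|t /andP[t1 t2] e] := IH; [rewrite h1|exists t; rewrite ?t1 ?leqW].
exists (a + d).+1; first by rewrite leqnn andbT leqW ?leq_addr.
by rewrite evs_step; move: h2 h3; case: (ev _); clear; lia.
Qed.

Lemma evs_time a b k : a <= b -> evs a <= k < evs b -> exists t, [/\ a <= t < b, ev t & evs t = k].
Proof.
move=> /subnKC <-; elim: (b - a) => [|d IH]; first by rewrite addn0; case: ltngtP.
rewrite addnS evs_step => /andP[h1 h2]; have [h3|h3] := ltnP k (evs (a + d)).
  have [|t [/andP[t1 t2] e1 e2]] := IH; first by rewrite h1.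
  by exists t; rewrite t1 ltnS ltnW.
exists (a + d); rewrite leq_addr leqnn; move: h2 h3; case: (ev _); clear; [|lia].
by split=> //; lia.
Qed.

Lemma word_const a b : a <= b -> (forall t, a <= t < b -> ev t -> gt t = 16) ->
  word a b = nseq (evs b - evs a) false.
Proof.
move=> ab h; rewrite (size_word ab) addKn; apply/all_pred1P/allP => x /mapP[t].
by rewrite mem_filter mem_index_iota => /andP[evt ht] ->; rewrite h.
Qed.

Lemma count_word a b : count id (word a b) = \sum_(a <= t < b) (ev t && (gt t == 12)).
Proof.
rewrite /word count_map count_filter -sum1_count big_mkcond /=.
by apply: eq_bigr => t _; rewrite /= andbC; case: (_ && _).
Qed.
End Words.

Section Phase.
Variables (n M : nat) (q : aseq n M).
Implicit Types (t s r k : nat) (i j m w : 'I_n) (X : {set 'I_n}).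
Hypothesis n30 : n = 30.
Notation lw := (lw q).
Notation rw := (rw q).
Notation ps := (ps q).
Notation gt := (gt q).
Notation ev := (ev q).
Notation ctr := (ctr q).
Notation K := (K q).
Notation evs := (evs q).
Notation word := (word q).
Variables (A B C : {set 'I_n}) (c1 c2 c3 : nat).
Hypothesis D : dec q A B C c1 c2 c3.
Hypothesis events : \sum_(0 <= t < M) ev t = 48.
Hypothesis centers : \sum_(0 <= t < M) ctr t = 144.
Hypothesis c1M : M <= c1.

Let l1 : c1 < c2. Proof. by case: D => _ _ []. Qed.
Let l2 : c2 < c3. Proof. by case: D => _ _ []. Qed.
Let l3 : c3 < c1 + M. Proof. by case: D => _ _ []. Qed.

Variables (tL tR : nat).
Hypothesis bl : block q A B C c1 c2 c3 tL tR.

Let r1 : c1 <= tL. Proof. by case: bl => -[]. Qed.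
Let r2 : tL < c2. Proof. by case: bl => -[]. Qed.
Let r3 : c2 <= tR. Proof. by case: bl => -[]. Qed.
Let r4 : tR < c3. Proof. by case: bl => -[]. Qed.

Lemma mono_ev_ge : 6 <= \sum_(0 <= t < M) (ev t && mono q A t).
Proof.
rewrite (mono_ev n30 D) -(bl_mono bl) (@big_cat_nat _ _ _ tL.+1 c1 c3) /=; first last.
- by move: r2 l2; clear; lia.
- by move: r1; clear; lia.
rewrite [X in _ <= _ + X](@big_cat_nat _ _ _ tR) /=; first last.
- exact: ltnW.
- by move: r2 r3; clear; lia.
by rewrite addnCA leq_addr.
Qed.

(* Both wires would be together in the centre before and after bl_mid. *)
Lemma no_both s t x y : x \in A -> x != y -> c1 <= s <= tL -> tR < t <= c3 ->
  x \in K s -> y \in K s -> x \in K t -> y \in K t -> y \notin K tL.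
Proof.
move=> xA xy /andP[s1 s2] /andP[t1 t2] xs ys xt yt; apply/negP => yL.
have [m /andP[m1 m2] h] := bl_mid bl.
have sm : s <= m by apply: leq_trans s2 _; exact: ltnW.
have mt : m <= t by apply: leq_trans m2 _; exact: ltnW.
have /andP[_ /h[h1 _]] := coexist_convex n30 D events centers c1M xA xy s1 sm mt t2 xs ys xt yt.
by move: yL; rewrite in_K; move: (ps tL y) h1; clear; lia.
Qed.

Lemma K_stay t x : ev t -> x \in K t -> x != ext q t -> x \in K t.+1.
Proof. by move=> /K_ev[_ _ _ ->] xt xe; rewrite in_setU1 in_setD1 xt xe orbT. Qed.

Lemma K_enter t : ev t -> ent q t \in K t.+1.
Proof. by move=> /K_ev[_ _ _ ->]; rewrite setU11. Qed.

Lemma low_const s t i : s <= t -> evs s = evs t -> (ps s i <= 12) = (ps t i <= 12).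
Proof.
move=> st e; apply: side_const st _ => r /andP[h1 h2]; apply/negP => g.
have er : ev r by rewrite /ev g.
by have := evs_lt er h2; rewrite -e; have := evs_mono q h1; case: ltngtP.
Qed.

Lemma high_const s t i : s <= t -> evs s = evs t -> (ps s i <= 16) = (ps t i <= 16).
Proof.
move=> st e; apply: side_const st _ => r /andP[h1 h2]; apply/negP => g.
have er : ev r by rewrite /ev g orbT.
by have := evs_lt er h2; rewrite -e; have := evs_mono q h1; case: ltngtP.
Qed.

(** The wire [x] going out on the right just before the block is central again after it ([bl_W]),
    and the wire [y] coming in on the left just after it was central before it ([bl_Z]). So [x] and
    [y] share the centre on both sides of the block, against [no_both]. *)
Lemma ends_disjoint s t : c1 <= s < tL -> ev s -> evs tL = (evs s).+1 ->
  gt s = 16 -> lw s \in A -> rw s \notin A ->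
  tR < t < c3 -> ev t -> evs t = (evs tR).+1 -> gt t = 12 -> lw t \in A -> rw t \notin A -> False.
Proof.
move=> /andP[s1 s2] es eL gs xA xrA /andP[t1 t2] et eR ggt yA yrA.
set x := lw s in xA; set y := lw t in yA.
have evR : ev tR by case: (bl_ev bl).
have exs : ext q s = x by rewrite /ext gs.
have ens : ent q s = rw s by rewrite /ent gs.
have ext' : ext q t = rw t by rewrite /ext ggt.
have ent' : ent q t = y by rewrite /ent ggt.
have eL1 : evs s.+1 = evs tL by rewrite evs_step es addn1.
have eR1 : evs tR.+1 = evs t by rewrite evs_step evR addn1.
have xL : 16 < ps tL x by rewrite ltnNge -(high_const x s2 eL1) ps_l1 gs.
have xR := bl_W bl xA xL.
have yR : ps tR.+1 y <= 12 by rewrite (low_const y t1 eR1) ps_l ggt.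
have yL := bl_Z bl yA yR.
have xy : x != y.
  by apply: contraTneq xL => ->; move: yL; rewrite in_K; move: (ps _ _); clear; lia.
have ys1 : y \in K s.+1 by rewrite (K_evs s2 eL1).
have ys : y \in K s.
  move: ys1; have [_ _ _ ->] := K_ev es; rewrite in_setU1 in_setD1 ens => /orP[/eqP yr|/andP[]//].
  by rewrite -yr yA in xrA.
have xs : x \in K s by have [] := K_ev es; rewrite exs.
have xt : x \in K t.+1.
  apply: K_stay et _ _; first by rewrite -(K_evs t1 eR1).
  by rewrite ext'; apply: contraNneq yrA => <-.
have yt : y \in K t.+1 by rewrite -ent'; exact: K_enter.
have := @no_both s t.+1 x y xA xy _ _ xs ys xt yt.
by rewrite s1 (ltnW s2) ltnS (ltnW t1) t2 yL => /(_ isT isT).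
Qed.

Hypothesis monoA : \sum_(0 <= t < M) (ev t && mono q A t) = 6.

(** The six events inside [A] already lie in its block. *)
Lemma no_mono t : tR < t < c3 -> ev t -> mono q A t = false.
Proof.
move=> /andP[h1 h2] et; apply/negP => mt; move: monoA.
rewrite (mono_ev n30 D) (@big_cat_nat _ _ _ tR c1 c3) /=; first last.
- exact: ltnW.
- by move: l1 r3; clear; lia.
rewrite (@big_cat_nat _ _ _ tL.+1 c1 tR) /=; first last.
- by move: r2 r3; clear; lia.
- by move: r1; clear; lia.
rewrite (bl_mono bl) (@big_cat_nat _ _ _ t tR c3) /=; first last.
- exact: ltnW.
- exact: ltnW.
by rewrite [X in _ + (_ + X)]big_ltn // et mt; clear; lia.
Qed.

Lemma no_mono_before t : c1 <= t < tL -> ev t -> mono q A t = false.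
Proof.
move=> /andP[h1 h2] et; apply/negP => mt; move: monoA.
rewrite (mono_ev n30 D) (@big_cat_nat _ _ _ tL.+1 c1 c3) /=; first last.
- by move: r2 l2; clear; lia.
- by move: r1; clear; lia.
rewrite (@big_cat_nat _ _ _ tR tL.+1 c3) /=; first last.
- exact: ltnW.
- by move: r2 r3; clear; lia.
rewrite (bl_mono bl) (@big_cat_nat _ _ _ t c1 tL.+1) /=; first last.
- by apply: leqW; exact: ltnW.
- by [].
by rewrite [X in (_ + X) + _]big_ltn ?leqW // et mt; clear; lia.
Qed.

Lemma beyond_total g t : g < 30 -> beyond q [set: 'I_n] g t = 29 - g.
Proof.
move=> hg; have cf : #|front q [set: 'I_n] g.+1 t| = g.+1 by rewrite card_front // cardsT card_ord n30.
have cc := cardsC (front q [set: 'I_n] g.+1 t).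
have cI : #|'I_n| = 30 by rewrite card_ord.
have -> : beyond q [set: 'I_n] g t = #|~: front q [set: 'I_n] g.+1 t|.
  rewrite /beyond -sum1_card big_mkcond [RHS]big_mkcond; apply: eq_bigr => i _ /=.
  by rewrite in_setC in_front in_setT /= -/(ps t i) -leqNgt.
by move: cc; rewrite cf cI; move: #|_| hg; clear; lia.
Qed.

Lemma beyond_cover g t : g < 30 -> beyond q A g t + beyond q B g t + beyond q C g t = 29 - g.
Proof.
move=> hg; rewrite -(beyond_total t hg) /beyond.
rewrite big_mkcond [X in _ + X + _]big_mkcond [X in _ + X]big_mkcond -!big_split [RHS]big_mkcond.
apply: eq_bigr => i _ /=; rewrite in_setT; case: (pos_c1 D i) => -> -> ->.
rewrite (leqNgt 10) (leqNgt 20); move: (ps c1 i) (nat_of_bool _) => x b.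
by case: (ltnP x 10) => h1; case: (ltnP x 20) => h2 /=; rewrite ?addn0 //; move: h1 h2; clear; lia.
Qed.

Lemma beyond_flip X g t : g < 29 -> beyond q X g (t + M) + beyond q X (28 - g) t = #|X|.
Proof.
move=> hg; rewrite /beyond -big_split -sum1_card; apply: eq_bigr => i _ /=.
have := ps_period q n30 t i; move: (ps _ _) (ps _ _) hg; clear; lia.
Qed.

Let D' := dec_shift D.
Let D'' := dec_shift D'.

(** Obtained from [A_late_pos] for the decomposition shifted twice, in which [B] is the first class;
    the odd multiple of [M] reverses positions. *)
Lemma B_low t i : c2 <= t <= c3 -> i \in B -> ps t i <= 9.
Proof.
move=> ht iB; have h' : c2 + M + M.*2 <= t + M + M + M <= c3 + M + M + M.
  by move: ht; clear; lia.
have := A_late_pos n30 D'' h' iB.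
have := ps_period q n30 t i; have := ps_period q n30 (t + M) i.
by have := ps_period q n30 (t + M + M) i; clear; lia.
Qed.

Lemma event_AC t : c2 <= t < c3 -> ev t -> rw t \notin B.
Proof.
move=> /andP[h1 h2] et; apply/negP => /(B_low _) h.
have := h t; rewrite h1 (ltnW h2) (ps_r q t) => /(_ isT).
by move: et; rewrite /ev; move: (gt t); clear; lia.
Qed.

Lemma event_AC' t : c2 <= t < c3 -> ev t -> lw t \notin B.
Proof.
move=> /andP[h1 h2] et; apply/negP => /(B_low _) h.
have := h t; rewrite h1 (ltnW h2) (ps_l q t) => /(_ isT).
by move: et; rewrite /ev; move: (gt t); clear; lia.
Qed.

End Phase.

Section Transition.
Variables (n M : nat) (q : aseq n M).
Implicit Types (t s r k : nat) (i j m w : 'I_n) (X : {set 'I_n}).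
Hypothesis n30 : n = 30.
Notation lw := (lw q).
Notation rw := (rw q).
Notation ps := (ps q).
Notation gt := (gt q).
Notation ev := (ev q).
Notation ctr := (ctr q).
Notation K := (K q).
Notation evs := (evs q).
Notation word := (word q).
Variables (A B C : {set 'I_n}) (c1 c2 c3 : nat).
Hypothesis D : dec q A B C c1 c2 c3.
Hypothesis events : \sum_(0 <= t < M) ev t = 48.
Hypothesis centers : \sum_(0 <= t < M) ctr t = 144.
Hypothesis c1M : M <= c1.

Let l1 : c1 < c2. Proof. by case: D => _ _ []. Qed.
Let l2 : c2 < c3. Proof. by case: D => _ _ []. Qed.
Let l3 : c3 < c1 + M. Proof. by case: D => _ _ []. Qed.

Variables (tL tR tL' tR' : nat).
Hypothesis bl : block q A B C c1 c2 c3 tL tR.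
Hypothesis bl' : block q C A B (c2 + M) (c3 + M) (c1 + M.*2) tL' tR'.
Hypothesis monoA : \sum_(0 <= t < M) (ev t && mono q A t) = 6.
Hypothesis monoC : \sum_(0 <= t < M) (ev t && mono q C t) = 6.

Let r1 : c1 <= tL. Proof. by case: bl => -[]. Qed.
Let r2 : tL < c2. Proof. by case: bl => -[]. Qed.
Let r3 : c2 <= tR. Proof. by case: bl => -[]. Qed.
Let r4 : tR < c3. Proof. by case: bl => -[]. Qed.
Let r5 : c2 + M <= tL'. Proof. by case: bl' => -[]. Qed.
Let r6 : tL' < c3 + M. Proof. by case: bl' => -[]. Qed.
Let D' := dec_shift D.

(** The next block pulled back by half a turn, where left and right are exchanged and it reads
    RRRRLLLL. *)
Let u := tL' - M.
Let uM : u + M = tL'. Proof. by rewrite /u subnK //; move: r5; clear; lia. Qed.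
Let u1 : c2 <= u. Proof. by move: r5 uM; clear; lia. Qed.
Let u2 : u < c3. Proof. by move: r6 uM; clear; lia. Qed.

(** By reflection, 7 and 4 wires of [C] lie beyond 12 and 16, and none of [B]; the totals 17 and 13
    leave 10 and 9 for [A]. *)
Lemma beyond_u : beyond q A 12 u = 10 /\ beyond q A 16 u = 9.
Proof.
have [h1 h2] := bl_before bl'; rewrite -uM in h1 h2.
have [cA cB cC] : [/\ #|A| = 10, #|B| = 10 & #|C| = 10] by case: D.
have f1 := @beyond_flip _ _ q n30 C 12 u isT.
have f2 := @beyond_flip _ _ q n30 C 16 u isT.
have b g : 9 < g -> beyond q B g u = 0.
  move=> hg; apply: big1 => i iB; have := @B_low _ _ q n30 _ _ _ _ _ _ D u i _ iB.
  rewrite u1 (ltnW u2) => /(_ isT); move: (ps u i) hg; clear; lia.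
have g1 := @beyond_cover _ _ q n30 _ _ _ _ _ _ D 12 u isT.
have g2 := @beyond_cover _ _ q n30 _ _ _ _ _ _ D 16 u isT.
rewrite b // in g1; rewrite b // in g2; rewrite cC h1 in f1; rewrite cC h2 in f2.
rewrite -[28 - 12]/16 in f1; rewrite -[28 - 16]/12 in f2.
by split; move: f1 f2 g1 g2; clear; lia.
Qed.

(** The count of [A] beyond 16 never decreases in the window; it is 4 just after [tR] and 9 at
    [u]. *)
Lemma tR_lt_u : tR < u.
Proof.
rewrite ltnNge; apply/negP => h; have := @beyond_sum _ _ q A 16 u tR.+1 (leqW h).
have [_ ->] := beyond_u; have [_ ->] := bl_after bl.
set x := \sum_(_ <= t < _) _; set y := \sum_(_ <= t < _) _.
have : x <= y.
  rewrite /x /y big_nat [X in _ <= X]big_nat; apply: leq_sum => t /andP[t1 t2].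
  have t3 : c1 <= t < c3.
    by rewrite (leq_trans (ltnW l1) (leq_trans u1 t1)) (leq_trans t2).
  by have := A_right D t3; case: (rw t \in A) => [->|] //; rewrite andbF.
by move: x y; clear; lia.
Qed.

(** Events inside [A] or inside [C] occur only in the blocks, and [B] is away from the centre in
    this phase. *)
Lemma between t : tR < t < u -> ev t -> [/\ lw t \in A, rw t \in C & rw t \notin A].
Proof.
move=> /andP[t1 t2] et.
have t3 : c2 <= t < c3 by rewrite (leq_trans r3 (ltnW t1)) (ltn_trans t2 u2).
have t4 : c1 <= t < c3 by case/andP: t3 => h ->; rewrite andbT (leq_trans (ltnW l1) h).
have nm : mono q A t = false.
  by apply: (no_mono n30 D bl monoA) => //; rewrite t1 (ltn_trans t2 u2).
have nC : mono q C t = false.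
  rewrite -mono_period; apply: (no_mono_before n30 D' bl' monoC).
    by rewrite leq_add2r -uM ltn_add2r t2; case/andP: t3 => ->.
  by rewrite ev_period.
have nr := event_AC n30 D t3 et; have nl := event_AC' n30 D t3 et.
have cov i : i \notin B -> (i \in C) = (i \notin A).
  case: (pos_c1 D i) => -> -> ->; move: (ps c1 i); clear; lia.
move: nm nC; rewrite /mono !cov //; have := A_right D t4.
by case: (rw t \in A) => [->|] //; case: (lw t \in A).
Qed.

Let tRu : tR.+1 <= u. Proof. exact: tR_lt_u. Qed.

(** Each of these events carries one wire of [A] to the right, and the counts beyond 12 and 16 grow
    from 7 to 10 and from 4 to 9. *)
Lemma between_sums : \sum_(tR.+1 <= t < u) (ev t && (gt t == 12)) = 3 /\
  \sum_(tR.+1 <= t < u) (ev t && (gt t == 16)) = 5.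
Proof.
have aux g : (g == 12) || (g == 16) ->
    beyond q A g u = beyond q A g tR.+1 + \sum_(tR.+1 <= t < u) (ev t && (gt t == g)).
  move=> hg; have := @beyond_sum _ _ q A g _ _ tRu.
  rewrite [\sum_(_ <= t < _) (_ && (rw t \in A))]big_nat big1 => [|t ht]; last first.
    have [e|//] := eqVneq (gt t) g.
    have et : ev t by rewrite /ev e.
    by have [_ _ /negbTE ->] := between ht et.
  rewrite addn0 => ->; congr (_ + _); rewrite big_nat [RHS]big_nat; apply: eq_bigr => t ht.
  have [e|] := eqVneq (gt t) g; last by rewrite andbF.
  have et : ev t by rewrite /ev e.
  by have [-> _ _] := between ht et; rewrite et.
have [a1 a2] := beyond_u; have [b1 b2] := bl_after bl.
have := aux 12 isT; have := aux 16 isT; rewrite a1 a2 b1 b2.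
by do 2!(move: (\sum_(_ <= t < _) _) => ?); clear; lia.
Qed.

Let p := word tR.+1 u.

Lemma size_p : size p = 8.
Proof.
have := size_word q tRu; rewrite (evs_cat q tRu) => /addnI <-.
have e : \sum_(tR.+1 <= t < u) ev t = \sum_(tR.+1 <= t < u) (ev t && (gt t == 12)) +
    \sum_(tR.+1 <= t < u) (ev t && (gt t == 16)).
  by rewrite -big_split; apply: eq_bigr => t _ /=; rewrite /ev; move: (gt t); clear; lia.
by have [s1 s2] := between_sums; rewrite e s1 s2.
Qed.

Lemma evs_tR1 : evs tR.+1 = evs tL + 8.
Proof. by have [_ e1 e2] := bl_ev bl; rewrite evs_step e1 e2; clear; lia. Qed.

Lemma evs_u : evs u = evs tL + 16.
Proof. by have := size_word q tRu; rewrite -/p size_p evs_tR1; clear; lia. Qed.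

Lemma evs_period t : evs (t + M) = evs t + 48.
Proof.
rewrite (evs_cat q (leq_addr M t)); congr (_ + _); rewrite -events.
by apply: (sum_nat_period (f := fun r => nat_of_bool (ev r))) => r; rewrite ev_period.
Qed.

Lemma evs_tL' : evs tL' = evs tL + 64.
Proof. by rewrite -uM evs_period evs_u; clear; lia. Qed.

(** Two wires of [A] that enter on the left at consecutive events were both central at [tL] by
    [bl_Z], and both are central after the second entry; [no_both] forbids this. *)
Lemma no_repeat_p : no_repeat p.
Proof.
apply: no_repeatP => k; rewrite size_p => k8; apply/negP => /andP[n1 n2].
have [|s [/andP[hs1 hs2] es vs]] := @evs_time _ _ q tR.+1 u (evs tR.+1 + k) tRu.
  by rewrite leq_addr /= evs_u evs_tR1; move: k8; clear; lia.
have [|t [/andP[ht1 ht2] et vt]] := @evs_time _ _ q tR.+1 u (evs tR.+1 + k.+1) tRu.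
  by rewrite leq_addr /= evs_u evs_tR1; move: k8; clear; lia.
have hs : tR < s < u by rewrite hs1.
have ht : tR < t < u by rewrite ht1.
have gs : gt s = 12 by apply/eqP; rewrite -(nth_word hs es) vs addKn.
have gt' : gt t = 12 by apply/eqP; rewrite -(nth_word ht et) vt addKn.
have [xA xC xr] := between hs es; have [yA yC yr] := between ht et.
have st : s < t by apply: (@evs_le_lt _ _ q); rewrite vs vt ltn_add2l.
have s1t : evs s.+1 = evs t by rewrite evs_step es vs vt; clear; lia.
set x := lw s in xA; set y := lw t in yA.
have ens : ent q s = x by rewrite /ent gs.
have ent' : ent q t = y by rewrite /ent gt'.
have ext' : ext q t = rw t by rewrite /ext gt'.
have xt : x \in K t by rewrite -(K_evs st s1t) -ens; exact: K_enter.
have yt : y \notin K t by have [_ ] := K_ev et; rewrite ent'.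
have xy : x != y by apply: contraNneq yt => <-.
have low r i : tR < r < u -> i \in A -> ps r i <= 12 -> ps tR.+1 i <= 12.
  move=> /andP[h1 h2] iA; move: h1 h2; elim: r => // r IH; rewrite ltnS leq_eqVlt => /orP[/eqP ->//|h1] h2.
  move=> h; apply: IH => //; first exact: ltnW.
  rewrite leqNgt; apply/negP => h3; have [g e] := ps_step_down h3 h.
  have er : ev r by rewrite /ev g.
  have ht0 : tR < r < u by rewrite h1 ltnW.
  by have [_ _] := between ht0 er; rewrite e iA.
have xL : x \in K tL by apply: (bl_Z bl xA); apply: (low s) => //; rewrite ps_l gs.
have yL : y \in K tL by apply: (bl_Z bl yA); apply: (low t) => //; rewrite ps_l gt'.
have xt1 : x \in K t.+1.
  by apply: K_stay et xt _; rewrite ext'; apply: contraNneq yr => <-.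
have yt1 : y \in K t.+1 by rewrite -ent'; exact: K_enter.
have := @no_both _ _ q n30 _ _ _ _ _ _ D events centers c1M _ _ bl tL t.+1 x y xA xy _ _ xL yL xt1 yt1.
rewrite r1 leqnn ltnS (ltnW ht1) (ltn_trans ht2 u2) yL => h.
by have := h isT isT.
Qed.

Lemma p_ok : word_ok p.
Proof.
by rewrite /word_ok no_repeat_p andbT /p count_word; have [-> _] := between_sums.
Qed.

(** The window takes the R half of the block before [p] and the L half of the next block, which
    reads RRRR half a turn earlier. *)
Lemma phase_window a b : evs a = evs tL + 4 -> evs b = evs tL + 20 -> word a b = phase_word p.
Proof.
move=> ea eb; have eR := evs_tR1; have eu := evs_u; have e' := evs_tL'.
have aR : a <= tR.+1 by apply: ltnW; apply: (@evs_le_lt _ _ q); rewrite ea eR; clear; lia.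
have ub : u <= b by apply: ltnW; apply: (@evs_le_lt _ _ q); rewrite eb eu; clear; lia.
have La : tL <= a by apply: ltnW; apply: (@evs_le_lt _ _ q); rewrite ea; clear; lia.
rewrite (word_cat q aR (leq_trans tRu ub)) (word_cat q tRu ub) /phase_word; congr (_ ++ (_ ++ _)).
  rewrite word_const // => [|t /andP[t1 t2] et]; first by rewrite ea eR subnDl.
  rewrite (bl_side bl) //; first by have := evs_mono q t1; rewrite ea leqNgt => /negbTE ->.
  by rewrite (leq_trans La t1).
rewrite word_const // => [|t /andP[t1 t2] et]; first by rewrite eb eu subnDl.
have et' : ev (t + M) by rewrite ev_period.
have v : evs (t + M) < evs tL' + 4.
  by have := evs_lt et t2; rewrite evs_period e' eb; clear; lia.
have := bl_side bl' _ et'; rewrite v; have := gt_period q n30 t.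
have -> : tL' <= t + M <= tR'.
  rewrite -{1}uM leq_add2r t1 /=; apply: ltnW; apply: (@evs_le_lt _ _ q).
  have [_ _ ->] := bl_ev bl'; apply: leq_trans v _; by rewrite leq_add2l.
by move=> e /(_ isT) e2; move: e; rewrite e2; clear; lia.
Qed.

Lemma phase_defects a b : M <= a -> a <= b -> evs a = evs tL + 4 -> evs b = evs tL + 20 ->
  (if head false p && last false p then 1 else 2) <= \sum_(a <= t < b) dft q t.
Proof.
move=> Ma ab ea eb; have w := phase_window ea eb.
apply: (forces_sound n30 D events centers Ma ab (w := phase_word p)).
- have pw : p \in [seq w <- words 8 | word_ok w].
    by rewrite mem_filter p_ok; have := mem_words p; rewrite size_p.
  by move/allP: words_forced => /(_ p pw).
- by rewrite -w; exact: size_word.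
move=> t ht et; rewrite -w nth_word //; move: et; rewrite /ev.
by case: eqP => //= _ /eqP.
Qed.

Lemma head_p : head false p -> exists t, [/\ tR < t < c3, ev t, evs t = (evs tR).+1 /\ gt t = 12,
  lw t \in A & rw t \notin A].
Proof.
rewrite -nth0 => h.
have [|t [ht et vt]] := @evs_time _ _ q tR.+1 u (evs tR.+1 + 0) tRu.
  by rewrite leq_addr /= evs_u evs_tR1; clear; lia.
have [h1 _ h3] := between ht et; exists t; split=> //.
- by case/andP: ht => -> h2; exact: ltn_trans u2.
- split; first by rewrite vt addn0 evs_step; have [_ -> _] := bl_ev bl; rewrite addn1.
  by apply/eqP; rewrite -(nth_word ht et) vt addKn.
Qed.

(** Half a turn later a final L is the R event just before the next block, moving a wire of [C]: the
    form needed by [ends_disjoint]. *)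
Lemma last_p : last false p -> exists s, [/\ c2 + M <= s < tL', ev s, evs tL' = (evs s).+1 /\ gt s = 16,
  lw s \in C & rw s \notin C].
Proof.
rewrite -nth_last size_p => h.
have [|t [ht et vt]] := @evs_time _ _ q tR.+1 u (evs tR.+1 + 7) tRu.
  by rewrite leq_addr /= evs_u evs_tR1; clear; lia.
have [h1 h2 h3] := between ht et; case/andP: (ht) => t1 t2; exists (t + M); split.
- by rewrite leq_add2r -uM ltn_add2r t2 (leq_trans r3 (ltnW t1)).
- by rewrite ev_period.
- split; first by rewrite evs_period evs_tL' vt evs_tR1; clear; lia.
  have g : gt t == 12 by rewrite -(nth_word ht et) vt addKn.
  by have := gt_period q n30 t; rewrite (eqP g); clear; lia.
- by rewrite lw_period.
- rewrite rw_period; case: (pos_c1 D (lw t)) => eA _ eC; move: h1; rewrite eA eC.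
  by move: (ps _ _); clear; lia.
Qed.

End Transition.

(** * At most 69 halving lines *)

Definition mid_pair (s : cstate) : bool := s.2.1.1.

Lemma cstep_14 s s' : cstep 14 s = Some s' -> mid_pair s = false /\ mid_pair s'.
Proof. by case: s => [[[x1 x2] x3] [[[] x5] x6]] //= [<-]. Qed.

Lemma cstep_keep g s s' : ~~ (13 <= g <= 15) -> cstep g s = Some s' -> mid_pair s' = mid_pair s.
Proof.
move=> nc; have [hg|hg] := boolP (12 <= g <= 16); last by move/(cstep_other hg) => ->.
have : (g == 12) || (g == 16) by move: hg nc; clear; lia.
by case: s => [[[x1 x2] x3] [[x4 x5] x6]] /orP[] /eqP -> /=; case: ifP => // _ [<-].
Qed.

Section Count.
Variables (n M : nat) (q : aseq n M).
Implicit Types (t s r k : nat).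
Hypothesis n30 : n = 30.
Notation gt := (gt q).
Notation ev := (ev q).
Notation ctr := (ctr q).
Notation evs := (evs q).
Notation lst := (lst q).
Notation dft := (dft q).
Hypothesis events : \sum_(0 <= t < M) ev t = 48.
Hypothesis centers : \sum_(0 <= t < M) ctr t = 144.

Lemma ctr_exists a : exists2 r, a <= r < a + M & ctr r.
Proof.
have [/hasP[r]|/hasPn no] := boolP (has ctr (index_iota a (a + M))).
  by rewrite mem_index_iota; exists r.
have := @sum_nat_period (fun t => nat_of_bool (ctr t)) M a.
rewrite centers big_nat big1 => [|t ht]; last first.
  by apply/eqP; rewrite eqb0; apply: no; rewrite mem_index_iota.
by move=> h; have := h (fun t => congr1 nat_of_bool (ctr_period q n30 t)).
Qed.

(** After one central swap the flag has forgotten its initial value, and half a turn preserves which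
    central swaps are middle ones. *)
Lemma lst_flip r t : ctr r -> r < t -> lst (t + M) = lst t.
Proof.
move=> cr; elim: t => // t IH; rewrite ltnS addSn /= ctr_period //.
have -> : (gt (t + M) == 14) = (gt t == 14) by have := gt_period q n30 t; clear; lia.
rewrite leq_eqVlt => /orP[/eqP <-|/IH -> //]; by rewrite cr.
Qed.

Lemma lst_period t : M <= t -> lst (t + M) = lst t.
Proof. by move=> Mt; have [r /andP[_ rM] cr] := ctr_exists 0; apply: (lst_flip cr); exact: leq_trans rM Mt. Qed.

Lemma dft_period t : M <= t -> dft (t + M) = dft t.
Proof.
move=> Mt; rewrite /dft ctr_period // lst_period //; congr [&& _, ~~ _ & _].
by have := gt_period q n30 t; clear; lia.
Qed.

Lemma dft_sum_shift a b : M <= a ->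
  \sum_(a + M <= t < b + M) dft t = \sum_(a <= t < b) dft t.
Proof.
move=> Ma; rewrite big_addn addnK big_nat [RHS]big_nat.
by apply: eq_bigr => t /andP[h _]; rewrite dft_period //; exact: leq_trans Ma h.
Qed.

(** The flag falls at middle swaps and rises at side swaps; rises and falls balance up to its values
    at the ends. *)
Lemma lst_balance a b : a <= b ->
  lst b + \sum_(a <= t < b) ((gt t == 14) && lst t) =
  lst a + \sum_(a <= t < b) [&& ctr t, gt t != 14 & ~~ lst t].
Proof.
move/subnKC => <-; elim: (b - a) => [|d]; first by rewrite addn0 !big_geq.
rewrite addnS !big_nat_recr ?leq_addr //=; move: (a + d) => t.
have [g|g] := eqVneq (gt t) 14; first have -> : ctr t by rewrite /ctr g.
  by do 2!move: (\sum_(_ <= _ < _) _) => ?; case: (lst t); clear; lia.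
by do 2!move: (\sum_(_ <= _ < _) _) => ?; case: (ctr t); case: (lst t); clear; lia.
Qed.

Variables (A B C : {set 'I_n}) (c1 c2 c3 : nat).
Hypothesis D : dec q A B C c1 c2 c3.

Lemma lst_crossed r t : M <= r -> ctr r -> r < t -> lst t || mid_pair (cst q t).
Proof.
move=> Mr cr; elim: t => // t IH; rewrite ltnS => rt.
have Mt := leq_trans Mr rt; have st := cst_step n30 D events centers Mt.
rewrite [lst t.+1]/=; case: eqP => [g | n14]; first by rewrite g in st; rewrite (proj2 (cstep_14 st)).
have [//|nc] := boolP (ctr t); rewrite (cstep_keep nc st); apply: IH.
by move: rt; rewrite leq_eqVlt => /orP[/eqP e|//]; rewrite -e cr in nc.
Qed.

(** After a middle swap the middle pair is crossed, and only a side swap changes this; so two middle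
    swaps never follow each other. *)
Lemma mid_lst t : M.*2 <= t -> gt t = 14 -> lst t.
Proof.
move=> Mt g; have [r /andP[r1 r2] cr] := ctr_exists M.
have Mt' : M <= t by move: Mt; clear; lia.
have st := cst_step n30 D events centers Mt'; rewrite g in st.
have := @lst_crossed r t r1 cr; rewrite (proj1 (cstep_14 st)) orbF; apply.
by move: r2 Mt; clear; lia.
Qed.

(** Of the 144 central swaps, the middle ones make the flag fall, equally many side swaps make it
    rise, and the remaining ones are repetitions. *)
Lemma dft_total a : M.*2 <= a ->
  \sum_(a <= t < a + M) dft t + (\sum_(0 <= t < M) (gt t == 14)).*2 = 144.
Proof.
move=> Ma; have aM : M <= a by move: Ma; clear; lia.
have := lst_balance (leq_addr M a); rewrite lst_period // => /addnI.
rewrite -(@sum_nat_period (fun t => nat_of_bool (gt t == 14)) M a) => [|t]; last first.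
  by congr nat_of_bool; have := gt_period q n30 t; clear; lia.
rewrite -centers -(@sum_nat_period (fun t => nat_of_bool (ctr t)) M a) => [|t]; last first.
  by rewrite ctr_period.
have -> : \sum_(a <= t < a + M) ((gt t == 14) && lst t) = \sum_(a <= t < a + M) (gt t == 14).
  rewrite big_nat [RHS]big_nat; apply: eq_bigr => t /andP[h _].
  by case: eqP => // g; rewrite mid_lst //; exact: leq_trans Ma h.
move=> e; rewrite -addnn {1}e -!big_split; apply: eq_bigr => t _ /=; rewrite /dft.
have [g|g] := eqVneq (gt t) 14; first by rewrite /ctr g.
by case: (ctr t); case: (lst t).
Qed.

End Count.

Section Three.
Variables (n M : nat) (q : aseq n M).
Implicit Types (t s r k : nat).
Hypothesis n30 : n = 30.
Notation gt := (gt q).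
Notation ev := (ev q).
Notation ctr := (ctr q).
Notation evs := (evs q).
Notation lst := (lst q).
Notation dft := (dft q).
Notation word := (word q).
Hypothesis events : \sum_(0 <= t < M) ev t = 48.
Hypothesis centers : \sum_(0 <= t < M) ctr t = 144.

(** A final L of one phase and an initial L of the next are the events just before and just after
    the block between them. *)
Lemma link A B C c1 c2 c3 tL0 tR0 tL1 tR1 tL2 tR2 : dec q A B C c1 c2 c3 -> M <= c1 ->
  block q A B C c1 c2 c3 tL0 tR0 ->
  block q C A B (c2 + M) (c3 + M) (c1 + M.*2) tL1 tR1 ->
  block q B C A (c3 + M + M) (c1 + M.*2 + M) (c2 + M + M.*2) tL2 tR2 ->
  \sum_(0 <= t < M) (ev t && mono q A t) = 6 ->
  \sum_(0 <= t < M) (ev t && mono q C t) = 6 ->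
  \sum_(0 <= t < M) (ev t && mono q B t) = 6 ->
  last false (word tR0.+1 (tL1 - M)) -> head false (word tR1.+1 (tL2 - M)) -> False.
Proof.
move=> D0 m0 b0 b1 b2 mA mC mB; have D1 := dec_shift D0.
move=> /(last_p n30 D0 events b0 b1 mA mC)[s [hs es [vs gs] xs rs]].
move=> /(head_p n30 D1 b1 b2 mC mB)[t [ht et [vt gt'] xt rt]].
apply: (ends_disjoint n30 D1 events centers _ b1 hs es vs gs xs rs ht et vt gt' xt rt).
exact: leq_addl.
Qed.

Lemma three_phases A B C c1 c2 c3 : dec q A B C c1 c2 c3 -> M.*2 <= c1 ->
  \sum_(0 <= t < M) (gt t == 14) <= 69.
Proof.
move=> D0 c1M; have D1 := dec_shift D0; have D2 := dec_shift D1; have D3 := dec_shift D2.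
have [m0 m1 m2 m3] : [/\ M <= c1, M <= c2 + M, M <= c3 + M + M & M <= c1 + M.*2 + M + M].
  by split; move: c1M; clear; lia.
have [tL0 [tR0 b0]] := block_exists n30 D0 events centers m0.
have [tL1 [tR1 b1]] := block_exists n30 D1 events centers m1.
have [tL2 [tR2 b2]] := block_exists n30 D2 events centers m2.
have [tL3 [tR3 b3]] := block_exists n30 D3 events centers m3.
have [mA mB mC] : [/\ \sum_(0 <= t < M) (ev t && mono q A t) = 6,
    \sum_(0 <= t < M) (ev t && mono q B t) = 6 & \sum_(0 <= t < M) (ev t && mono q C t) = 6].
  have := mono_ev18 n30 D0 events; have := mono_ev_ge n30 D0 b0.
  have := mono_ev_ge n30 D1 b1; have := mono_ev_ge n30 D2 b2.
  by do 3!move: (\sum_(_ <= t < _) _) => ?; clear; split; lia.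
have l1 := evs_tL' n30 D0 events b0 b1 mA mC.
have l2 := evs_tL' n30 D1 events b1 b2 mC mB.
have l3 := evs_tL' n30 D2 events b2 b3 mB mA.
have per := evs_period n30 events.
have tLM : tL0 <= tL0 + M by exact: leq_addr.
(* Three windows of sixteen events tile the half turn from [a] to [a + M]; those of the second and
   third phase are pulled back by [M] and [2 * M]. *)
have [|a /andP[a1 a2] ea] := @evs_reach _ _ q tL0 (tL0 + M) (evs tL0 + 4) tLM.
  by rewrite per; clear; lia.
have [|b /andP[b1' b2'] eb] := @evs_reach _ _ q tL0 (tL0 + M) (evs tL0 + 20) tLM.
  by rewrite per; clear; lia.
have [|c /andP[c1' c2'] ec] := @evs_reach _ _ q tL0 (tL0 + M) (evs tL0 + 36) tLM.
  by rewrite per; clear; lia.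
have ab : a < b by apply: (@evs_le_lt _ _ q); rewrite ea eb; clear; lia.
have bc : b < c by apply: (@evs_le_lt _ _ q); rewrite ec eb; clear; lia.
have ca : c < a + M by apply: (@evs_le_lt _ _ q); rewrite per ec ea; clear; lia.
have L0 : c1 <= tL0 by case: (bl_range b0).
have aM : M.*2 <= a by exact: leq_trans c1M (leq_trans L0 a1).
have aM1 : M <= a by move: aM; clear; lia.
have bM1 : M <= b by exact: leq_trans aM1 (ltnW ab).
have cM1 : M <= c by exact: leq_trans bM1 (ltnW bc).
have sft := @dft_sum_shift _ _ q n30 centers.
have d0 := phase_defects n30 D0 events centers m0 b0 b1 mA mC aM1 (ltnW ab) ea eb.
have Mx x : M <= x + M by exact: leq_addl.
have bcM : b + M <= c + M by rewrite leq_add2r ltnW.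
have caM : c + M + M <= a + M + M + M by rewrite !leq_add2r ltnW.
have e1 : evs (b + M) = evs tL1 + 4 by rewrite per eb l1; clear; lia.
have e2 : evs (c + M) = evs tL1 + 20 by rewrite per ec l1; clear; lia.
have e3 : evs (c + M + M) = evs tL2 + 4 by rewrite !per ec l2 l1; clear; lia.
have e4 : evs (a + M + M + M) = evs tL2 + 20 by rewrite !per ea l2 l1; clear; lia.
have d1 := phase_defects n30 D1 events centers m1 b1 b2 mC mB (Mx _) bcM e1 e2.
have d2 := phase_defects n30 D2 events centers m2 b2 b3 mB mA (Mx _) caM e3 e4.
rewrite sft // in d1; rewrite sft // sft // in d2.
have k01 := link D0 m0 b0 b1 b2 mA mC mB.
have k12 := link D1 m1 b1 b2 b3 mC mB mA.
(* Three shifts advance time by two full turns and 192 events, so the fourth block ends exactly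
   [4 * M] after the first; this closes the cycle of phases. *)
have k20 : last false (word tR2.+1 (tL3 - M)) -> head false (word tR0.+1 (tL1 - M)) -> False.
  move=> /(last_p n30 D2 events b2 b3 mB mA)[s [hs es [vs gs] xs rs]].
  move=> /(head_p n30 D0 b0 b1 mA mC)[t [/andP[t1 t2] et [vt gt'] xt rt]].
  have [evL0 evR0 eR0] := bl_ev b0; have [evL3 evR3 eR3] := bl_ev b3.
  have ev4 r : ev (r + M + M + M + M) = ev r by rewrite !ev_period.
  have per4 r : evs (r + M + M + M + M) = evs r + 192 by rewrite !per; clear; lia.
  have eR : tR3 = tR0 + M + M + M + M.
    apply: (@evs_inj _ _ q) => //; first by rewrite ev4.
    by rewrite per4 eR3 eR0 l3 l2 l1; clear; lia.
  apply: (@ends_disjoint _ _ q n30 _ _ _ _ _ _ D3 events centers m3 _ _ b3 s (t + M + M + M + M)) => //.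
  - by rewrite eR !ltn_add2r t1 /=; move: t2; clear; lia.
  - by rewrite ev4.
  - by rewrite eR !per4 vt.
  - have := gt_period q n30 (t + M + M + M); have := gt_period q n30 (t + M + M).
    have := gt_period q n30 (t + M); have := gt_period q n30 t; rewrite gt'; clear; lia.
  - by rewrite lw_period rw_period lw_period rw_period.
  - by rewrite rw_period lw_period rw_period lw_period.
have := dft_total n30 events centers D0 aM.
rewrite (@big_cat_nat _ _ _ b a) /=; try by move: ab bc ca; clear; lia.
rewrite (@big_cat_nat _ _ _ c b) /=; try by move: ab bc ca; clear; lia.
move: d0 d1 d2 k01 k12 k20; do 4!move: (\sum_(_ <= t < _) _) => ?.
do 3!(case: (head _ _); case: (last _ _)) => /=; clear => *; try lia; exfalso; auto.
Qed.

End Three.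

(** With [m] the smaller of [g] and [28 - g], the weights [29 - 2 * k] for [m < k < 15] add up to
    the square of [14 - m], and [m * (28 - m)] is 196 minus that square. *)
Lemma gate_weight g : g < 29 ->
  g * (28 - g) + \sum_(1 <= k < 15) (29 - 2 * k) * ((g < k) + (28 - g < k)) = 196.
Proof.
move=> hg; have h : all (fun g => g * (28 - g) +
    sumn [seq (29 - 2 * k) * ((g < k) + (28 - g < k)) | k <- iota 1 14] == 196) (iota 0 29) by [].
move/allP: h => /(_ g); rewrite mem_iota hg => /(_ isT) /eqP <-.
by rewrite sumnE big_map.
Qed.

(** * From lower bounds on E k to the sum over gates *)

Section Bound.
Variables (n M : nat) (q : aseq n M).
Implicit Types (t s r k : nat).
Hypothesis n30 : n = 30.
Hypothesis M435 : M = 435.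
Notation gt := (gt q).
Notation ev := (ev q).
Notation ctr := (ctr q).
Notation ps := (ps q).
Notation lw := (lw q).
Notation rw := (rw q).
Definition E k := edges_lt q [set: 'I_n] k.
Definition halving := \sum_(0 <= t < M) (gt t == 14).

Lemma E_half k : E k = \sum_(0 <= t < M) ((gt t < k) + (28 - gt t < k)).
Proof.
rewrite /E /edges_lt sum_nat_double; apply: eq_bigr => t _.
rewrite /act !in_setT /= -!/(gt _); have := gt_period q n30 t; move: (gt _) (gt _).
by clear; lia.
Qed.

Lemma E_lower k : k < 14 -> edges_bound k 30 <= E k.
Proof.
move=> hk; have cT : #|[set: 'I_n]| = 30 by rewrite cardsT card_ord.
by have := @edges_lower _ _ q [set: 'I_n] k; rewrite cT; apply; move: hk; clear; lia.
Qed.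

Lemma weight_total :
  \sum_(0 <= t < M) gt t * (28 - gt t) + \sum_(1 <= k < 15) (29 - 2 * k) * E k = 196 * 435.
Proof.
under [X in _ + X]eq_bigr => k _ do rewrite E_half big_distrr.
rewrite exchange_big /= -big_split /=.
under eq_bigr => t _ do rewrite (gate_weight (gt_lt q n30 t)).
by rewrite sum_nat_const_nat M435 subn0 mulnC.
Qed.

Lemma E14 : E 14 + halving = 435.
Proof.
rewrite E_half /halving -big_split /= -[RHS]M435 -[RHS]muln1 -[X in X * _]subn0 -sum_nat_const_nat.
by apply: eq_bigr => t _; have := gt_lt q n30 t; move: (gt t); clear; lia.
Qed.

Lemma E1413 : E 14 = E 13 + \sum_(0 <= t < M) ((gt t == 13) || (gt t == 15)).
Proof.
rewrite !E_half -big_split /=; apply: eq_bigr => t _.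
by have := gt_lt q n30 t; move: (gt t); clear; lia.
Qed.

Lemma E1312 : E 13 = E 12 + \sum_(0 <= t < M) ev t.
Proof.
rewrite !E_half -big_split /=; apply: eq_bigr => t _; rewrite /ev.
by have := gt_lt q n30 t; move: (gt t); clear; lia.
Qed.

Lemma E13ctr : E 13 + \sum_(0 <= t < M) ctr t = 435.
Proof.
rewrite E_half -big_split /= -[RHS]M435 -[RHS]muln1 -[X in X * _]subn0 -sum_nat_const_nat.
by apply: eq_bigr => t _; have := gt_lt q n30 t; rewrite /ctr; move: (gt t); clear; lia.
Qed.

Lemma halving_side T : T <= M ->
  \sum_(0 <= t < T) (gt t == 14) <= \sum_(0 <= t < T) ((gt t == 13) || (gt t == 15)) \/
  \sum_(0 <= t < T) (gt t == 14) = (\sum_(0 <= t < T) ((gt t == 13) || (gt t == 15))).+1 /\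
  exists s, [/\ s < T, gt s = 14, ps T (lw s) = 15 & ps T (rw s) = 14].
Proof.
elim: T => [|T IH] TM; first by left; rewrite !big_geq.
have {}IH := IH (ltnW TM); rewrite !big_nat_recr //=.
move: IH; do 2!move: (\sum_(_ <= t < _) _) => ?.
have [g|n14] := eqVneq (gt T) 14.
  case=> [h|[h [s [sT gs p1 p2]]]].
    rewrite g /= addn0; move: h; rewrite leq_eqVlt => /orP[/eqP ->|h]; last by left; rewrite addn1.
    right; split; first by rewrite addn1.
    by exists T; rewrite ps_l1 ps_r1 g.
  have lr : lw T = rw s by apply: (@ps_inj _ _ q T); rewrite p2 (ps_l q T).
  have rl : rw T = lw s by apply: (@ps_inj _ _ q T); rewrite p1 (ps_r q T) g.
  have : s + M <= T.
    apply: (pswap_far (q := q) sT (i := lw s) (j := rw s)); first by rewrite /pswap !eqxx.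
    by rewrite /pswap lr rl !eqxx orbT.
  by move: TM; clear; lia.
rewrite addn0; have [sd|nsd] := boolP ((gt T == 13) || (gt T == 15)).
  by case=> [h|[-> _]]; left; rewrite addn1 // leqW.
rewrite addn0; case=> [h|[h [s [sT gs p1 p2]]]]; [by left|right; split=> //].
exists s; split=> //; first exact: ltnW.
- rewrite ps_o1 //; apply: contraNneq nsd => e; move: p1; rewrite e.
    by rewrite (ps_l q T) => ->; rewrite orbT.
  by rewrite (ps_r q T) => -[e']; rewrite e' in n14.
- rewrite ps_o1 //; apply: contraNneq nsd => e; move: p2; rewrite e.
    by rewrite (ps_l q T) => e'; rewrite e' in n14.
  by rewrite (ps_r q T) => -[->].
Qed.

(** With [435 - E 14] middle and [E 14 - E 13] side swaps, alternation gives
    [2 * E 14 >= 434 + 291], and the odd right side is rounded up. *)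
Lemma E14_lower : 363 <= E 14.
Proof.
have := E14; have := E1413; have := E_lower (isT : 13 < 14); rewrite -[edges_bound _ _]/291.
rewrite /halving; have [h|[h _]] := halving_side (leqnn M); move: h;
  by do 2!move: (\sum_(_ <= t < _) _) => ?; clear; lia.
Qed.

Lemma E14_tight : E 2 = 9 -> E 10 = 165 -> E 12 = 243 -> E 13 = 291 -> 366 <= E 14.
Proof.
move=> e2 e10 e12 e13.
have events : \sum_(0 <= t < M) ev t = 48 by have := E1312; rewrite e12 e13; clear; lia.
have centers : \sum_(0 <= t < M) ctr t = 144 by have := E13ctr; rewrite e13; clear; lia.
have [A [B [C [c1 [c2 [c3 D]]]]]] := dec_exists n30 e10 e2.
(* Shifting twice moves the decomposition past time [2 * M]. *)
have := three_phases n30 events centers (dec_shift (dec_shift D)).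
have -> : M.*2 <= c3 + M + M by clear; lia.
by move=> /(_ isT); have := E14; rewrite /halving; clear; lia.
Qed.

(** The constants are [219 * 331 = 72489 = 82215 - 9726], where [8 * 82215 = 30 * 29 * 28 * 27], and
    [297 * 43 = 12771 = 196 * 435 - 72489]. *)
Theorem gates_bound : \sum_(0 <= t < M) gt t * (28 - gt t) <= 219 * 331.
Proof.
suff : 297 * 43 <= \sum_(1 <= k < 15) (29 - 2 * k) * E k.
  by have := weight_total; do 2!move: (\sum_(_ <= t < _) _) => ?; clear; lia.
have -> : \sum_(1 <= k < 15) (29 - 2 * k) * E k = 27 * E 1 + 25 * E 2 + 23 * E 3 + 21 * E 4 + 19 * E 5
    + 17 * E 6 + 15 * E 7 + 13 * E 8 + 11 * E 9 + 9 * E 10 + 7 * E 11 + 5 * E 12 + 3 * E 13 + E 14.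
  by rewrite unlock /=; clear; lia.
have b k := @E_lower k.
have b1 : 3 <= E 1 := b 1 isT. have b2 : 9 <= E 2 := b 2 isT. have b3 : 18 <= E 3 := b 3 isT.
have b4 : 30 <= E 4 := b 4 isT. have b5 : 45 <= E 5 := b 5 isT. have b6 : 63 <= E 6 := b 6 isT.
have b7 : 84 <= E 7 := b 7 isT. have b8 : 108 <= E 8 := b 8 isT. have b9 : 135 <= E 9 := b 9 isT.
have b10 : 165 <= E 10 := b 10 isT. have b11 : 201 <= E 11 := b 11 isT.
have b12 : 243 <= E 12 := b 12 isT. have b13 : 291 <= E 13 := b 13 isT.
have b14 := E14_lower; have t := E14_tight; clear b.
move: b1 b2 b3 b4 b5 b6 b7 b8 b9 b10 b11 b12 b13 b14 t.
move: (E 1) (E 2) (E 3) (E 4) (E 5) (E 6) (E 7) (E 8) (E 9) (E 10) (E 11) (E 12) (E 13) (E 14).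
clear => x1 x2 x3 x4 x5 x6 x7 x8 x9 x10 x11 x12 x13 x14 b1 b2 b3 b4 b5 b6 b7 b8 b9 b10 b11 b12 b13 b14 t.
have low : 27 * 3 + 23 * 18 + 21 * 30 + 19 * 45 + 17 * 63 + 15 * 84 + 13 * 108 + 11 * 135 + 7 * 201 <=
    27 * x1 + 23 * x3 + 21 * x4 + 19 * x5 + 17 * x6 + 15 * x7 + 13 * x8 + 11 * x9 + 7 * x11.
  by rewrite !leq_add ?leq_mul2l.
have -> : 27 * x1 + 25 * x2 + 23 * x3 + 21 * x4 + 19 * x5 + 17 * x6 + 15 * x7 + 13 * x8 + 11 * x9 +
    9 * x10 + 7 * x11 + 5 * x12 + 3 * x13 + x14 = (27 * x1 + 23 * x3 + 21 * x4 + 19 * x5 + 17 * x6 +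
    15 * x7 + 13 * x8 + 11 * x9 + 7 * x11) + 25 * x2 + 9 * x10 + 5 * x12 + 3 * x13 + x14.
  by clear; lia.
move: (27 * x1 + _ + _ + _ + _ + _ + _ + _ + _) low => y low.
clear b1 b3 b4 b5 b6 b7 b8 b9 b11.
(* The bounds give 12768 in total, so one unit more at any of these four places, of weight 25, 9, 5
   or 3, is enough. *)
have [e2|e2] := ltnP 9 x2; first by clear t; lia.
have [e10|e10] := ltnP 165 x10; first by clear t; lia.
have [e12|e12] := ltnP 243 x12; first by clear t; lia.
have [e13|e13] := ltnP 291 x13; first by clear t; lia.
have {b14} b14 : 366 <= x14 by apply: t; apply/eqP; rewrite eqn_leq ?e2 ?e10 ?e12 ?e13.
by clear t; lia.
Qed.

End Bound.

(** * The allowable sequence of a point set *)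

Section Build.
Variables (n : nat) (o : rel 'I_n) (L : seq ('I_n * 'I_n)).
Implicit Types (i j k m : 'I_n) (t s r : nat).
Hypothesis o_irr : irreflexive o.
Hypothesis o_trans : transitive o.
Hypothesis o_total : forall i j, i != j -> o i j || o j i.
Hypothesis L_uniq : uniq L.
Hypothesis mem_L : forall i j, ((i, j) \in L) = o i j.
Hypothesis L_pos : 0 < size L.
Let M := size L.
Let x i j := index (i, j) L.
(** The signotope condition: of the three pairs of a triple, the extreme one is swapped second. This
    makes the intermediate relations transitive. *)
Hypothesis between : forall i j k, o i j -> o j k ->
  (x i j < x i k < x j k) || (x j k < x i k < x i j).

Lemma o_asym i j : o i j -> o j i = false.
Proof. by move=> h; apply/negP => h'; have := o_trans h h'; rewrite o_irr. Qed.

Lemma x_lt i j : o i j -> x i j < M.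
Proof. by rewrite -mem_L index_mem. Qed.

Definition before r i j := if o i j then r <= x i j else o j i && (x j i < r).

Lemma before_asym r i j : before r i j -> ~~ before r j i.
Proof.
rewrite /before; case oij : (o i j); first by rewrite (o_asym oij) /= -leqNgt.
by case/andP=> -> /=; rewrite ltnNge.
Qed.

Lemma before_total r i j : i != j -> before r i j || before r j i.
Proof.
rewrite /before => /o_total; case oij : (o i j); first by rewrite (o_asym oij) /=; case: leqP.
by move=> /= -> /=; case: ltnP.
Qed.

Lemma before_trans r : transitive (before r).
Proof.
move=> j i k; rewrite /before.
have [->|ij] := eqVneq i j; first by rewrite o_irr.
have [->|jk] := eqVneq j k; first by rewrite o_irr.
have [<-|ik] := eqVneq i k.
  case oij : (o i j); first by rewrite (o_asym oij) /=; case: ltngtP.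
  by case/andP => -> h1 /=; rewrite leqNgt h1.
case oij : (o i j); case ojk : (o j k).
- by rewrite (o_trans oij ojk); have := between oij ojk; clear; lia.
- move=> h1 /andP[okj h2]; case oik : (o i k).
    by have := between oik okj; move: h1 h2; clear; lia.
  have oki : o k i by have := o_total ik; rewrite oik.
  by rewrite oki; have := between oki oij; move: h1 h2; clear; lia.
- move=> /andP[oji h1] h2; case oik : (o i k).
    by have := between oji oik; move: h1 h2; clear; lia.
  have oki : o k i by have := o_total ik; rewrite oik.
  by rewrite oki; have := between ojk oki; move: h1 h2; clear; lia.
move=> /andP[oji h1] /andP[okj h2]; have oki := o_trans okj oji.
by rewrite (o_asym oki) oki; have := between okj oji; move: h1 h2; clear; lia.
Qed.

Lemma before_end i j : before M i j = before 0 j i.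
Proof.
rewrite /before ltn0 andbF leq0n; case oij : (o i j).
  by rewrite (o_asym oij) leqNgt x_lt.
by case oji : (o j i) => //=; rewrite x_lt.
Qed.

Variable e0 : 'I_n * 'I_n.
Let L1 r := (nth e0 L r).1.
Let L2 r := (nth e0 L r).2.

Lemma L12 r : r < M -> o (L1 r) (L2 r) /\ x (L1 r) (L2 r) = r.
Proof.
move=> h; rewrite /L1 /L2 /x -mem_L -surjective_pairing mem_nth //; split=> //.
exact: index_uniq.
Qed.

Lemma L_x i j : o i j -> L1 (x i j) = i /\ L2 (x i j) = j.
Proof. by move=> h; rewrite /L1 /L2 nth_index // mem_L. Qed.

Lemma before_step r i j : r < M -> before r.+1 i j =
  (i == L2 r) && (j == L1 r) || before r i j && ~~ ((i == L1 r) && (j == L2 r)).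
Proof.
move=> h; have [o12 x12] := L12 h; rewrite /before.
have e a b : o a b -> (x a b == r) = (a == L1 r) && (b == L2 r).
  move=> oab; apply/eqP/andP => [<-|[/eqP -> /eqP ->]//].
  by have [-> ->] := L_x oab; rewrite !eqxx.
case oij : (o i j).
  rewrite -e //; have -> : (i == L2 r) && (j == L1 r) = false.
    by apply/negP => /andP[/eqP a /eqP b]; move: oij; rewrite a b o_asym.
  by move: (x i j); clear; lia.
case oji : (o j i) => /=.
  rewrite andbC -e //; have -> : (i == L1 r) && (j == L2 r) = false.
    by apply/negP => /andP[/eqP a /eqP b]; move: oij; rewrite a b o12.
  by move: (x j i); clear; lia.
by rewrite orbF; apply/esym/negP => /andP[/eqP a /eqP b]; move: oji; rewrite a b o12.
Qed.

(** Every other half turn replays the list of swaps with the order reversed. *)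
Definition abef t i j :=
  if odd (t %/ M) then before (t %% M) j i else before (t %% M) i j.
Definition alw t := if odd (t %/ M) then L2 (t %% M) else L1 (t %% M).
Definition arw t := if odd (t %/ M) then L1 (t %% M) else L2 (t %% M).

Let rM t : t %% M < M. Proof. by rewrite ltn_mod. Qed.

Lemma abef_asym t i j : abef t i j -> ~~ abef t j i.
Proof. by rewrite /abef; case: (odd _); apply: before_asym. Qed.
Lemma abef_total t i j : i != j -> abef t i j || abef t j i.
Proof. by rewrite /abef => ij; case: (odd _); [rewrite orbC|]; exact: before_total. Qed.
Lemma abef_trans t : transitive (abef t).
Proof.
move=> j i k; rewrite /abef; case: (odd _); last exact: before_trans.
by move=> h1 h2; exact: before_trans h2 h1.
Qed.

Lemma abef_lr t : abef t (alw t) (arw t).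
Proof.
have [o12 x12] := L12 (rM t).
by rewrite /abef /alw /arw; case: (odd _); rewrite /before o12 x12.
Qed.

Lemma abef_period t i j : abef (t + M) i j = abef t j i.
Proof. by rewrite /abef divnDr // divnn L_pos addn1 modnDr /=; case: (odd _). Qed.
Lemma alw_period t : alw (t + M) = arw t.
Proof. by rewrite /alw /arw divnDr // divnn L_pos addn1 modnDr /=; case: (odd _). Qed.
Lemma arw_period t : arw (t + M) = alw t.
Proof. by rewrite /alw /arw divnDr // divnn L_pos addn1 modnDr /=; case: (odd _). Qed.

Lemma abef_step t i j : abef t.+1 i j =
    (i == arw t) && (j == alw t) || abef t i j && ~~ ((i == alw t) && (j == arw t)).
Proof.
have -> : abef t.+1 i j = if odd (t %/ M) then before (t %% M).+1 j i else before (t %% M).+1 i j.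
  rewrite {1}(divn_eq t M) -addnS /abef divnMDl // modnMDl.
  have := rM t; rewrite leq_eqVlt => /orP[/eqP e|h].
    rewrite e divnn L_pos modnn addn1 !before_end /=.
    by case: (odd _).
  by rewrite (divn_small h) addn0 (modn_small h).
rewrite /abef /alw /arw; case: (odd _); rewrite before_step //.
by rewrite ![(j == _) && _]andbC.
Qed.

Lemma aswap_once s t : s < t -> [set alw s; arw s] = [set alw t; arw t] -> s + M <= t.
Proof.
move=> st; have e r : [set alw r; arw r] = [set L1 (r %% M); L2 (r %% M)].
  by rewrite /alw /arw; case: (odd _) => //; rewrite setUC.
rewrite !e => h; have [o1 x1] := L12 (rM s); have [o2 x2] := L12 (rM t).
have E : s %% M = t %% M.
  rewrite -x1 -x2; move: h o1 o2; move: (L1 (s %% M)) (L2 (s %% M)) (L1 (t %% M)) (L2 (t %% M)) => a b c d h o1 o2.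
  have /set2P[ea|ea] : a \in [set c; d] by rewrite -h set21.
    have /set2P[eb|eb] : b \in [set c; d] by rewrite -h set22.
      by move: o1; rewrite ea eb o_irr.
    by rewrite ea eb.
  have /set2P[eb|eb] : b \in [set c; d] by rewrite -h set22.
    by move: o1; rewrite ea eb o_asym.
  by move: o1; rewrite ea eb o_irr.
have hq : s %/ M < t %/ M.
  rewrite ltnNge; apply/negP => hq; move: st; rewrite ltnNge => /negP; apply.
  by rewrite (divn_eq s M) (divn_eq t M) E leq_add2r leq_mul2r hq orbT.
by rewrite (divn_eq s M) (divn_eq t M) E addnAC -mulSnr leq_add2r leq_mul2r hq orbT.
Qed.

Definition aseq_of : aseq n M :=
  ASeq abef_asym abef_total abef_trans abef_lr abef_step abef_period alw_period arw_period aswap_once.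

Lemma aseq_gate t : t < M -> gate aseq_of setT t = #|[set m | before t m (L1 t)]|.
Proof.
move=> tM; rewrite /gate /pos; apply: eq_card => m; rewrite !inE /= /abef /alw.
by rewrite divn_small // modn_small.
Qed.

End Build.

Import Order.TTheory GRing.Theory Num.Theory.
Delimit Scope Z_scope with BZ.
Local Open Scope ring_scope.

Section Geometry.
Variables (R : realType) (n : nat) (p : 'I_n -> point R).
Implicit Types (i j k m : 'I_n) (u v w : 'I_n * 'I_n).
Hypothesis gp : general_position p.

(** The order by projection on a direction slightly tilted from the first axis, so that vertical
    pairs are ordered too and are swapped last. *)
Definition lexo i j := ((p i).1 < (p j).1) || ((p i).1 == (p j).1) && ((p i).2 < (p j).2).
Definition dx u := (p u.2).1 - (p u.1).1.
Definition dy u := (p u.2).2 - (p u.1).2.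
Definition cross u v := dx u * dy v - dy u * dx v.
Definition sle u v := 0 <= cross u v.
Definition lexpair u := lexo u.1 u.2.

Lemma lexo_irr : irreflexive lexo.
Proof. by move=> i; rewrite /lexo !ltxx andbF. Qed.

Lemma lexo_trans : transitive lexo.
Proof.
move=> j i k /orP[h|/andP[/eqP e h]] /orP[h'|/andP[/eqP e' h']]; apply/orP.
- by left; exact: lt_trans h'.
- by left; rewrite -e'.
- by left; rewrite e.
- by right; rewrite e e' eqxx (lt_trans h h').
Qed.

Lemma lexo_total i j : i != j -> lexo i j || lexo j i.
Proof.
move=> ij; rewrite /lexo; case: ltgtP => //= e1; case: ltgtP => //= e2.
by case: gp => inj _; case/eqP: ij; apply: inj; rewrite (surjective_pairing (p i)) e1 e2 -surjective_pairing.
Qed.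

Lemma lexpairP u : lexpair u -> 0 < dx u \/ dx u = 0 /\ 0 < dy u.
Proof.
case/orP => [h|/andP[/eqP e h]]; [left|right]; rewrite /dx /dy ?subr_gt0 // e subrr.
by split.
Qed.

Lemma sle_total : {in lexpair &, total sle}.
Proof.
move=> u v _ _; rewrite /sle; have -> : cross v u = - cross u v by rewrite /cross; ring.
by rewrite oppr_ge0 le_total.
Qed.

(** The directions of lexicographic pairs lie in a half-open half plane, where the cross product
    compares slopes; the vertical ones need a separate case. *)
Lemma sle_trans : {in lexpair & &, transitive sle}.
Proof.
move=> v u w /lexpairP hv /lexpairP hu /lexpairP hw; rewrite /sle /cross.
move: (dx v) (dy v) (dx u) (dy u) (dx w) (dy w) hv hu hw => b1 b2 a1 a2 c1 c2 hv hu hw h1 h2.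
have id : b1 * (a1 * c2 - a2 * c1) = a1 * (b1 * c2 - b2 * c1) + c1 * (a1 * b2 - a2 * b1) by ring.
have a0 : 0 <= a1 by case: hu => [/ltW|[-> _]].
have c0 : 0 <= c1 by case: hw => [/ltW|[-> _]].
case: hv => [b0|[b0 b2p]].
  by rewrite -(pmulr_rge0 _ b0) id addr_ge0 // mulr_ge0.
have c10 : c1 = 0.
  by apply/eqP; rewrite eq_le c0 andbT -(pmulr_rle0 _ b2p); move: h2; rewrite b0; lra.
case: hw => [|[_ c2p]]; first by rewrite c10 ltxx.
by rewrite c10 mulr0 subr0 mulr_ge0 // ltW.
Qed.

(** Parallel pairs are ordered arbitrarily by the sort. This is harmless: only pairs of the same
    triple are ever compared, and their cross product is an orientation, which is nonzero. *)
Definition slopes := sort sle [seq u <- enum {: 'I_n * 'I_n} | lexpair u].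

Lemma mem_slopes i j : ((i, j) \in slopes) = lexo i j.
Proof. by rewrite mem_sort mem_filter mem_enum andbT. Qed.

Lemma slopes_uniq : uniq slopes.
Proof. by rewrite sort_uniq filter_uniq // enum_uniq. Qed.

Lemma slopes_sorted : sorted sle slopes.
Proof. by apply: (sort_sorted_in sle_total); apply: filter_all. Qed.

Lemma slopes_lt u v : lexpair u -> lexpair v -> 0 < cross u v -> (index u slopes < index v slopes)%N.
Proof.
move=> hu hv h; rewrite ltnNge leq_eqVlt; apply/negP => /orP[/eqP e|lt].
  have uv : u = v.
    by rewrite -(nth_index u (s := slopes) (x := u)) -?e ?nth_index //; case: (u) (v) hu hv => a b [c d]; rewrite mem_slopes.
  by move: h; rewrite uv /cross mulrC subrr ltxx.
have tr : {in slopes & &, transitive sle}.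
  by move=> a b c; rewrite !mem_sort !mem_filter => /andP[ha _] /andP[hb _] /andP[hc _]; apply: sle_trans.
have := sorted_ltn_index_in tr slopes_sorted.
have mu : u \in slopes by case: (u) hu => a b; rewrite mem_slopes.
have mv : v \in slopes by case: (v) hv => a b; rewrite mem_slopes.
move/(_ v u mv mu lt); rewrite /sle; have -> : cross v u = - cross u v by rewrite /cross; ring.
by rewrite oppr_ge0 leNgt h.
Qed.

Lemma orient_cross i j k : [/\ cross (i, j) (i, k) = orient (p i) (p j) (p k),
  cross (i, k) (j, k) = orient (p i) (p j) (p k) & cross (i, j) (j, k) = orient (p i) (p j) (p k)].
Proof. by split; rewrite /cross /dx /dy /orient /=; ring. Qed.

Lemma slopes_pos i j k : lexo i j -> lexo j k -> 0 < orient (p i) (p j) (p k) ->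
  (index (i, j) slopes < index (i, k) slopes < index (j, k) slopes)%N.
Proof.
move=> ij jk h; have ik := lexo_trans ij jk; have [h1 h2 _] := orient_cross i j k.
by rewrite !slopes_lt // ?h1 ?h2.
Qed.

Lemma slopes_neg i j k : lexo i j -> lexo j k -> orient (p i) (p j) (p k) < 0 ->
  (index (j, k) slopes < index (i, k) slopes < index (i, j) slopes)%N.
Proof.
move=> ij jk h; have ik := lexo_trans ij jk; have [h1 h2 _] := orient_cross i j k.
have opp u v : cross u v = - cross v u by rewrite /cross; ring.
by rewrite !slopes_lt // opp ?h1 ?h2 oppr_gt0.
Qed.

Lemma lexo_neq i j : lexo i j -> i != j.
Proof. by apply: contraTneq => ->; rewrite lexo_irr. Qed.

Lemma slopes_between i j k : lexo i j -> lexo j k ->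
  let x i j := index (i, j) slopes in
  ((x i j < x i k < x j k) || (x j k < x i k < x i j))%N.
Proof.
move=> ij jk /=; case: gp => _ /(_ i j k (lexo_neq ij) (lexo_neq jk) (lexo_neq (lexo_trans ij jk))).
by rewrite neq_lt => /orP[h|h]; [rewrite slopes_neg ?orbT|rewrite slopes_pos].
Qed.

(* When the pair (i, j) is swapped, the wires before it are the points on the
   right of the line ij. *)
Lemma before_right i j m : lexo i j ->
  before lexo slopes (index (i, j) slopes) m i = (orient (p i) (p j) (p m) < 0).
Proof.
move=> ij; rewrite /before.
have [->|mi] := eqVneq m i.
  by rewrite lexo_irr /= /orient !subrr !mulr0 subrr ltxx.
have [->|mj] := eqVneq m j.
  rewrite ij; have -> : lexo j i = false by apply/negP => h; have := lexo_trans ij h; rewrite lexo_irr.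
  by rewrite ltnn /orient mulrC subrr ltxx.
have im : i != m by rewrite eq_sym.
have jm : j != m by rewrite eq_sym.
have ne : orient (p i) (p j) (p m) != 0 by case: gp => _; apply => //; exact: lexo_neq.
have c1 : orient (p m) (p i) (p j) = orient (p i) (p j) (p m) by rewrite /orient; ring.
have c2 : orient (p i) (p m) (p j) = - orient (p i) (p j) (p m) by rewrite /orient; ring.
move: ne; rewrite neq_lt; case: (boolP (lexo m i)) => [hmi|hmi].
  case/orP => h.
    by have := slopes_neg hmi ij; rewrite c1 h => /(_ isT) /andP[a b]; rewrite (ltnW (ltn_trans a b)).
  have := slopes_pos hmi ij; rewrite c1 h => /(_ isT) /andP[a b].
  by rewrite leqNgt (ltn_trans a b) /= [RHS]ltNge ltW.
have him : lexo i m by have := lexo_total im; rewrite (negbTE hmi) orbF.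
rewrite him /=; case: (boolP (lexo m j)) => [hmj|hmj].
  case/orP => h.
    by have := slopes_pos him hmj; rewrite c2 oppr_gt0 h => /(_ isT) /andP[-> _].
  have := slopes_neg him hmj; rewrite c2 oppr_lt0 h => /(_ isT) /andP[_ a].
  by rewrite ltnNge (ltnW a) [RHS]ltNge (ltW h).
have hjm : lexo j m by have := lexo_total jm; rewrite (negbTE hmj) orbF.
case/orP => h.
  by have := slopes_neg ij hjm h => /andP[_ ->].
by have := slopes_pos ij hjm h => /andP[a _]; rewrite ltnNge (ltnW a) [RHS]ltNge (ltW h).
Qed.

End Geometry.

(** For a symmetric summand the choice of one order for each pair does not matter; this passes from
    the lexicographic order to that of the indices. *)
Lemma sum_tournament n (o : rel 'I_n) (F : 'I_n -> 'I_n -> nat) :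
  irreflexive o -> (forall i j, i != j -> o i j = ~~ o j i) -> (forall i j, F i j = F j i) ->
  ((\sum_(u : 'I_n * 'I_n | o u.1 u.2) F u.1 u.2).*2 = \sum_(u : 'I_n * 'I_n | u.1 != u.2) F u.1 u.2)%N.
Proof.
move=> irr tot sym; rewrite [RHS](bigID (fun u => o u.1 u.2)) /= -addnn; congr (_ + _)%N.
  apply: eq_bigl => -[i j] /=; have [->|//] := eqVneq i j; by rewrite irr.
have sw : injective (fun u : 'I_n * 'I_n => (u.2, u.1)) by move=> [a b] [c d] [-> ->].
rewrite (reindex_inj sw) /=; apply: eq_big => [[i j]|[i j] _] /=; last exact: sym.
by have [->|ij] := eqVneq i j; rewrite ?irr //= tot // eq_sym.
Qed.

Section Sides.
Variables (R : realType) (n : nat) (p : 'I_n -> point R).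
Implicit Types (i j k m : 'I_n).
Hypothesis gp : general_position p.

Definition right i j := #|[set m | orient (p i) (p j) (p m) < 0]|.

Lemma right_left i j : i != j -> (right i j + right j i + 2 = n)%N.
Proof.
move=> ij; rewrite -[RHS]card_ord -(cardsC [set i; j]) cards2 ij addnC; congr (_ + _)%N.
rewrite /right -!sum1_card big_mkcond [X in (_ + X)%N]big_mkcond [RHS]big_mkcond -big_split /=; apply: eq_bigr => m _.
rewrite !inE; have -> : orient (p j) (p i) (p m) = - orient (p i) (p j) (p m) by rewrite /orient; ring.
rewrite oppr_lt0; have [->|mi] := eqVneq m i; first by rewrite /orient !subrr !mulr0 subrr ltxx.
have [->|mj] := eqVneq m j; first by rewrite /orient mulrC subrr ltxx.
have ne : orient (p i) (p j) (p m) != 0 by case: gp => _; apply => //; rewrite eq_sym.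
by move: ne; case: ltgtP.
Qed.

Lemma lexo_compl i j : i != j -> lexo p i j = ~~ lexo p j i.
Proof.
move=> ij; apply/idP/idP => [h|h]; last by have := lexo_total gp ij; rewrite (negbTE h) orbF.
by apply/negP => h'; have := lexo_trans h h'; rewrite lexo_irr.
Qed.

Lemma slopes_size : (size (slopes p)).*2 = (n * n.-1)%N.
Proof.
have -> : size (slopes p) = \sum_(u : 'I_n * 'I_n | lexpair p u) 1.
  by rewrite size_sort size_filter -sum1_count big_enum_cond.
rewrite (@sum_tournament n (lexo p) (fun _ _ => 1%N)) //; first last.
- exact: lexo_compl.
- exact: lexo_irr.
rewrite -(pair_big_dep xpredT (fun i j => i != j) (fun _ _ => 1%N)) /=.
under eq_bigr => i _.
  rewrite sum1_card (eq_card (B := predC1 i)); last by move=> j; rewrite !inE eq_sym.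
  rewrite cardC1 card_ord.
  over.
by rewrite sum_nat_const card_ord.
Qed.

Lemma right_bound : n = 30 ->
  (\sum_(u : 'I_n * 'I_n | u.1 < u.2) right u.1 u.2 * right u.2 u.1 <= 219 * 331)%N.
Proof.
move=> n30; have M435 : size (slopes p) = 435 by apply: double_inj; rewrite slopes_size n30.
have Mpos : (0 < size (slopes p))%N by rewrite M435.
have [e0 _] : exists e0 : 'I_n * 'I_n, e0 \in slopes p.
  by case: (slopes p) Mpos => // e s _; exists e; rewrite mem_head.
pose q := aseq_of (@lexo_irr _ _ p) (@lexo_trans _ _ p) (lexo_total gp) (slopes_uniq p)
  (@mem_slopes _ _ p) Mpos (slopes_between gp) e0.
have := gates_bound q n30 M435.
suff -> : (\sum_(0 <= t < size (slopes p)) gt q t * (28 - gt q t) =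
  \sum_(u : 'I_n * 'I_n | u.1 < u.2) right u.1 u.2 * right u.2 u.1)%N by [].
transitivity (\sum_(u : 'I_n * 'I_n | lexo p u.1 u.2) right u.1 u.2 * right u.2 u.1)%N.
  transitivity (\sum_(u <- slopes p) right u.1 u.2 * right u.2 u.1)%N.
    rewrite (big_nth e0) big_nat [RHS]big_nat; apply: eq_bigr => t /= tM.
    have [o12 x12] := L12 (slopes_uniq p) (@mem_slopes _ _ p) e0 tM.
    have -> : gt q t = right (nth e0 (slopes p) t).1 (nth e0 (slopes p) t).2.
      rewrite /gt aseq_gate // /right; apply: eq_card => m; rewrite !inE.
      by rewrite -{1}x12 before_right.
    have := right_left (lexo_neq o12); move: (right _ _) (right _ _) => a b e.
    by rewrite -[b](_ : 28 - a = b)%N //; move: e; rewrite n30; clear; lia.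
  by rewrite (perm_big _ (permEl (perm_sort _ _))) big_filter big_enum_cond.
have sym i j : (right i j * right j i = right j i * right i j)%N by rewrite mulnC.
apply: double_inj; apply: etrans (sum_tournament (@lexo_irr _ _ p) (lexo_compl) sym) _.
apply: esym (sum_tournament (o := fun i j : 'I_n => (i < j)%N) _ _ sym) => [i|i j ij].
  exact: ltnn.
by rewrite -leqNgt ltn_neqAle ij.
Qed.

End Sides.

(** * Counting crossings by separations *)

Section Sum4.
Variable n : nat.
Implicit Types f g : 'I_n -> 'I_n -> 'I_n -> 'I_n -> bool.

Definition S4 f := (\sum_i \sum_j \sum_k \sum_l f i j k l)%N.

Lemma S4_12 f : S4 (fun i j k l => f j i k l) = S4 f.
Proof. by rewrite /S4 exchange_big. Qed.
Lemma S4_23 f : S4 (fun i j k l => f i k j l) = S4 f.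
Proof. by apply: eq_bigr => i _; rewrite exchange_big. Qed.
Lemma S4_34 f : S4 (fun i j k l => f i j l k) = S4 f.
Proof. by apply: eq_bigr => i _; apply: eq_bigr => j _; rewrite exchange_big. Qed.

Lemma eq_S4 f g : (forall i j k l, f i j k l = g i j k l) -> S4 f = S4 g.
Proof. by move=> h; do 4![apply: eq_bigr => ? _]; rewrite h. Qed.

Lemma S4_add (f g h : 'I_n -> 'I_n -> 'I_n -> 'I_n -> bool) : (forall i j k l, f i j k l = g i j k l + h i j k l :> nat)%N -> S4 f = (S4 g + S4 h)%N.
Proof.
move=> e; rewrite /S4 -big_split; apply: eq_bigr => i _; rewrite -big_split; apply: eq_bigr => j _.
by rewrite -big_split; apply: eq_bigr => k _; rewrite -big_split; apply: eq_bigr => l _; rewrite e.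
Qed.

Lemma S4_set f : #|[set q : 'I_n * 'I_n * 'I_n * 'I_n | let: (i, j, k, l) := q in f i j k l]| = S4 f.
Proof.
rewrite /S4 pair_bigA pair_bigA pair_bigA -sum1_card big_mkcond /=.
by apply: eq_bigr => -[[[i j] k] l] _; rewrite inE /=; case: (f i j k l).
Qed.

Definition distinct (i j k l : 'I_n) := uniq [:: l; k; j; i].

Lemma sum_notin m (s : seq 'I_n) : size s = m -> (\sum_l uniq (l :: s) = uniq s * (n - m))%N.
Proof.
move=> <-; have [u|nu] := boolP (uniq s); last by rewrite big1 // => l _; rewrite /= (negbTE nu) andbF.
rewrite mul1n -(card_uniqP u) -[X in (X - _)%N](card_ord n) -(cardC (mem s)) addKn -sum1_card [RHS]big_mkcond.
by apply: eq_bigr => l _; rewrite /= u andbT inE; case: (l \in s).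
Qed.

Lemma S4_distinct : S4 distinct = (n * n.-1 * (n - 2) * (n - 3))%N.
Proof.
rewrite /S4; under eq_bigr => i _.
  under eq_bigr => j _.
    under eq_bigr => k _ do rewrite (sum_notin (m := 3)) //.
    rewrite -big_distrl (sum_notin (m := 2)) //; over.
  rewrite -!big_distrl (sum_notin (m := 1)) //; over.
by rewrite -!big_distrl /= sum_nat_const card_ord muln1 subn1.
Qed.
End Sum4.

Section Crossing.
Variables (R : realType) (n : nat) (p : 'I_n -> point R).
Implicit Types (i j k l m : 'I_n).
Hypothesis gp : general_position p.
Notation D := (@distinct n).

Definition neg i j k := orient (p i) (p j) (p k) < 0.
(** The line through [i] and [j] separates [k] from [l]; two segments cross when each line separates
    the ends of the other segment. *)
Definition sep i j k l := neg i j k (+) neg i j l.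
Definition cro i j k l := sep i j k l && sep k l i j.

Lemma distinctE i j k l : D i j k l = [&& i != j, i != k, i != l, j != k, j != l & k != l].
Proof.
rewrite /distinct /= !inE !negb_or !andbT [l == k]eq_sym [l == j]eq_sym [l == i]eq_sym [k == j]eq_sym.
rewrite [k == i]eq_sym [j == i]eq_sym.
by do 6!case: (_ == _).
Qed.

Lemma orient_neq0 i j k : i != j -> i != k -> j != k -> orient (p i) (p j) (p k) != 0.
Proof. by move=> ij ik jk; case: gp => _; apply. Qed.

Lemma orient_rot (a b c : point R) : orient b c a = orient a b c.
Proof. by rewrite /orient; ring. Qed.
Lemma orient_swap (a b c : point R) : orient b a c = - orient a b c.
Proof. by rewrite /orient; ring. Qed.

Lemma neg_rot i j k : neg j k i = neg i j k.
Proof. by rewrite /neg orient_rot. Qed.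

Lemma neg_swap i j k : i != j -> i != k -> j != k -> neg i k j = ~~ neg i j k.
Proof.
move=> ij ik jk; rewrite /neg; have -> : orient (p i) (p k) (p j) = - orient (p i) (p j) (p k).
  by rewrite /orient; ring.
by rewrite oppr_lt0 -leNgt lt0r orient_neq0.
Qed.

(** In convex position there is one crossing, and the two diagonals separate the other points. With
    one point inside the triangle of the others there is no crossing, and the three lines through it
    separate. *)
Lemma four_points i j k l : D i j k l ->
  (cro i j k l + cro i k j l + cro i l j k + (sep i j k l + sep i k j l + sep i l j k +
   sep j k i l + sep j l i k + sep k l i j) = 3)%N.
Proof.
rewrite distinctE => /and5P[ij ik il jk /andP[jl kl]].
rewrite /cro /sep (neg_rot i j k) (neg_rot i j l) (neg_rot i k l) (neg_rot j k l).
rewrite (neg_swap ij ik jk) (neg_swap ij il jl) (neg_swap ik il kl) (neg_swap jk jl kl).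
(* Of the sixteen sign patterns, this relation excludes two; the other fourteen are checked. *)
have e : orient (p i) (p j) (p k) + orient (p i) (p k) (p l) =
         orient (p i) (p j) (p l) + orient (p j) (p k) (p l) by rewrite /orient; ring.
have x1 : ~~ [&& neg i j k, neg i k l, ~~ neg i j l & ~~ neg j k l].
  by apply/negP => /and4P[]; rewrite /neg -!leNgt; lra.
have x2 : ~~ [&& ~~ neg i j k, ~~ neg i k l, neg i j l & neg j k l].
  by apply/negP => /and4P[]; rewrite /neg -!leNgt; lra.
move: x1 x2; case: (neg i j k); case: (neg i k l); case: (neg i j l); by case: (neg j k l).
Qed.

Notation Dc f := (fun i j k l => D i j k l && f i j k l).

Lemma D_12 i j k l : D j i k l = D i j k l.
Proof. by rewrite !distinctE [j == i]eq_sym; do 6!case: (_ == _). Qed.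
Lemma D_23 i j k l : D i k j l = D i j k l.
Proof. by rewrite !distinctE [k == j]eq_sym; do 6!case: (_ == _). Qed.
Lemma D_34 i j k l : D i j l k = D i j k l.
Proof. by rewrite !distinctE [l == k]eq_sym; do 6!case: (_ == _). Qed.

Lemma sep_flip i j k l : D i j k l -> sep j i k l = sep i j k l.
Proof.
rewrite distinctE => /and5P[ij ik il jk /andP[jl kl]]; rewrite /sep -2!(neg_rot j i).
by rewrite (neg_swap ij ik jk) (neg_swap ij il jl); do 2!case: (neg _ _ _).
Qed.

Lemma sep_sym i j k l : sep i j l k = sep i j k l.
Proof. by rewrite /sep addbC. Qed.

Lemma S4_perm f : [/\ S4 (Dc (fun i j k l => f i k j l)) = S4 (Dc f),
  S4 (Dc (fun i j k l => f i l j k)) = S4 (Dc f), S4 (Dc (fun i j k l => f j k i l)) = S4 (Dc f),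
  S4 (Dc (fun i j k l => f j l i k)) = S4 (Dc f) & S4 (Dc (fun i j k l => f k l i j)) = S4 (Dc f)].
Proof.
have p1 g : S4 (Dc (fun i j k l => g i k j l)) = S4 (Dc g).
  by rewrite -[RHS]S4_23; apply: eq_S4 => i j k l; rewrite D_23.
have p2 g : S4 (Dc (fun i j k l => g j i k l)) = S4 (Dc g).
  by rewrite -[RHS]S4_12; apply: eq_S4 => i j k l; rewrite D_12.
have p3 g : S4 (Dc (fun i j k l => g i j l k)) = S4 (Dc g).
  by rewrite -[RHS]S4_34; apply: eq_S4 => i j k l; rewrite D_34.
have p4 g : S4 (Dc (fun i j k l => g i l j k)) = S4 (Dc g).
  by rewrite -(p1 g) -(p3 (fun i j k l => g i k j l)).
have p5 g : S4 (Dc (fun i j k l => g j k i l)) = S4 (Dc g).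
  by rewrite -(p1 g) -(p2 (fun i j k l => g i k j l)).
have p6 g : S4 (Dc (fun i j k l => g j l i k)) = S4 (Dc g).
  by rewrite -(p5 g) -(p3 (fun i j k l => g j k i l)).
have p7 g : S4 (Dc (fun i j k l => g k l i j)) = S4 (Dc g).
  by rewrite -(p6 g) -(p1 (fun i j k l => g j l i k)).
by split.
Qed.

Lemma S4_three (f g h a b c d e u : 'I_n -> 'I_n -> 'I_n -> 'I_n -> bool) : (forall i j k l, D i j k l ->
  f i j k l + g i j k l + h i j k l + (a i j k l + b i j k l + c i j k l + d i j k l + e i j k l + u i j k l) = 3)%N ->
  (S4 (Dc f) + S4 (Dc g) + S4 (Dc h) + (S4 (Dc a) + S4 (Dc b) + S4 (Dc c) + S4 (Dc d) + S4 (Dc e) + S4 (Dc u))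
   = 3 * S4 D)%N.
Proof.
move=> H; rewrite /S4 !big_distrr /= -!big_split; apply: eq_bigr => i _ /=.
rewrite !big_distrr /= -!big_split; apply: eq_bigr => j _ /=.
rewrite !big_distrr /= -!big_split; apply: eq_bigr => k _ /=.
rewrite !big_distrr /= -!big_split; apply: eq_bigr => l _ /=.
by case dd: (D i j k l) => //=; rewrite muln1 H.
Qed.

Lemma cro_sep_total : (S4 (Dc cro) + 2 * S4 (Dc sep) = n * n.-1 * (n - 2) * (n - 3))%N.
Proof.
have := S4_three four_points; rewrite S4_distinct.
have [c1 c2 _ _ _] := S4_perm cro; have [s1 s2 s3 s4 s5] := S4_perm sep.
rewrite c1 c2 s1 s2 s3 s4 s5; move: (S4 _) (S4 _) (_ * _ * _ * _)%N; clear; lia.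
Qed.

Lemma neg_neq i j k : neg i j k -> [/\ i != j, i != k & j != k].
Proof.
rewrite /neg => h; split; apply: contraTneq h => ->; rewrite /orient -leNgt.
- by rewrite !subrr !mul0r subrr.
- by rewrite !subrr !mulr0 subrr.
- by rewrite mulrC subrr.
Qed.

(** The factor 4 comes from the two orders of [i], [j] and the choice of which of [k], [l] lies on
    the right. *)
Lemma sep_right : S4 (Dc sep) = (4 * \sum_(u : 'I_n * 'I_n | (u.1 < u.2)%N) right p u.1 u.2 * right p u.2 u.1)%N.
Proof.
pose T := S4 (Dc (fun i j k l => neg i j k && ~~ neg i j l)).
have -> : S4 (Dc sep) = (T + T)%N.
  have {2}-> : T = S4 (Dc (fun i j k l => neg i j l && ~~ neg i j k)).
    by rewrite -[RHS]S4_34; apply: eq_S4 => i j k l; rewrite D_34.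
  apply: S4_add => i j k l; rewrite /sep; case: (D i j k l) => //=.
  by case: (neg i j k); case: (neg i j l).
have -> : T = S4 (fun i j k l => [&& i != j, neg i j k & neg j i l]).
  apply: eq_S4 => i j k l; apply/idP/idP.
    rewrite distinctE => /and3P[/and5P[ij ik il jk /andP[jl kl]] h1 h2].
    by rewrite ij h1 -neg_rot neg_swap.
  case/and3P => ij h1 h2; have [_ ik jk] := neg_neq h1; have [_ jl il] := neg_neq h2.
  have h3 : ~~ neg i j l by rewrite -neg_swap // neg_rot.
  rewrite distinctE ij ik il jk jl h1 h3 !andbT; apply: contraNneq h3 => <-; exact: h1.
have -> : S4 (fun i j k l => [&& i != j, neg i j k & neg j i l]) =
    (\sum_(u : 'I_n * 'I_n | u.1 != u.2) right p u.1 u.2 * right p u.2 u.1)%N.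
  rewrite /S4 pair_bigA [RHS]big_mkcond /=; apply: eq_bigr => -[i j] _ /=.
  case: (i != j) => /=; last by rewrite big1 // => k _; rewrite big1.
  have rE a b : right p a b = (\sum_m neg a b m)%N.
    rewrite /right -sum1_card big_mkcond; apply: eq_bigr => m _; rewrite inE -/(neg a b m).
    by case: (neg a b m).
  rewrite !rE big_distrl; apply: eq_bigr => k _; rewrite big_distrr; apply: eq_bigr => l _ /=.
  by case: (neg i j k); case: (neg j i l).
have sym i j : (right p i j * right p j i = right p j i * right p i j)%N by rewrite mulnC.
have <- := sum_tournament (o := fun i j : 'I_n => (i < j)%N) _ _ sym.
- by move: (\sum_(_ | _) _)%N; clear; lia.
- exact: ltnn.
by move=> i j ij; rewrite -leqNgt ltn_neqAle ij.
Qed.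

Lemma orient_on (a b c d : point R) t :
  orient c d (a.1 + t * (b.1 - a.1), a.2 + t * (b.2 - a.2)) =
  (1 - t) * orient c d a + t * orient c d b.
Proof. by rewrite /orient /=; ring. Qed.

Lemma same_side (x y t : R) : 0 <= t <= 1 -> x != 0 -> y != 0 ->
  (1 - t) * x + t * y = 0 -> (x < 0) != (y < 0).
Proof.
move=> /andP[t0 t1] x0 y0 e; apply/eqP => s; have [xn|xp] := ltrP x 0.
  have yn : y < 0 by rewrite -s.
  have [tz|tz] := eqVneq t 0; first by move: e; rewrite tz; lra.
  have tp : 0 < t by rewrite lt0r tz.
  by nra.
have yp : 0 <= y by rewrite leNgt -s -leNgt.
have xp' : 0 < x by rewrite lt0r x0.
have yp' : 0 < y by rewrite lt0r y0.
by nra.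
Qed.

(** The crossing point has parameters [u / (u - v)] and [w / (w - z)] on the two segments, with
    [w - z = - (u - v)], so that one denominator can be cleared. *)
Lemma param_eq (a b c d u v w : R) : u - v != 0 ->
  a * (u - v) + u * b = c * (u - v) - w * d ->
  a + u / (u - v) * b = c + w / - (u - v) * d.
Proof.
move: (u - v) => q q0 e; apply: (mulIf q0).
have -> : (a + u / q * b) * q = a * q + u * b by field.
by rewrite e; field.
Qed.

Lemma meet_cro i j k l : D i j k l ->
  `[< segments_meet (p i) (p j) (p k) (p l) >] = cro i j k l.
Proof.
rewrite distinctE => /and5P[ij ik il jk /andP[jl kl]].
have [ki li kj lj] : [/\ k != i, l != i, k != j & l != j].
  by rewrite ![_ == i]eq_sym ![_ == j]eq_sym.
have a0 := orient_neq0 ij ik jk; have b0 := orient_neq0 ij il jl.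
have c0 := orient_neq0 kl ki li; have d0 := orient_neq0 kl kj lj.
rewrite /cro /sep /neg; apply/asboolP/andP => [[t [s [ht hs e1 e2]]]|[h1 h2]].
  have := orient_on (p k) (p l) (p i) (p j) s; rewrite -e1 -e2.
  have -> : orient (p i) (p j) ((p i).1 + t * ((p j).1 - (p i).1), (p i).2 + t * ((p j).2 - (p i).2)) = 0.
    by rewrite /orient /=; ring.
  move=> /esym /(same_side hs a0 b0) h1.
  have := orient_on (p i) (p j) (p k) (p l) t; rewrite e1 e2.
  have -> : orient (p k) (p l) ((p k).1 + s * ((p l).1 - (p k).1), (p k).2 + s * ((p l).2 - (p k).2)) = 0.
    by rewrite /orient /=; ring.
  move=> /esym /(same_side ht c0 d0) h2.
  by move: h1 h2; do 4!case: (_ < _).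
have wz : orient (p i) (p j) (p k) - orient (p i) (p j) (p l) =
  - (orient (p k) (p l) (p i) - orient (p k) (p l) (p j)) by rewrite /orient; ring.
set u := orient (p k) (p l) (p i) in c0 h2 wz *; set v := orient (p k) (p l) (p j) in d0 h2 wz *.
set w := orient (p i) (p j) (p k) in a0 h1 wz *; set z := orient (p i) (p j) (p l) in b0 h1 wz *.
have frac (x y : R) : x != 0 -> y != 0 -> (x < 0) (+) (y < 0) -> x - y != 0 /\ 0 <= x / (x - y) <= 1.
  move=> x0 y0; have [xn|xp] := ltrP x 0; have [yn|yp] := ltrP y 0 => // _.
    have xy : x - y < 0 by lra.
    split; first by rewrite lt_eqF.
    by rewrite ler_ndivlMr // ler_ndivrMr // mul0r mul1r; lra.
  have xy : 0 < x - y by lra.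
  split; first by rewrite gt_eqF.
  by rewrite ler_pdivlMr // ler_pdivrMr // mul0r mul1r; lra.
have [uv ht] := frac u v c0 d0 h2; have [wz0 hs] := frac w z a0 b0 h1.
exists (u / (u - v)), (w / (w - z)); split=> //.
- by rewrite wz; apply: param_eq => //; rewrite /u /v /w /orient; ring.
by rewrite wz; apply: param_eq => //; rewrite /u /v /w /orient; ring.
Qed.

Lemma cro_half (g : 'I_n -> 'I_n -> 'I_n -> 'I_n -> bool) (a : 'I_n -> 'I_n -> 'I_n -> 'I_n -> bool)
    (b : 'I_n -> 'I_n -> 'I_n -> 'I_n -> bool) :
  (forall i j k l, g i j k l -> b i j k l = ~~ a i j k l) ->
  S4 (fun i j k l => g i j k l && b i j k l) = S4 (fun i j k l => g i j k l && a i j k l) ->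
  S4 g = (2 * S4 (fun i j k l => g i j k l && a i j k l))%N.
Proof.
move=> h e; rewrite mul2n -addnn -{2}e; apply: S4_add => i j k l.
by case gg: (g i j k l) => //=; rewrite h //; case: (a i j k l).
Qed.

(** Each of the conditions [i < j], [k < l], [i < k] selects one half of the ordered quadruples. *)
Lemma cro_crossings : S4 (Dc cro) = (8 * crossings p)%N.
Proof.
have cs i j k l : D i j k l -> cro j i k l = cro i j k l.
  by move=> d; rewrite /cro (sep_flip d) [sep k l j i]sep_sym.
have ct i j k l : cro k l i j = cro i j k l by rewrite /cro andbC.
pose g1 i j k l := D i j k l && cro i j k l.
pose g2 (i j k l : 'I_n) := g1 i j k l && (i < j)%N.
pose g3 (i j k l : 'I_n) := g2 i j k l && (k < l)%N.
pose g4 (i j k l : 'I_n) := g3 i j k l && (i < k)%N.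
have dn i j k l : g1 i j k l -> [&& i != j, k != l & i != k].
  by case/andP; rewrite distinctE => /and5P[-> -> _ _ /andP[_ ->]].
have lt (i j : 'I_n) : i != j -> (j < i)%N = ~~ (i < j)%N.
  by move=> ij; rewrite -leqNgt ltn_neqAle eq_sym ij.
have gs1 i j k l : g1 j i k l = g1 i j k l.
  by rewrite /g1 D_12; case d: (D i j k l) => //=; apply: cs.
have gs3 i j k l : g1 k l i j = g1 i j k l.
  by rewrite /g1 ct; congr (_ && _); rewrite !distinctE; rewrite ![k == _]eq_sym ![l == _]eq_sym; do 6!case: (_ == _).
have gs2 i j k l : g1 i j l k = g1 i j k l by rewrite -gs3 gs1 gs3.
have h1 : S4 g1 = (2 * S4 g2)%N.
  apply: (@cro_half g1 (fun i j _ _ => (i < j)%N) (fun i j _ _ => (j < i)%N)) => [i j k l /dn/and3P[/lt]//|].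
  by rewrite -[RHS]S4_12; apply: eq_S4 => i j k l; rewrite gs1.
have h2 : S4 g2 = (2 * S4 g3)%N.
  apply: (@cro_half g2 (fun _ _ k l => (k < l)%N) (fun _ _ k l => (l < k)%N)).
    by move=> i j k l /andP[/dn/and3P[_ /lt]].
  by rewrite -[RHS]S4_34; apply: eq_S4 => i j k l; rewrite /g2 gs2.
have h3 : S4 g3 = (2 * S4 g4)%N.
  apply: (@cro_half g3 (fun i _ k _ => (i < k)%N) (fun i _ k _ => (k < i)%N)).
    by move=> i j k l /andP[/andP[/dn/and3P[_ _ /lt]]].
  rewrite -[RHS]S4_23 -[RHS]S4_12 -[RHS]S4_34 -[RHS]S4_23; apply: eq_S4 => i j k l.
  by rewrite /g3 /g2 gs3; congr (_ && _); rewrite -!andbA [(k < l)%N && _]andbC.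
rewrite -/(S4 g1) h1 h2 h3 !mulnA; congr (_ * _)%N; rewrite /crossings S4_set; apply: eq_S4 => i j k l.
rewrite /g4 /g3 /g2 /g1; case dd: (D i j k l); last first.
  apply/esym/negP => /and5P[ij kl ik il /and3P[jk jl _]]; move: dd; rewrite distinctE il jk jl.
  by rewrite !neq_ltn ij kl ik.
rewrite (meet_cro dd); move: dd; rewrite distinctE => /and5P[_ _ -> -> /andP[-> _]].
by do 3!case: (_ < _)%N; case: (cro i j k l).
Qed.

Theorem crossings_formula :
  (8 * (crossings p + \sum_(u : 'I_n * 'I_n | (u.1 < u.2)%N) right p u.1 u.2 * right p u.2 u.1) =
   n * n.-1 * (n - 2) * (n - 3))%N.
Proof.
have := cro_sep_total; rewrite cro_crossings sep_right => <-.
by move: (crossings p) (\sum_(_ | _) _)%N; clear; lia.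
Qed.

End Crossing.

(** * A drawing with 9726 crossings *)

Definition spin (a : Z * Z) : seq (Z * Z) :=
  [:: a; (- a.2, a.1 - a.2); (a.2 - a.1, - a.1)]%BZ.

(* spin a is the orbit of a under the map (x, y) |-> (-y, x - y) of order 3, an
   affine image of the rotation by 120 degrees; ten orbits were found by search. *)
Definition example : seq (Z * Z) := flatten [seq spin a | a <-
  [:: (3237, -952); (2897, -1130); (2142, 1028); (7315, 1062); (9023, 680); (10850, 480);
   (15278, 1274); (14732, 1256); (25228, 2663); (27085, 2916)]%BZ].

Definition zorient (a b c : Z * Z) : Z :=
  ((b.1 - a.1) * (c.2 - a.2) - (b.2 - a.2) * (c.1 - a.1))%BZ.

Fixpoint zright (a b : Z * Z) (s : seq (Z * Z)) : nat :=
  if s is c :: s' then (if (zorient a b c <? 0)%BZ then (zright a b s').+1 else zright a b s') else 0.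

Fixpoint pairs_all (T : Type) (f : T -> T -> bool) (s : seq T) : bool :=
  if s is a :: s' then all (f a) s' && pairs_all f s' else true.

Fixpoint pairs_sum (T : Type) (f : T -> T -> nat) (s : seq T) : Z :=
  if s is a :: s' then foldr (fun b z => (Z.of_nat (f a b) + z)%BZ) (pairs_sum f s') s' else 0%BZ.

Fixpoint triples_ok (s : seq (Z * Z)) : bool :=
  if s is a :: s' then pairs_all (fun b c => negb (Z.eqb (zorient a b c) 0)) s' && triples_ok s' else true.

Lemma example_size : size example = 30. Proof. by []. Qed.
Lemma example_uniq : uniq example. Proof. by vm_compute. Qed.
Lemma example_triples : triples_ok example. Proof. by vm_compute. Qed.
(** The value required by [8 * (9726 + 72489) = 30 * 29 * 28 * 27]. The other side of each line has
    [28 - k] points; the total is kept in binary. *)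
Lemma example_sum : pairs_sum (fun a b => let k := zright a b example in muln k (subn 28 k)) example = 72489%BZ.
Proof. by vm_compute. Qed.

Lemma pairs_allP (T : Type) (x0 : T) f (s : seq T) i j : pairs_all f s -> (i < j < size s)%N ->
  f (nth x0 s i) (nth x0 s j).
Proof.
elim: s i j => [|a s IH] i j /=; first by rewrite ltn0 andbF.
move=> /andP[h1 h2] /andP[]; case: j => // j; rewrite ltnS => ij js.
case: i ij => [|i] ij /=; first by apply: (all_nthP x0 h1).
by apply: IH => //; rewrite ij.
Qed.

Lemma triples_okP (x0 : Z * Z) s i j k : triples_ok s -> (i < j)%N -> (j < k < size s)%N ->
  zorient (nth x0 s i) (nth x0 s j) (nth x0 s k) <> 0%BZ.
Proof.
elim: s i j k => [|a s IH] i j k /=; first by rewrite ltn0 andbF.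
move=> /andP[h1 h2] ij; case: j ij => // j; rewrite ltnS => ij.
case: k => //= k; rewrite !ltnS => jk; case: i ij => [|i] ij /=; last exact: IH.
by have := pairs_allP x0 h1 jk => /negP h e; apply: h; rewrite e.
Qed.

Lemma pairs_sumE (T : Type) (x0 : T) f (s : seq T) : pairs_sum f s =
  Z.of_nat (\sum_(0 <= i < size s) \sum_(0 <= j < size s) (i < j) * f (nth x0 s i) (nth x0 s j))%N.
Proof.
elim: s => [|a s IH]; first by rewrite big_geq.
rewrite [size _]/= big_nat_recl // big_nat_recl // ltnn mul0n add0n.
have -> : pairs_sum f (a :: s) = (Z.of_nat (\sum_(0 <= j < size s) f a (nth x0 s j)) + pairs_sum f s)%BZ.
  rewrite /=; move: (pairs_sum f s) => z; elim: s {IH} => [|b s IH] /=; first by rewrite big_geq.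
  by rewrite big_nat_recl //= IH; lia.
rewrite IH -Nat2Z.inj_add; congr (Z.of_nat (_ + _)%N).
  by apply: eq_bigr => j _; rewrite mul1n.
by apply: eq_bigr => i _; rewrite big_nat_recl // ltn0 mul0n add0n.
Qed.

Section Example.
Variable R : realType.

Definition zr (z : Z) : R := (int_of_Z z)%:~R.

Lemma zrB a b : zr (a - b)%BZ = zr a - zr b.
Proof. by rewrite /zr -intrB; congr (_%:~R); lia. Qed.
Lemma zrM a b : zr (a * b)%BZ = zr a * zr b.
Proof. by rewrite /zr -intrM; congr (_%:~R); lia. Qed.
Lemma zr_lt0 a : (zr a < 0) = (a <? 0)%BZ.
Proof. by rewrite /zr ltrz0; lia. Qed.
Lemma zr_inj : injective zr.
Proof. by move=> a b /intr_inj; lia. Qed.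

Definition pt (a : Z * Z) : point R := (zr a.1, zr a.2).
Lemma orient_pt a b c : orient (pt a) (pt b) (pt c) = zr (zorient a b c).
Proof. by rewrite /orient /zorient /= !(zrB, zrM). Qed.

Let x0 : Z * Z := (0%BZ, 0%BZ).
Definition ex (i : 'I_30) : point R := pt (nth x0 example i).

Lemma ex_gp : general_position ex.
Proof.
have lt (i : 'I_30) : (i < size example)%N by rewrite example_size.
split=> [i j /(congr1 (fun q : point R => (q.1, q.2)))|i j k].
  case=> /zr_inj e1 /zr_inj e2; apply/val_inj/eqP.
  rewrite -(nth_uniq x0 (lt i) (lt j) example_uniq).
  by rewrite (surjective_pairing (nth x0 example i)) e1 e2 -surjective_pairing.
have pos (a b c : 'I_30) : (a < b)%N -> (b < c)%N -> orient (ex a) (ex b) (ex c) != 0.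
  move=> ab bc; rewrite orient_pt -[0]/(zr 0%BZ) (inj_eq zr_inj); apply/eqP.
  apply: triples_okP; [exact: example_triples|by []|by rewrite bc lt].
have rot (a b c : 'I_30) : orient (ex b) (ex c) (ex a) = orient (ex a) (ex b) (ex c) by exact: orient_rot.
have swp (a b c : 'I_30) : orient (ex b) (ex a) (ex c) = - orient (ex a) (ex b) (ex c) by exact: orient_swap.
move=> ij jk ik; rewrite !neq_ltn in ij jk ik.
case/orP: ij => ij; case/orP: jk => jk; case/orP: ik => ik.
- exact: pos.
- by have := ltn_trans (ltn_trans ij jk) ik; rewrite ltnn.
- by rewrite -rot -rot swp oppr_eq0 pos.
- by rewrite -rot -rot pos.
- by rewrite swp oppr_eq0 pos.
- by rewrite -rot pos.
- by have := ltn_trans (ltn_trans ij ik) jk; rewrite ltnn.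
- by rewrite -rot swp oppr_eq0 pos.
Qed.

Lemma zright_count a b s : zright a b s = count (fun c => zorient a b c <? 0)%BZ s.
Proof. by elim: s => //= c s ->; case: (_ <? _)%BZ. Qed.

Lemma right_ex i j : right ex i j = zright (nth x0 example i) (nth x0 example j) example.
Proof.
rewrite zright_count -sum1_count big_mkcond (big_nth x0) example_size big_mkord /right -sum1_card big_mkcond.
by apply: eq_bigr => m _; rewrite inE orient_pt zr_lt0.
Qed.

Lemma ex_sum : Z.of_nat (\sum_(u : 'I_30 * 'I_30 | (u.1 < u.2)%N) right ex u.1 u.2 * right ex u.2 u.1)%N = 72489%BZ.
Proof.
rewrite -example_sum (pairs_sumE x0) example_size; congr Z.of_nat.
transitivity (\sum_(i < 30) \sum_(j < 30) if (i < j)%N then right ex i j * right ex j i else 0)%N.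
  by rewrite big_mkcond pair_bigA.
rewrite big_mkord; apply: eq_bigr => i _; rewrite big_mkord; apply: eq_bigr => j _.
rewrite -right_ex; case: ltnP => [ij|_]; last by rewrite mul0n.
rewrite mul1n; congr (_ * _)%N.
have ne : i != j by rewrite neq_ltn ij.
by have := right_left ex_gp ne; move: (right _ _ _) (right _ _ _) => a b; clear; lia.
Qed.

End Example.

(** Splits the literal so that the final arithmetic works with small numerals. *)
Lemma nat_9726 : 9726%N = (9 * 1000 + 726)%N. Proof. by []. Qed.

Theorem theorem2 (R : realType) : rectilinear_crossing_number_Kn R 30 9726.
Proof.
rewrite nat_9726; split=> [|p gp].
  exists (ex R); split; first exact: ex_gp.
  have := crossings_formula (ex_gp R); have := ex_sum R.
  by move: (crossings _) (\sum_(_ | _) _)%N => c s; clear; lia.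
have := crossings_formula gp; have := right_bound gp erefl.
by move: (crossings _) (\sum_(_ | _) _)%N => c s; clear; lia.
Qed.
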